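(* Let assumptions (A1)–(A6) and (B1)–(B4) of the context hold, and let $n\ge9$, $M\in[n]$ and $\eta\in(0,1/2]$ be such that, for constants $C_0,C_1>0$, $M\le C_0n\eta$ and $n\eta^2\ge C_1$, where $C_0\le\max_{i\in\{0,1\}}\big(\frac{g_{i,\min}}4\big)^{m+1}\frac{V_m}{2L^m}$. Then $$\mathbb E\Big(\Big(\frac{n_1}{n_0}\Big)^2\mathbb E\Big(\Big(\frac{n_0}{n_1}\frac{K_M^0(1)}M-\frac{\mathbb P(D=0)}{\mathbb P(D=1)}\frac{e(X_1)}{1-e(X_1)}\Big)^2\Big|\{D_i\}_{i=1}^n\Big)\mathbf 1(n_0>0)\Big)\lesssim\frac1{\eta^2}\Big(\frac M{n\eta}\Big)^{1/m}+\delta_{H_1}+(\delta_{H_2}+1)\cdot\frac1{\eta^2M}+\delta_{H_3},$$ and $$\mathbb E\Big(\Big(\frac{n_0}{n_1}\Big)^2\mathbb E\Big(\Big(\frac{n_1}{n_0}\frac{K_M^1(1)}M-\frac{\mathbb P(D=1)}{\mathbb P(D=0)}\frac{1-e(X_1)}{e(X_1)}\Big)^2\Big|\{D_i\}_{i=1}^n\Big)\mathbf 1(n_1>0)\Big)\lesssim\frac1{\eta^2}\Big(\frac M{n\eta}\Big)^{1/m}+\delta_{H_1}+(\delta_{H_2}+1)\cdot\frac1{\eta^2M}+\delta_{H_3},$$ where $$\delta_{H_1}:=\frac{1}{n^2\eta^4}+\Big(\frac{n}{M\eta}\Big)^2\Big(e^{-(1-\log2)M}+e^{M-r_0n\eta-M\log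 M+M\log(r_0n\eta)}\Big)^2,$$ $$\delta_{H_2}:=\Big(\frac{M}{n\eta}\Big)^{1/m}+\frac{1}{n\eta}+\frac nM\Big(e^{-(1-\log2)M}+e^{M-r_0n\eta-M\log M+M\log(r_0n\eta)}\Big),\qquad \delta_{H_3}:=\Big(\frac{n}{M\eta}\Big)^2e^{-(1-\log2)M},$$ with $r_0:=r_{\rm ratio}\vee r_{{\rm ratio},\phi}$ (both ratios are defined in the context). Moreover, under the assumptions $M^{-1}\log n=o(1)$, $n^{-1}M\log n=o(1)$ and $\eta$ bounded away from $0$, both upper bounds above simplify to $(M/n)^{1/m}+M^{-1}$. Here $a_n\lesssim b_n$ means that there is a constant $C>0$, not depending on $n,M,\eta$, with $a_n\le Cb_n$ for $n$ large enough.
   Context: Setting. $(X,Y,D)\in\mathbb X\times\mathbb R\times\{0,1\}$ with $\mathbb X\subseteq\mathbb R^m$ the support of $X$; there are potential outcomes $Y(0),Y(1)$ and $Y=DY(1)+(1-D)Y(0)$. $\{(X_i,Y_i,D_i)\}_{i=1}^n$ are i.i.d. copies of $(X,Y,D)$. Put $\mu_\omega(x)=\mathbb E(Y|X=x,D=\omega)$, $e(x)=\mathbb P(D=1|X=x)$, $n_1=\sum_{i=1}^nD_i$, $n_0=n-n_1$. Matching counts. $\mathcal J^\omega_M(i)$ is the set of $j\in[n]$ with $D_j=\omega$ and $\sum_{l\in[n],D_l=\omega}\mathbf 1(d(X_l,X_i)\le d(X_j,X_i))\le M$ ($d$ Euclidean distance). The number of matched times for unit $i$ with $D_i=\omega$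 is $K^\omega_M(i)=\sum_{j\in[n],D_j=1-\omega}\mathbf 1(i\in\mathcal J^\omega_M(j))$. The convention $0/0=0$ is used when $n_0=0$ or $n_1=0$. Notation. $[n]=\{1,\dots,n\}$; $a\vee b=\max(a,b)$; $B(x,r)$ is the closed Euclidean ball; $V_m$ the volume of the unit ball in $\mathbb R^m$; $\lambda$ Lebesgue measure. Assumptions ($\hat\mu_\omega$ in (B4) are regression estimators of $\mu_\omega$ based on the sample of size $n$; they do not enter the claim). (A1) $X$ is supported on a compact convex set $\mathbb X\subset\mathbb R^m$. (A2) $X$ has a Lebesgue density $g$ with $0<g_{\min}\le g\le g_{\max}<\infty$ on $\mathbb X$. (A3) For almost all $x\in\mathbb X$, $D$ is independent of $(Y(0),Y(1))$ conditional on $X=x$, and $\eta\le\mathbb P(D=1|X=x)\le1-\eta$ for a constant $\eta\in(0,1/2]$. (A4) Let $g_0,g_1$ be the conditional densities of $X|D=0$, $X|D=1$, with supports $S_0,S_1\subseteq\mathbb X$. For all $x,z\in S_0$ or all $x,z\in S_1$, $|g_0(z)-g_0(x)|\vee|g_1(z)-g_1(x)|\le L\|x-z\|$ for a constant $L>0$; and for $i=0,1$, $0<g_{i,\min}\le g_i\le g_{i,\max}<\infty$ on $S_i$. Put $r_{\rm ratio}=\max_{i=0,1}(g_{i,\min}/g_{i,\max})$. (A5) There is $0<a<1$ such that $\lambda(B(z,\delta)\cap S_0)\ge a\lambda(B(z,\delta))$ for all $0<\delta\le\mathrm{diam}(S_0)$, $z\in S_1$, and $\lambda(B(z,\delta)\cap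 S_1)\ge a\lambda(B(z,\delta))$ for all $0<\delta\le\mathrm{diam}(S_1)$, $z\in S_0$. (A6) The surface areas of $S_0$ and $S_1$ are bounded by a constant $H>0$. (B1) $\mathbb E\mu_\omega^2(X)$ is bounded for $\omega\in\{0,1\}$. (B2) There is $M_l>0$ with $\mathbb E[(Y-\mu_D(X))^2]\ge M_l$; and there are $p>0$, $0<M_{u,p}<\infty$ with $\mathbb E[|Y(\omega)-\mu_\omega(X)|^{4+p}|(X,D)=(x,\omega)]\le M_{u,p}$ for all $(x,\omega)\in\mathbb X\times\{0,1\}$. (B3) $\mu_\omega$ is continuously differentiable up to order $\lfloor m/2\rfloor+1$; in particular $\max_{t\in\Lambda_{\lfloor m/2\rfloor+1}}\|\partial^t\mu_\omega\|_\infty$ is bounded, where $\Lambda_k$ is the set of $t=(t_1,\dots,t_m)$ with nonnegative integer coordinates and $\sum_it_i=k$. (B4) There is $\epsilon_\mu>0$ such that for $\omega\in\{0,1\}$, $\mathbb E\max_{t\in\Lambda_{\lfloor m/2\rfloor+1}}\|\partial^t\hat\mu_\omega\|_\infty^2=O(1)$ and $\mathbb E\max_{l\in[\lfloor m/2\rfloor]}\max_{t\in\Lambda_l}\|\partial^t\mu_\omega-\partial^t\hat\mu_\omega\|_\infty^2=O(n^{-2\gamma_l})$ with constants $\gamma_l>\frac12-\frac lm+\epsilon_\mu$, $l=1,\dots,\lfloor m/2\rfloor$. The ratio $r_{{\rm ratio},\phi}$. This is the analogue of $r_{\rm ratio}$ for the transformation functions $\phi_0,\phi_1:\mathbb X\to\mathbb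 X_\phi\subseteq\mathbb R^{m'}$ used in a transformed (rank-based) version of the matching; these functions enter the present statement only through $r_0$. For $\omega,i\in\{0,1\}$ let $g_{\phi,\omega,i}$ be the conditional density of $\phi_\omega(X)$ given $D=i$, with support $S_{\phi,i}$, and $0<g_{\phi,\omega,i,\min}\le g_{\phi,\omega,i}\le g_{\phi,\omega,i,\max}<\infty$ on $S_{\phi,i}$. Then $r_{{\rm ratio},\phi}=\max_{i=0,1}\max_{\omega=0,1}(g_{\phi,\omega,i,\min}/g_{\phi,\omega,i,\max})$.
   Formalization: K_M^ω(1) is meant only when D_1=ω (setting it to 0 otherwise makes the bound false), so K_M^ω(1) and X_1 are read at unit 1 if D_1=ω, and otherwise at the first unit i with D_i=ω. *)

(* Defs.v *)
From HB Require Import structures.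
From mathcomp Require Import all_boot all_order all_algebra.
From mathcomp Require Import all_classical all_reals all_analysis.
Set Implicit Arguments.
Unset Strict Implicit.
Unset Printing Implicit Defensive.
Import Order.TTheory GRing.Theory Num.Theory.
Import numFieldNormedType.Exports.
Local Open Scope classical_set_scope.
Local Open Scope ring_scope.

Definition rV_display : measure_display -> measure_display.
Proof. exact. Qed.

Section measurable_rV.
Variables (R : realType) (m : nat).

Definition coord (i : 'I_m) (v : 'rV[R]_m) : measurableTypeR R := v ord0 i.

Let rV_set0 : g_sigma_preimage coord set0.
Proof. exact: sigma_algebra0. Qed.

Let rV_setC A : g_sigma_preimage coord A -> g_sigma_preimage coord (~` A).
Proof. exact: sigma_algebraC. Qed.

Let rV_bigcup (F : _^nat) : (forall i, g_sigma_preimage coord (F i)) ->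
  g_sigma_preimage coord (\bigcup_i (F i)).
Proof. exact: sigma_algebra_bigcup. Qed.

HB.instance Definition _ := @isMeasurable.Build (rV_display default_measure_display)
  'rV[R]_m (g_sigma_preimage coord) rV_set0 rV_setC rV_bigcup.

Lemma measurable_coord i : measurable_fun [set: 'rV[R]_m] (coord i).
Proof.
move=> _ Y mY; rewrite setTI; apply: sub_sigma_algebra => /=.
rewrite -bigcup_seq/=; exists i => /=; first by rewrite mem_index_enum.
by exists Y => //; rewrite setTI.
Qed.

Lemma measurable_fun_coord d (T : measurableType d) (f : T -> 'rV[R]_m) :
  (forall i, measurable_fun setT (coord i \o f)) -> measurable_fun setT f.
Proof.
move=> mf; have sub : g_sigma_preimage (fun i => coord i \o f) `<=` measurable.
  apply: smallest_sub; first exact: sigma_algebra_measurable.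
  rewrite -bigcup_seq => A [i _ [B mB <-]]; exact: mf.
move=> _ A mA; apply: sub.
by rewrite g_sigma_preimage_comp; exists A.
Qed.

End measurable_rV.

Section lebesgue_rV.
Variable R : realType.

(* Lebesgue measure on R^(m+1) is the image of lebesgue_measure \x (Lebesgue measure
   on R^m) under the identification R * R^m = R^(m+1); on R^0 it is the unit mass. *)
Definition rV_cons m (p : measurableTypeR R * 'rV[R]_m) : 'rV[R]_m.+1 :=
  row_mx (p.1%:M : 'M[R]_1) p.2.

Definition rV_uncons m (v : 'rV[R]_m.+1) : measurableTypeR R * 'rV[R]_m :=
  ((v : 'rV[R]_(1 + m)) ord0 ord0, rsubmx (v : 'rV[R]_(1 + m))).

Lemma rV_consK m : cancel (@rV_uncons m) (@rV_cons m).
Proof.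
move=> v; rewrite /rV_cons /rV_uncons /=; apply/rowP => j.
rewrite mxE; case: splitP => k jk; last by rewrite mxE; congr (v _ _); apply/val_inj.
by rewrite mxE [k]ord1 eqxx mulr1n; congr (v _ _); apply/val_inj; rewrite /= jk [k]ord1.
Qed.

Lemma rV_unconsK m : cancel (@rV_cons m) (@rV_uncons m).
Proof.
move=> [x v]; rewrite /rV_cons /rV_uncons /= row_mxKr; congr (_, _).
by rewrite mxE; case: splitP => // k _; rewrite mxE [k]ord1 eqxx mulr1n.
Qed.

Lemma measurable_rV_cons m : measurable_fun setT (@rV_cons m).
Proof.
apply: measurable_fun_coord => i; rewrite /comp /coord /rV_cons /=.
case: (split_ordP (i : 'I_(1 + m))) => k ->.
  under eq_fun do rewrite (row_mxEl (_ : 'M[R]_1) _ ord0 k) mxE [k]ord1 eqxx mulr1n.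
  exact: measurable_fst.
under eq_fun do rewrite (row_mxEr (_ : 'M[R]_1) _ ord0 k).
exact: (measurableT_comp (@measurable_coord R m k) measurable_snd).
Qed.

Lemma measurable_rV_uncons m : measurable_fun setT (@rV_uncons m).
Proof.
apply/measurable_fun_pairP; split.
  exact: (@measurable_coord R m.+1 ord0).
apply: measurable_fun_coord => i; rewrite /comp /coord /=.
under eq_fun do rewrite mxE.
exact: measurable_coord.
Qed.

Section lebesgue_rV_succ.
Variables (m : nat) (mu : {sigma_finite_measure set 'rV[R]_m -> \bar R}).

Definition lebesgue_rV_succ : set 'rV[R]_m.+1 -> \bar R :=
  pushforward (@lebesgue_measure R \x mu)%E (@rV_cons m).

Let succ_measure : {measure set 'rV[R]_m.+1 -> \bar R} :=
  measure_function_pushforward__canonical__measure_function_Measure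
    (@lebesgue_measure R \x mu)%E (@measurable_rV_cons m).

HB.instance Definition _ := isMeasure.Build _ _ _ lebesgue_rV_succ
  (measure0 succ_measure) (measure_ge0 succ_measure)
  (@measure_semi_sigma_additive _ _ _ succ_measure).

Let sigma_finite_succ : sigma_finite setT lebesgue_rV_succ.
Proof.
have /sigma_finiteP[F [TF ndF mF]] := sigma_finiteT (@lebesgue_measure R).
have /sigma_finiteP[G [TG ndG mG]] := sigma_finiteT mu.
exists (fun k => @rV_uncons m @^-1` (F k `*` G k)).
  apply/seteqP; split => // v _.
  have [k _ Fk] : (\bigcup_k F k) (rV_uncons v).1 by rewrite -TF.
  have [l _ Gl] : (\bigcup_k G k) (rV_uncons v).2 by rewrite -TG.
  exists (maxn k l) => //; split.
  - by move: Fk; exact/subsetPset/ndF/leq_maxl.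
  - by move: Gl; exact/subsetPset/ndG/leq_maxr.
move=> k; have [mFk Fk] := mF k; have [mGk Gk] := mG k; split.
  by rewrite -[X in measurable X]setTI; apply: measurable_rV_uncons => //;
    exact: measurableX.
rewrite /lebesgue_rV_succ /pushforward.
have -> : @rV_cons m @^-1` (@rV_uncons m @^-1` (F k `*` G k)) = F k `*` G k; last first.
  by rewrite product_measure1E// lte_mul_pinfty// ge0_fin_numE.
by rewrite -comp_preimage (_ : _ \o _ = id) ?preimage_id//;
  apply/funext => p; exact: rV_unconsK.
Qed.

HB.instance Definition _ := Measure_isSigmaFinite.Build _ _ _
  lebesgue_rV_succ sigma_finite_succ.

End lebesgue_rV_succ.

Fixpoint lebesgue_rV m : {sigma_finite_measure set 'rV[R]_m -> \bar R} :=
  match m with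
  | 0 => \d_(0 : 'rV[R]_0)
  | m'.+1 => lebesgue_rV_succ (lebesgue_rV m')
  end.

End lebesgue_rV.

Lemma lebesgue_rV_box (R : realType) m (a b : 'rV[R]_m) :
  (forall i, a ord0 i <= b ord0 i) ->
  lebesgue_rV R m [set v | forall i, a ord0 i <= v ord0 i <= b ord0 i] =
  (\prod_(i < m) (b ord0 i - a ord0 i))%:E.
Proof.
elim: m a b => [|m IH] a b ab.
  rewrite big_ord0 /= /dirac indicE mem_set// => -[]//.
rewrite big_ord_recl /= /lebesgue_rV_succ /pushforward.
pose a' := \row_(i < m) a ord0 (lift ord0 i).
pose b' := \row_(i < m) b ord0 (lift ord0 i).
have ab' i : a' ord0 i <= b' ord0 i by rewrite !mxE.

have -> : @rV_cons R m @^-1` [set v | forall i, a ord0 i <= v ord0 i <= b ord0 i] =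
   (`[a ord0 ord0, b ord0 ord0]%classic : set (measurableTypeR R))
     `*` [set v : 'rV[R]_m | forall i, a' ord0 i <= v ord0 i <= b' ord0 i].
  apply/seteqP; split => -[x v] /=; rewrite /rV_cons /=.
    move=> h; split => [|i].
      have := h ord0; rewrite mxE; case: splitP => // k _.
      by rewrite mxE [k]ord1 eqxx mulr1n /= in_itv.
    have := h (lift ord0 i); rewrite !mxE; case: splitP => k /=.
      by rewrite [k]ord1.
    by rewrite /bump /= => -[/val_inj ->].
  rewrite in_itv => -[xab vab] i; rewrite mxE; case: splitP => k ik.
    rewrite mxE [k]ord1 eqxx mulr1n (_ : i = ord0)//.
    by apply/val_inj; rewrite /= ik [k]ord1.
  have -> : i = lift ord0 k by apply/val_inj.
  by have := vab k; rewrite !mxE.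
rewrite product_measure1E//; last first.
  rewrite (_ : [set v | _] = \bigcap_(i in [set: 'I_m])
     (@coord R m i @^-1` `[a' ord0 i, b' ord0 i]%classic)).
    apply: fin_bigcap_measurable => // i _.
    by rewrite -[X in measurable X]setTI; exact: measurable_coord.
  by apply/seteqP; split => v /= h i; have := h i; rewrite /coord /= in_itv//= => /(_ I).
rewrite IH// EFinM; congr (_ * _)%E.
  transitivity (if (a ord0 ord0)%:E < (b ord0 ord0)%:E
    then (b ord0 ord0 - a ord0 ord0)%:E else 0)%E.
    exact: (lebesgue_measure_itv `[a ord0 ord0, b ord0 ord0]).
  rewrite lte_fin; case: ltgtP (ab ord0) => // -> _; by rewrite subrr.
by congr (_%:E); apply: eq_bigr => i _; rewrite !mxE.
Qed.

Section euclidean.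
Variable R : realType.

(* The norm `|v| of the library on 'rV[R]_m is the sup norm. *)
Definition enorm m (v : 'rV[R]_m) : R := Num.sqrt (\sum_i v ord0 i ^+ 2).
Definition edist m (x y : 'rV[R]_m) : R := enorm (x - y).
Definition eball m (x : 'rV[R]_m) (r : R) : set 'rV[R]_m :=
  [set y | edist y x <= r].

Definition unit_ball_volume m : R :=
  fine (lebesgue_rV R m (eball (0 : 'rV[R]_m) 1)).

Definition ediam m (A : set 'rV[R]_m) : \bar R :=
  ereal_sup [set (edist x y)%:E | x in A & y in A].

(* The s-dimensional Hausdorff measure, normalized as in Evans and Gariepy. The
   empty set is treated apart so that it does not count as 0 ^+ 0 = 1 if s = 0. *)
Definition hausdorff_weight m (s : nat) (B : set 'rV[R]_m) : \bar R :=
  if B == set0 then 0%E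
  else (unit_ball_volume s * (fine (ediam B) / 2) ^+ s)%:E.

Definition hausdorff_pre m (s : nat) (delta : R) (A : set 'rV[R]_m) : \bar R :=
  ereal_inf [set (\sum_(0 <= j <oo) hausdorff_weight s (B j))%E | B in
    [set B : nat -> set 'rV[R]_m | A `<=` \bigcup_j B j /\
       forall j, (ediam (B j) <= delta%:E)%E]].

Definition hausdorff m (s : nat) (A : set 'rV[R]_m) : \bar R :=
  ereal_sup [set hausdorff_pre s delta A | delta in [set delta | 0 < delta]].

Definition surface_area m (A : set 'rV[R]_m) : \bar R :=
  hausdorff m.-1 (closure A `\` A°).

End euclidean.

Section smoothness.
Variables (R : realType) (m : nat).
Implicit Types (f g : 'rV[R]_m -> R) (A : set 'rV[R]_m).

Definition pderivs (s : seq 'I_m) f : 'rV[R]_m -> R :=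
  foldr (fun i g x => 'D_(delta_mx ord0 i) g x) f s.

Definition mderiv (t : 'I_m -> nat) f : 'rV[R]_m -> R :=
  pderivs (flatten [seq nseq (t i) i | i <- enum 'I_m]) f.

(* C^k up to the boundary: the partial derivatives of order at most k exist on
   the interior of A and extend continuously to A. *)
Definition Ck_on (k : nat) A f : Prop :=
  {within A, continuous f} /\
  forall s : seq 'I_m, (size s <= k)%N ->
    ((size s < k)%N -> forall i x, A° x ->
       derivable (pderivs s f) x (delta_mx ord0 i)) /\
    exists2 h : 'rV[R]_m -> R, {within A, continuous h} &
      forall x, A° x -> h x = pderivs s f x.

Definition supnorm A f : \bar R := ereal_sup [set `|f x|%:E | x in A°].

Definition multi_index (l : nat) : set ('I_m -> nat) :=
  [set t | (\sum_i t i)%N = l].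

(* The sets of multi-indices of a given order are finite, so that these suprema
   are maxima. *)
Definition max_mderiv (l : nat) A f : \bar R :=
  ereal_sup [set supnorm A (mderiv t f) | t in multi_index l].
Definition max_mderiv_dist (l : nat) A f g : \bar R :=
  ereal_sup [set supnorm A (mderiv t f \- mderiv t g) | t in multi_index l].

End smoothness.

Section probability.
Context {d : measure_display} {T : measurableType d} {R : realType}.
Variable P : probability T R.
Implicit Types (B E : set T).

(* P(E | B) *)
Definition cprob E B : R := fine (P (E `&` B)) / fine (P B).

Definition is_density k (U : T -> 'rV[R]_k) B (f : 'rV[R]_k -> R) : Prop :=
  [/\ measurable_fun setT f, forall x, 0 <= f x &
    forall A, measurable A ->
      (cprob (U @^-1` A) B)%:E = (\int[lebesgue_rV R k]_(x in A) (f x)%:E)%E].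

(* the support of the law of U conditionally on B *)
Definition csupport k (U : T -> 'rV[R]_k) B : set 'rV[R]_k :=
  [set x | forall r, 0 < r -> 0 < cprob (U @^-1` eball x r) B].

(* q is a version of P(E | X = .) *)
Definition is_cprob k (X : T -> 'rV[R]_k) E (q : 'rV[R]_k -> R) : Prop :=
  measurable_fun setT q /\
  forall A, measurable A ->
    P (X @^-1` A `&` E) = (\int[P]_(t in X @^-1` A) (q (X t))%:E)%E.

(* h is a version of E(W | X = ., B) *)
Definition is_cmean k (X : T -> 'rV[R]_k) B (W : T -> R) (h : 'rV[R]_k -> R) :=
  [/\ measurable_fun setT h, P.-integrable B (EFin \o W) &
    forall A, measurable A ->
      (\int[P]_(t in X @^-1` A `&` B) (W t)%:E =
       \int[P]_(t in X @^-1` A `&` B) (h (X t))%:E)%E].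

(* the conditional expectation given the discrete random variable V *)
Definition cond_exp (F : finType) (W : T -> \bar R) (V : T -> F) (t : T)
    : \bar R :=
  ((fine (P [set s | V s = V t]))^-1%:E *
    \int[P]_(s in [set s | V s = V t]) W s)%E.

Definition iid_copies d' (U : measurableType d') n
    (Z : 'I_n -> T -> U) (Z0 : T -> U) : Prop :=
  [/\ measurable_fun setT Z0, forall i, measurable_fun setT (Z i),
    forall i A, measurable A -> P (Z i @^-1` A) = P (Z0 @^-1` A) &
    forall A : 'I_n -> set U, (forall i, measurable (A i)) ->
      P (\bigcap_(i in [set: 'I_n]) Z i @^-1` A i) =
      (\prod_(i < n) P (Z i @^-1` A i))%E].

End probability.

(* Treatment arms are booleans: true is the arm omega = 1, false the arm
   omega = 0. *)
Section matching.
Variables (R : realType) (m n : nat).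
Variables (x : 'I_n -> 'rV[R]_m) (a : 'I_n -> bool).

Definition arm_size (w : bool) : nat := (\sum_(i < n) (a i == w))%N.

(* j belongs to J_M^w(i) *)
Definition matched (w : bool) (M : nat) (i j : 'I_n) : bool :=
  (a j == w) && (\sum_(l < n | a l == w)
    (edist (x l) (x i) <= edist (x j) (x i))%R <= M)%N.

Definition match_count (w : bool) (M : nat) (i : 'I_n) : nat :=
  (\sum_(j < n | a j == ~~ w) matched w M j i)%N.

(* K_M^w(i) is meant for the units i in arm w only; match_count w M i is 0 for
   the other ones. So K_M^w(1) is read at unit 1 if this unit is in arm w, and
   otherwise at the first unit in arm w, which takes the role of unit 1: given
   the treatments, the units of an arm are exchangeable. *)
Definition first_unit (w : bool) : option 'I_n :=
  ohead [seq i <- enum 'I_n | a i == w].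

End matching.

Section model.
Context {d : measure_display} {T : measurableType d} {R : realType} {m : nat}.
Variable P : probability T R.
Variables (X : T -> 'rV[R]_m) (Y : bool -> T -> R) (D : T -> bool).

Definition arm (w : bool) : set T := [set t | D t = w].

Definition Yobs (t : T) : R := (D t)%:R * Y true t + (1 - (D t)%:R) * Y false t.

Definition cond_indep_potential_outcomes : Prop :=
  forall (w : bool) (B : set (R * R)) (q q' : 'rV[R]_m -> R), measurable B ->
    is_cprob P X (arm w) q ->
    is_cprob P X [set t | B (Y false t, Y true t)] q' ->
    is_cprob P X (arm w `&` [set t | B (Y false t, Y true t)])
      (fun x => q x * q' x).

Definition overlap (XX : set 'rV[R]_m) (e : 'rV[R]_m -> R) (eta : R) : Prop :=
  {ae lebesgue_rV R m, forall x, XX x -> eta <= e x <= 1 - eta}.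

Definition lipschitz_densities (g : bool -> 'rV[R]_m -> R) (L : R) : Prop :=
  forall i x z, csupport P X (arm i) x -> csupport P X (arm i) z ->
    Num.max `|g false z - g false x| `|g true z - g true x| <= L * edist x z.

Definition arm_regularity (a : R) : Prop :=
  forall i z delta, csupport P X (arm (~~ i)) z ->
    0 < delta -> (delta%:E <= ediam (csupport P X (arm i)))%E ->
    (a%:E * lebesgue_rV R m (eball z delta) <=
     lebesgue_rV R m (eball z delta `&` csupport P X (arm i)))%E.

Definition outcome_moments (XX : set 'rV[R]_m) (mu : bool -> 'rV[R]_m -> R)
    (Ml p Mu : R) : Prop :=
  (Ml%:E <= \int[P]_t ((Yobs t - mu (D t) (X t)) ^+ 2)%:E)%E /\
  forall w, exists2 h,
    is_cmean P X (arm w) (fun t => `|Y w t - mu w (X t)| `^ (4 + p)) h &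
    forall x, XX x -> h x <= Mu.

Section sample.
Variables (n : nat) (Z : 'I_n -> T -> 'rV[R]_m * R * bool).

Definition regression_estimators (XX : set 'rV[R]_m)
    (mu : bool -> 'rV[R]_m -> R)
    (est : bool -> ('I_n -> 'rV[R]_m * R * bool) -> 'rV[R]_m -> R)
    (K : R) (gam : nat -> R) : Prop :=
  forall w, let muhat t := est w (fun i => Z i t) in
  [/\ forall x, measurable_fun setT (fun t => muhat t x),
    forall t, Ck_on (m./2).+1 XX (muhat t),
    (\int[P]_t (max_mderiv (m./2).+1 XX (muhat t) ^+ 2) <= K%:E)%E &
    forall l, (1 <= l <= m./2)%N ->
      (\int[P]_t (max_mderiv_dist l XX (mu w) (muhat t) ^+ 2) <=
       (K * n%:R `^ (- 2 * gam l))%:E)%E].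

Let cov (t : T) (i : 'I_n) : 'rV[R]_m := (Z i t).1.1.
Let trt (t : T) (i : 'I_n) : bool := (Z i t).2.
Let Nw (w : bool) (t : T) : R := (arm_size (trt t) w)%:R.

(* P(D = w | X = x), if e x = P(D = 1 | X = x) *)
Definition propensity (e : 'rV[R]_m -> R) (w : bool) (x : 'rV[R]_m) : R :=
  if w then e x else 1 - e x.

Definition weight_error (e : 'rV[R]_m -> R) (w : bool) (M : nat)
    (i : 'I_n) (t : T) : R :=
  Nw w t / Nw (~~ w) t * ((match_count (cov t) (trt t) w M i)%:R / M%:R) -
  fine (P (arm w)) / fine (P (arm (~~ w))) *
    (propensity e (~~ w) (cov t i) / propensity e w (cov t i)).

Definition expected_weight_error (e : 'rV[R]_m -> R) (w : bool) (M : nat)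
    : \bar R :=
  (\int[P]_t (((Nw (~~ w) t / Nw w t) ^+ 2)%:E *
    cond_exp P
      (fun s => (oapp (fun i => weight_error e w M i s ^+ 2) 0
                   (first_unit (trt s) w))%:E)
      (fun s => [ffun i => trt s i]) t *
    ((0 < Nw w t)%R%:R)%:E))%E.

End sample.
End model.

(* Constants that do not depend on the sample size, on the number of matches, on
   the overlap parameter eta or on the law of (X, Y(0), Y(1), D). *)
Record constants (R : realType) := Constants {
  g_min : R ; g_max : R ;                 (* bounds on the density of X *)
  gD_min : bool -> R ; gD_max : bool -> R ; (* on the densities of X given D *)
  lip : R ; ball_frac : R ; area : R ;    (* L, a, H *)
  mu_sq : R ;                             (* bound on E mu_w(X)^2 *)
  var_min : R ; mom_exp : R ; mom_max : R ; (* M_l, p, M_{u,p} *)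
  mu_deriv : R ;                          (* bound on the derivatives of mu_w *)
  est_bound : R ; est_eps : R ; est_rate : nat -> R ; (* O(.), epsilon_mu, gamma_l *)
  gphi_min : bool -> bool -> R ;          (* bounds on the density of phi_w(X) *)
  gphi_max : bool -> bool -> R ;          (* given D = i, indexed by w then i *)
  C0 : R ; C1 : R }.

Definition admissible (R : realType) (m : nat) (c : constants R) : Prop :=
  [/\ 0 < g_min c <= g_max c /\ (forall i, 0 < gD_min c i <= gD_max c i),
    [/\ 0 < lip c, 0 < ball_frac c < 1 & 0 < area c],
    [/\ 0 < var_min c, 0 < mom_exp c & 0 < mom_max c],
    0 < est_eps c /\ (forall l, (1 <= l <= m./2)%N ->
      2^-1 - l%:R / m%:R + est_eps c < est_rate c l) &
    [/\ forall w i, 0 < gphi_min c w i <= gphi_max c w i, 0 < C0 c, 0 < C1 c &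
      C0 c <= Num.max ((gD_min c false / 4) ^+ m.+1) ((gD_min c true / 4) ^+ m.+1)
              * (unit_ball_volume R m / (2 * lip c ^+ m))]].

Section bounds.
Variable R : realType.

Definition r_ratio (c : constants R) : R :=
  Num.max (gD_min c false / gD_max c false) (gD_min c true / gD_max c true).

Definition r_ratio_phi (c : constants R) : R :=
  Num.max
    (Num.max (gphi_min c false false / gphi_max c false false)
             (gphi_min c true false / gphi_max c true false))
    (Num.max (gphi_min c false true / gphi_max c false true)
             (gphi_min c true true / gphi_max c true true)).

Definition r_zero (c : constants R) : R := Num.max (r_ratio c) (r_ratio_phi c).

Variables (m : nat) (r0 n M eta : R).

Definition delta_tail : R :=
  expR (- (1 - ln 2) * M) +
  expR (M - r0 * n * eta - M * ln M + M * ln (r0 * n * eta)).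

Definition delta_H1 : R :=
  (n ^+ 2 * eta ^+ 4)^-1 + (n / (M * eta)) ^+ 2 * delta_tail ^+ 2.

Definition delta_H2 : R :=
  (M / (n * eta)) `^ m%:R^-1 + (n * eta)^-1 + n / M * delta_tail.

Definition delta_H3 : R :=
  (n / (M * eta)) ^+ 2 * expR (- (1 - ln 2) * M).

Definition matching_bound : R :=
  (eta ^+ 2)^-1 * (M / (n * eta)) `^ m%:R^-1 + delta_H1 +
  (delta_H2 + 1) * (eta ^+ 2 * M)^-1 + delta_H3.

Definition simple_rate : R := (M / n) `^ m%:R^-1 + M^-1.

End bounds.

(* Main.v *)
(* Overlap forces both arms to have the support XX of X, and by Bayes' rule the ratio
   P(w)/P(~w) P(~w|x)/P(w|x) is the density ratio g_{~w}(x)/g_w(x). Given the treatments,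
   the units are independent with laws g_0 and g_1; after multiplication by N_{~w}/N_w,
   the error at a unit X_i = x of arm w is K/M - (N_{~w}/N_w) g_{~w}(x)/g_w(x).

   A unit z of the other arm is matched to x if fewer than M of the other units of arm w
   are nearer to z than x is. Their number is close to N_w g_w(x) V |z - x|^m, so that z is
   matched, up to errors controlled by Chernoff's bounds on the shells on which this
   quantity is M +- k (sqrt M + (M/N_w)^(1/m) M), if and only if it lies in a ball of
   g_{~w}-mass about M g_{~w}(x)/(N_w g_w(x)). For this the ball of radius of the order of
   (M/N_w)^(1/m) around x has to lie in XX. By convexity, the points x at which this
   fails form a set of mass of that same order, and a crude bound suffices for them.

   Averaging over the treatments, the powers of n/N_w become powers of 1/eta through the
   inverse moments of the binomial law. *)
Require Import Defs.
From HB Require Import structures.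
From mathcomp Require Import all_boot all_order all_algebra.
From mathcomp Require Import all_classical all_reals all_analysis.
From mathcomp Require Import measurable_realfun zify ring lra.
Set Implicit Arguments.
Unset Strict Implicit.
Unset Printing Implicit Defensive.
Import Order.TTheory GRing.Theory Num.Theory.
Import numFieldNormedType.Exports.
Local Open Scope classical_set_scope.
Local Open Scope ring_scope.

(** The matching count is the number of seekers, the units of the other arm, that select the base
    point. It is compared with the number of seekers in a deterministic set. The obstacle is that
    all seekers look at the same donors, so that the failures of this prediction at two of them are
    dependent. Only the positions of the seekers are independent: in a shell of mass g where the
    prediction fails with probability p, two given seekers both fail with probability at most g^2 p,
    not (g p)^2. The squared sum over the shells is therefore split by Cauchy-Schwarz with the
    summable weights 1/((k+1)(k+2)), and p has to decay like the square of this weight, which the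
    Chernoff exponents provide. A shell has mass of order (sqrt M + (M/N)^(1/m) M)/N: the first term
    is the fluctuation of a count near M, the second the error made in freezing the Lipschitz
    density at the base point. Relative to M/N its square is of order 1/M + (M/N)^(2/m). The
    exponent 1 - log 2 is that of a count of mean at least 2M falling below M, under a tilt by 1/2.
    The constant depends on the support only through the radius of an inscribed ball. *)

Local Notation edist := Defs.edist.

(** * Euclidean distance and Lebesgue measure *)

Lemma eq_ler disp (T : porderType disp) (x y : T) : x = y -> (x <= y)%O.
Proof. by move=> ->. Qed.

Section euclidean_facts.
Variable R : realType.

Lemma enorm_ge0 m (v : 'rV[R]_m) : 0 <= enorm v.
Proof. exact: sqrtr_ge0. Qed.

Lemma enorm_sqr m (v : 'rV[R]_m) : enorm v ^+ 2 = \sum_i v ord0 i ^+ 2.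
Proof. by rewrite sqr_sqrtr//; apply: sumr_ge0 => i _; exact: sqr_ge0. Qed.

(** Lagrange's identity: the double sum of the squares of [a i * b j - a j * b i] is twice the gap
    between the two sides. *)
Lemma cauchy_schwarz_sum (I : finType) (a b : I -> R) :
  (\sum_i a i * b i) ^+ 2 <= (\sum_i a i ^+ 2) * (\sum_i b i ^+ 2).
Proof.
have : 0 <= \sum_i \sum_j (a i * b j - a j * b i) ^+ 2.
  by apply: sumr_ge0 => i _; apply: sumr_ge0 => j _; exact: sqr_ge0.
have -> : \sum_i \sum_j (a i * b j - a j * b i) ^+ 2 =
    2 * ((\sum_i a i ^+ 2) * (\sum_i b i ^+ 2) - (\sum_i a i * b i) ^+ 2).
  have E i j : (a i * b j - a j * b i) ^+ 2 = a i ^+ 2 * b j ^+ 2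
      + a j ^+ 2 * b i ^+ 2 - 2 * (a i * b i * (a j * b j)) by ring.
  under eq_bigr => i _ do under eq_bigr => j _ do rewrite E.
  under eq_bigr => i _ do rewrite sumrB big_split/= -!mulr_sumr -mulr_suml.
  rewrite sumrB big_split/= -!mulr_suml -!mulr_sumr -mulr_suml expr2; ring.
by lra.
Qed.

Lemma ler_enormD m (u v : 'rV[R]_m) : enorm (u + v) <= enorm u + enorm v.
Proof.
rewrite -(ler_pXn2r (_ : (0 < 2)%N)) ?nnegrE ?addr_ge0 ?enorm_ge0//.
rewrite sqrrD !enorm_sqr.
under eq_bigr => i _ do rewrite mxE sqrrD.
rewrite !big_split/= lerD2r lerD2l -mulr2n.
rewrite lerMn2r//=; apply: le_trans (ler_norm _) _.
rewrite -(ler_pXn2r (_ : (0 < 2)%N)) ?nnegrE ?mulr_ge0 ?enorm_ge0//.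
by rewrite exprMn !enorm_sqr real_normK ?num_real// cauchy_schwarz_sum.
Qed.

Lemma enormZ m (c : R) (v : 'rV[R]_m) : enorm (c *: v) = `|c| * enorm v.
Proof.
rewrite /enorm; under eq_bigr => i _ do rewrite mxE exprMn.
by rewrite -mulr_sumr sqrtrM ?sqr_ge0// sqrtr_sqr.
Qed.

Lemma enormN m (v : 'rV[R]_m) : enorm (- v) = enorm v.
Proof. by rewrite -scaleN1r enormZ normrN1 mul1r. Qed.

Lemma enorm0 m : enorm (0 : 'rV[R]_m) = 0.
Proof. by rewrite -(scale0r (0 : 'rV[R]_m)) enormZ normr0 mul0r. Qed.

Lemma ler_coord_enorm m (v : 'rV[R]_m) i : `|v ord0 i| <= enorm v.
Proof.
rewrite -sqrtr_sqr ler_wsqrtr// (bigD1 i)//= lerDl.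
by apply: sumr_ge0 => j _; exact: sqr_ge0.
Qed.

Lemma enorm_le_box m (v : 'rV[R]_m) (b : R) : (0 < m)%N ->
  (forall i, `|v ord0 i| <= b) -> enorm v <= m%:R * b.
Proof.
move=> m0 vb; have b0 : 0 <= b by apply: le_trans (vb (Ordinal m0)).
rewrite -(ler_pXn2r (_ : (0 < 2)%N)) ?nnegrE ?mulr_ge0 ?enorm_ge0//.
rewrite enorm_sqr; apply: (@le_trans _ _ (\sum_(i < m) b ^+ 2)).
  by apply: ler_sum => i _; rewrite -(real_normK (num_real _)) ler_pXn2r.
rewrite sumr_const card_ord -[leLHS]mulr_natl exprMn ler_wpM2r ?sqr_ge0//.
by rewrite -natrX ler_nat expnS expn1 leq_pmulr.
Qed.

Lemma edist_ge0 m (x y : 'rV[R]_m) : 0 <= edist x y.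
Proof. exact: enorm_ge0. Qed.

Lemma edistxx m (x : 'rV[R]_m) : edist x x = 0.
Proof. by rewrite /edist subrr enorm0. Qed.

Lemma edistC m (x y : 'rV[R]_m) : edist x y = edist y x.
Proof. by rewrite /edist -enormN opprB. Qed.

Lemma edist_triangle m (y x z : 'rV[R]_m) : edist x z <= edist x y + edist y z.
Proof. by rewrite /edist (le_trans _ (ler_enormD _ _))// addrA subrK. Qed.

Lemma edist_eq0 m (x y : 'rV[R]_m) : edist x y <= 0 -> x = y.
Proof.
move=> xy; apply/rowP => i; apply/eqP; rewrite -subr_eq0 -normr_le0.
by rewrite (le_trans _ xy)// (le_trans _ (ler_coord_enorm _ i))// !mxE.
Qed.

End euclidean_facts.

Section measurability.
Variable R : realType.

Lemma measurable_sqrtr : measurable_fun [set: R] (@Num.sqrt R).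
Proof.
apply: measurable_realfun.nondecreasing_measurable => // x y xy; exact: ler_wsqrtr.
Qed.

Lemma measurable_edist d (T : measurableType d) m (f g : T -> 'rV[R]_m) :
  measurable_fun setT f -> measurable_fun setT g ->
  measurable_fun setT (fun t => edist (f t) (g t)).
Proof.
move=> mf mg; apply: (measurableT_comp measurable_sqrtr).
apply: measurable_sum => i; apply: measurable_funX.
under eq_fun do rewrite !mxE.
apply: measurable_funB; exact: (measurableT_comp (measurable_coord i)).
Qed.

Lemma measurable_set_le d (T : measurableType d) (f g : T -> R) :
  measurable_fun setT f -> measurable_fun setT g ->
  measurable [set t | f t <= g t].
Proof. by move=> mf mg; rewrite -[X in measurable X]setTI; exact: measurable_fun_le. Qed.

Lemma measurable_preimage d d' (T : measurableType d) (U : measurableType d')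
    (f : T -> U) (A : set U) :
  measurable_fun setT f -> measurable A -> measurable (f @^-1` A).
Proof. by move=> mf mA; rewrite -[X in measurable X]setTI; exact: mf. Qed.

Lemma measurable_eball m (x : 'rV[R]_m) r : measurable (eball x r).
Proof. by apply: measurable_set_le => //; exact: measurable_edist. Qed.

Lemma measurable_affine m (c : R) (t : 'rV[R]_m) :
  measurable_fun setT (fun y : 'rV[R]_m => c *: y + t).
Proof.
apply: measurable_fun_coord => i.
rewrite (_ : _ \o _ = fun y : 'rV[R]_m => c * y ord0 i + t ord0 i); last first.
  by apply/funext => y; rewrite /Defs.coord/= !mxE.
apply: measurable_funD => //; apply: measurable_funM => //; exact: measurable_coord.
Qed.

End measurability.

(** * Lebesgue measure under dilations and translations *)

Section lebesgue_affine.
Variable R : realType.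

(** As a function of [A] the right-hand side is a measure that gives half-open intervals their
    length, and this characterises Lebesgue measure. *)
Lemma lebesgue_measure_affine (c t : R) (A : set (measurableTypeR R)) : 0 < c ->
  measurable A ->
  lebesgue_measure A = (c%:E * lebesgue_measure ((fun x : R => (c * x + t)%R) @^-1` A))%E.
Proof.
move=> c0 mA.
have mf : measurable_fun setT (fun x : measurableTypeR R => c * x + t : measurableTypeR R).
  by apply: measurable_funD => //; exact: measurable_funM.
pose nu : {measure set (measurableTypeR R) -> \bar R} :=
  mscale (NngNum (ltW c0)) (measure_function_pushforward__canonical__measure_function_Measure
    (@lebesgue_measure R) mf).
suff: lebesgue_measure A = nu A by [].
apply: lebesgue_measure_unique => //= _ [[a b]] _ <-.
rewrite /nu /mscale /= /pushforward.
have -> : (fun x : R => c * x + t) @^-1` `]a, b] = `](a - t) / c, (b - t) / c]%classic.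
  apply/seteqP; split => x /=; rewrite !in_itv/= ltr_pdivrMr// ler_pdivlMr//;
    rewrite [x * c]mulrC => /andP[? ?]; apply/andP; split; lra.
rewrite !lebesgue_measure_itv/= !lte_fin ltr_pM2r ?invr_gt0// ltrD2r.
case: ifPn => ab; last by rewrite mule0.
rewrite -!EFinB -EFinM; congr (_%:E); field; exact: lt0r_neq0.
Qed.

(** Such a map acts separately on the first coordinate and on the others, so that both measures
    agree on rectangles; uniqueness of the product measure then gives the induction on the
    dimension. *)
Lemma lebesgue_rV_affine m (c : R) (t : 'rV[R]_m) (A : set 'rV[R]_m) : 0 < c ->
  measurable A ->
  lebesgue_rV R m A =
  ((c ^+ m)%:E * lebesgue_rV R m ((fun y : 'rV[R]_m => (c *: y + t)%R) @^-1` A))%E.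
Proof.
move=> c0; elim: m t A => [|m IH] t A mA.
  rewrite expr0 mul1e; congr (lebesgue_rV _ _ _); apply/seteqP.
  by split => x; rewrite /= [x]thinmx0 [_ + _]thinmx0.
pose f (p : measurableTypeR R * 'rV[R]_m) : measurableTypeR R * 'rV[R]_m :=
  (c * p.1 + (rV_uncons t).1, c *: p.2 + (rV_uncons t).2).
have mf : measurable_fun setT f.
  apply/measurable_fun_pairP; split.
    apply: measurable_funD => //; apply: measurable_funM => //; exact: measurable_fst.
  exact: (measurableT_comp (measurable_affine _ _) measurable_snd).
pose nu : {measure set (measurableTypeR R * 'rV[R]_m) -> \bar R} :=
  mscale (NngNum (exprn_ge0 m.+1 (ltW c0)))
   (measure_function_pushforward__canonical__measure_function_Measure
    (@lebesgue_measure R \x lebesgue_rV R m)%E mf).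
have nuE : forall X : set (measurableTypeR R * 'rV[R]_m), measurable X ->
    (@lebesgue_measure R \x lebesgue_rV R m)%E X = nu X.
  apply: product_measure_unique => A1 B1 mA1 mB1.
  change (nu (A1 `*` B1)) with
    ((c ^+ m.+1)%:E * (@lebesgue_measure R \x lebesgue_rV R m) (f @^-1` (A1 `*` B1)))%E.
  have -> : f @^-1` (A1 `*` B1) =
      ((fun x : R => c * x + (rV_uncons t).1) @^-1` A1) `*`
      ((fun y : 'rV[R]_m => c *: y + (rV_uncons t).2) @^-1` B1) by [].
  rewrite product_measure1E//; last 2 first.
    apply: (@measurable_preimage _ _ (measurableTypeR R) (measurableTypeR R)) => //.
    by apply: measurable_funD => //; exact: measurable_funM.
    by apply: measurable_preimage => //; exact: measurable_affine.
  rewrite exprS EFinM muleACA; congr (_ * _)%E; last exact/esym/IH.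
  exact/esym/lebesgue_measure_affine.
rewrite [LHS]nuE; last by apply: measurable_preimage => //; exact: measurable_rV_cons.
rewrite /nu /mscale/= /pushforward; congr (_ * _)%E.
rewrite /lebesgue_rV_succ /pushforward; congr (product_measure1 _ _ _).
apply/seteqP; suff E : forall p, rV_cons (f p) = c *: rV_cons p + t.
  by split => p /=; rewrite E.
move=> p; rewrite [RHS](congr1 (fun z => c *: rV_cons p + z) (esym (rV_consK t))).
rewrite /rV_cons /f/= (@scale_row_mx R 1 1 m) (@add_row_mx R 1 1 m).
have E (a b : R) : (c * a + b)%:M = c *: a%:M + b%:M :> 'M[R]_1.
  by rewrite scale_scalar_mx raddfD.
by rewrite E.
Qed.

End lebesgue_affine.

(** * Independent coordinates *)

Section independent_coordinates.
Context d (U : measurableType d) (R : realType) (n : nat).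
Variables (G : 'I_n -> probability U R) (Q : probability (n.-tuple U) R).
Hypothesis indepQ : forall A : 'I_n -> set U, (forall i, measurable (A i)) ->
  Q [set w | forall i, A i (tnth w i)] = (\prod_i G i (A i))%E.

Definition upd (i : 'I_n) (u : U) (w : n.-tuple U) : n.-tuple U :=
  [tuple if l == i then u else tnth w l | l < n].

Lemma tnth_upd i u w l : tnth (upd i u w) l = if l == i then u else tnth w l.
Proof. by rewrite tnth_mktuple. Qed.

Lemma measurable_upd i :
  measurable_fun setT (fun p : U * n.-tuple U => upd i p.1 p.2).
Proof.
apply/measurable_fun_tnthP => l.
rewrite (_ : _ \o _ = fun p : U * n.-tuple U => if l == i then p.1 else tnth p.2 l).
  case: eqP => _; first exact: measurable_fst.
  exact: (measurableT_comp (measurable_tnth l) measurable_snd).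
by apply/funext => p /=; rewrite tnth_upd.
Qed.

Lemma measurable_rect (A : 'I_n -> set U) : (forall i, measurable (A i)) ->
  measurable [set w : n.-tuple U | forall i, A i (tnth w i)].
Proof.
move=> mA; rewrite (_ : [set w | _] =
    \bigcap_(i in [set: 'I_n]) ((fun w : n.-tuple U => tnth w i) @^-1` A i)).
  apply: fin_bigcap_measurable => // i _; apply: measurable_preimage => //.
  exact: measurable_tnth.
by apply/seteqP; split => w /= h i; [move=> _|]; exact: h.
Qed.

(** Conditioning on one coordinate, for a law known only through its values on rectangles: drawing
    coordinate [i] afresh preserves these values, and rectangles are stable under intersection and
    generate the sigma-algebra. *)
Lemma resample i (F : n.-tuple U -> \bar R) :
  measurable_fun setT F -> (forall w, (0 <= F w)%E) ->
  (\int[Q]_w F w = \int[G i]_u \int[Q]_w F (upd i u w))%E.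
Proof.
move=> mF F0.
pose nu : {measure set (n.-tuple U) -> \bar R} :=
  measure_function_pushforward__canonical__measure_function_Measure
    (G i \x Q)%E (measurable_upd i).
pose C : set (set (n.-tuple U)) := [set X | exists2 A : 'I_n -> set U,
  (forall i, measurable (A i)) & X = [set w | forall i, A i (tnth w i)]].
have Qnu X : measurable X -> Q X = nu X.
  apply: (measure_unique C (fun=> setT)) => //.
  - apply/seteqP; split.
      apply: smallest_sub; first exact: smallest_sigma_algebra.
      rewrite -bigcup_seq => Y [l _ [B mB <-]]; apply: sub_sigma_algebra.
      exists (fun k => if k == l then B else setT) => [k|]; first by case: ifP.
      rewrite setTI; apply/seteqP; split => w /=.
        by move=> Bw k; case: eqP => [->|].
      by move=> /(_ l); rewrite eqxx.
    apply: smallest_sub; first exact: sigma_algebra_measurable.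
    by move=> Y [A mA ->]; exact: measurable_rect.
  - move=> Y Z [A mA ->] [B mB ->]; exists (fun k => A k `&` B k) => [k|].
      exact: measurableI.
    apply/seteqP; split => w /=; first by move=> [? ?] k; split.
    by move=> h; split => k; case: (h k).
  - move=> _; exists (fun=> setT) => //; by apply/seteqP; split.
  - by apply/seteqP; split => // w _; exists 0%N.
  - move=> Y [A mA ->]; transitivity (\prod_k G k (A k))%E; first exact: indepQ.
    change (nu [set w | forall k, A k (tnth w k)]) with ((G i \x Q)%E
      ((fun p : U * n.-tuple U => upd i p.1 p.2) @^-1`
        [set w | forall k, A k (tnth w k)])).
    (* The condition on coordinate [i] concerns the fresh point alone. Leaving the old coordinate
       free makes the preimage of a rectangle a product. *)
    pose A' (k : 'I_n) : set U := if k == i then setT else A k.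
    have mA' k : measurable (A' k) by rewrite /A'; case: ifP.
    rewrite (_ : _ @^-1` _ = A i `*` [set w | forall k, A' k (tnth w k)]).
      rewrite product_measure1E//; last exact: measurable_rect.
      transitivity (G i (A i) * \prod_k G k (A' k))%E; last first.
        by congr (_ * _)%E; exact/esym/indepQ.
      rewrite (bigD1 i)//= [in RHS](bigD1 i)//= {1}/A' eqxx.
      rewrite probability_setT mul1e; congr (_ * _)%E; apply: eq_bigr => k ki.
      by rewrite /A' (negbTE ki).
    apply/seteqP; split => -[u w] /=.
      move=> h; split; first by have := h i; rewrite tnth_upd eqxx.
      by move=> k; have := h k; rewrite tnth_upd /A'; case: ifP.
    move=> [Au h] k; rewrite tnth_upd; have := h k; rewrite /A'.
    by case: eqP => // ->.
  - by move=> _; rewrite ltey_eq fin_num_measure.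
rewrite (@eq_measure_integral _ _ _ _ nu); last by move=> A mA _; exact: Qnu.
rewrite ge0_integral_pushforward//; last exact: measurable_upd.
rewrite preimage_setT fubini_tonelli1//; last by move=> p; exact: F0.
exact: (measurableT_comp mF (measurable_upd i)).
Qed.

Lemma measurable_resampled i (F : n.-tuple U -> \bar R) :
  measurable_fun setT F -> (forall w, (0 <= F w)%E) ->
  measurable_fun setT (fun u => \int[Q]_w F (upd i u w))%E.
Proof.
move=> mF F0.
apply: (@measurable_fun_fubini_tonelli_F _ _ _ _ _ Q
  (F \o (fun p : U * n.-tuple U => upd i p.1 p.2))).
  exact: (measurableT_comp mF (measurable_upd i)).
by move=> p; exact: F0.
Qed.

Lemma integral_prod_tnth (s : seq 'I_n) (f : 'I_n -> U -> R) : uniq s ->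
  (forall i, measurable_fun setT (f i)) -> (forall i u, 0 <= f i u) ->
  (\int[Q]_w (\prod_(i <- s) f i (tnth w i))%:E =
   \prod_(i <- s) \int[G i]_u (f i u)%:E)%E.
Proof.
move=> + mf f0.
have mp (r : seq 'I_n) : measurable_fun setT
    (fun w : n.-tuple U => (\prod_(i <- r) f i (tnth w i))%:E).
  apply/measurable_EFinP; apply: measurable_prod => i _.
  exact: (measurableT_comp (mf i) (measurable_tnth i)).
have p0 (r : seq 'I_n) (w : n.-tuple U) : (0 <= (\prod_(i <- r) f i (tnth w i))%:E)%E.
  by rewrite lee_fin prodr_ge0.
elim: s => [_|i s IH /=/andP[is_ us]].
  under eq_integral do rewrite big_nil.
  by rewrite big_nil integral_cst//= probability_setT mule1.
rewrite (resample i)//.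
transitivity (\int[G i]_u ((f i u)%:E *
    \int[Q]_w (\prod_(j <- s) f j (tnth w j))%:E))%E.
  apply: eq_integral => u _; rewrite -ge0_integralZl//; last by rewrite lee_fin.
  apply: eq_integral => w _; rewrite big_cons tnth_upd eqxx EFinM.
  congr (_ * (_)%:E)%E; apply: eq_big_seq => j js; rewrite tnth_upd.
  by case: eqP js => // ->; rewrite (negbTE is_).
rewrite ge0_integralZr; [by rewrite big_cons IH| | | |]; first by [].
- exact/measurable_EFinP.
- by move=> u _; rewrite lee_fin.
- by apply: integral_ge0 => w _.
Qed.

End independent_coordinates.

(** The generating function of a Bernoulli variable, the single factor in Chernoff's method. *)
Lemma integral_two_valued d (U : measurableType d) (R : realType)
    (P : probability U R) (A : set U) (b p : R) : measurable A -> 0 <= b ->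
  P A = p%:E ->
  (\int[P]_u (if u \in A then b else 1)%:E)%E = (1 + (b - 1) * p)%:E.
Proof.
move=> mA b0 PA.
transitivity (\int[P]_u ((b * \1_A u)%:E + (1 * \1_(~` A) u)%:E))%E.
  apply: eq_integral => u _; rewrite -EFinD !indicE in_setC.
  by case: (u \in A); rewrite /= ?mulr1 ?mulr0 ?addr0 ?add0r.
have mAC : measurable_fun setT (\1_(~` A) : U -> R).
  by apply: measurable_indic; exact: measurableC.
rewrite ge0_integralD; [| | | | |]; last first.
- by apply/measurable_EFinP; apply: measurable_funM.
- by move=> u _; rewrite lee_fin mulr_ge0.
- by apply/measurable_EFinP; apply: measurable_funM.
- by move=> u _; rewrite lee_fin mulr_ge0.
- by [].
under eq_integral do rewrite EFinM.
rewrite ge0_integralZl_EFin//; last by apply/measurable_EFinP.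
have -> : (\int[P]_u (\1_A u)%:E)%E = p%:E by rewrite integral_indic// setIT -PA.
under eq_integral do rewrite EFinM.
rewrite ge0_integralZl_EFin//; last by apply/measurable_EFinP.
have -> : (\int[P]_u (\1_(~` A) u)%:E)%E = (1 - p)%:E.
  rewrite integral_indic//; last exact: measurableC.
  by rewrite setIT EFinB -PA -probability_setC.
rewrite -!EFinM -EFinD; congr (_%:E); ring.
Qed.

Lemma measure_le_integral d (U : measurableType d) (R : realType)
    (P : {measure set U -> \bar R}) (A : set U) (f : U -> R) :
  measurable A -> measurable_fun setT f -> (forall u, 0 <= f u) ->
  (forall u, A u -> 1 <= f u) -> (P A <= \int[P]_u (f u)%:E)%E.
Proof.
move=> mA mf f0 f1; rewrite -[A]setIT -integral_indic//.
apply: ge0_le_integral => //.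
- exact/measurable_EFinP.
- exact/measurable_EFinP.
- move=> u _; rewrite lee_fin indicE; case: (boolP (u \in A)) => // /set_mem; exact: f1.
Qed.

Lemma measurable_sum_pred d (T : measurableType d) (R : realType) (I : finType)
    (P : {pred I}) (h : I -> T -> R) :
  (forall i, i \in P -> measurable_fun setT (h i)) ->
  measurable_fun setT (fun x => \sum_(i in P) h i x).
Proof.
move=> mh; under eq_fun do rewrite big_mkcond.
apply: (@measurable_sum _ _ _ setT _ (index_enum I) (fun i x => if i \in P then h i x else 0)).
by move=> i; have [iP|iP] := boolP (i \in P); [exact: mh|].
Qed.

(** * Chernoff's bounds for counts of independent points *)

Section chernoff.
Context d (U : measurableType d) (R : realType) (n : nat).
Variables (G : 'I_n -> probability U R) (Q : probability (n.-tuple U) R).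
Hypothesis indepQ : forall A : 'I_n -> set U, (forall i, measurable (A i)) ->
  Q [set w | forall i, A i (tnth w i)] = (\prod_i G i (A i))%E.
Variables (S : {pred 'I_n}) (A : set U) (p : R).
Hypothesis mA : measurable A.
Hypothesis GA : forall i, i \in S -> G i A = p%:E.

Definition hits (w : n.-tuple U) : nat := (\sum_(i in S) (tnth w i \in A))%N.

Let tilt (b : R) (w : n.-tuple U) : R :=
  \prod_(i <- enum S) (if tnth w i \in A then b else 1).

Let tiltE b w : tilt b w = b ^+ hits w.
Proof.
rewrite /tilt /hits big_enum/= -prodrXr; apply: eq_bigr => i _.
by case: (_ \in _).
Qed.

Let measurable_if b : measurable_fun setT (fun u : U => if u \in A then b else 1 : R).
Proof.
rewrite (_ : (fun u => _) = fun u => (b - 1) * \1_A u + 1).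
  by apply: measurable_funD => //; apply: measurable_funM.
by apply/funext => u; rewrite indicE; case: (_ \in _); rewrite ?mulr1 ?subrK// mulr0 add0r.
Qed.

Lemma measurable_hits : measurable_fun setT (fun w => (hits w)%:R : R).
Proof.
rewrite (_ : (fun w => _) = fun w => \sum_(i in S) \1_A (tnth w i)).
  apply: measurable_sum_pred => i _.
  exact: (measurableT_comp (measurable_indic _) (measurable_tnth i)).
by apply/funext => w; rewrite /hits natr_sum; apply: eq_bigr => i _; rewrite indicE.
Qed.

Let integral_tilt b : 0 <= b ->
  (\int[Q]_w (tilt b w)%:E)%E = ((1 + (b - 1) * p) ^+ #|S|)%:E.
Proof.
move=> b0; rewrite (integral_prod_tnth indepQ (f := fun _ u => if u \in A then b else 1)).
- rewrite big_enum/= -prodr_const -prodEFin; apply: eq_bigr => i iS.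
  exact: (integral_two_valued _ b0 (GA iS)).
- exact: enum_uniq.
- by [].
- by move=> i u; case: ifP.
Qed.

Let measurable_tilt b : measurable_fun setT (tilt b).
Proof.
apply: measurable_prod => i _.
exact: (measurableT_comp (measurable_if b) (measurable_tnth i)).
Qed.

(** Markov's inequality for [b ^+ hits w], whose mean is a power of [1 + (b - 1) * p] by
    independence. Both tails are covered: the event asks for many hits if [b > 1] and for few if
    [b < 1]. *)
Let markov_tilt (b : R) (M : nat) (E : set (n.-tuple U)) : 0 < b -> measurable E ->
  0 <= 1 + (b - 1) * p ->
  (forall w, E w -> b ^+ M <= b ^+ hits w) ->
  (Q E <= (expR ((b - 1) * (#|S|%:R * p)) / b ^+ M)%:E)%E.
Proof.
move=> b0 mE bp EM.
apply: le_trans (measure_le_integral (f := fun w => (b ^+ M)^-1 * tilt b w) _ _ _ _ _) _ => //.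
- by apply: measurable_funM.
- by move=> w; rewrite tiltE mulr_ge0// ?invr_ge0 ?exprn_ge0// ltW.
- by move=> w Ew; rewrite tiltE ler_pdivlMl ?exprn_gt0// mulr1 EM.
under eq_integral do rewrite EFinM.
rewrite ge0_integralZl_EFin//; last 3 first.
- by move=> w _; rewrite lee_fin tiltE exprn_ge0// ltW.
- by apply/measurable_EFinP.
- by rewrite invr_ge0 exprn_ge0// ltW.
rewrite (integral_tilt (ltW b0)) -EFinM lee_fin mulrC ler_pM2r ?invr_gt0 ?exprn_gt0//.
have -> : (b - 1) * (#|S|%:R * p) = #|S|%:R * ((b - 1) * p) by ring.
rewrite expRM_natl lerXn2r ?nnegrE ?expR_ge0//; exact: expR_ge1Dx.
Qed.

Lemma chernoff_upper (a : R) (M : nat) : 0 <= a -> 0 <= p ->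
  (Q [set w | (M <= hits w)%N] <= (expR (a * (#|S|%:R * p)) / (1 + a) ^+ M)%:E)%E.
Proof.
move=> a0 p0; have := @markov_tilt (1 + a) M [set w | (M <= hits w)%N].
have -> : 1 + a - 1 = a by ring.
apply.
- by rewrite ltr_pwDl.
- rewrite (_ : [set w | _] = [set w | (M%:R : R) <= (hits w)%:R]).
    by apply: measurable_set_le => //; exact: measurable_hits.
  by apply/seteqP; split => w /=; rewrite ler_nat.
- by rewrite addr_ge0// mulr_ge0.
- by move=> w /= Mw; rewrite ler_weXn2l// lerDl.
Qed.

Lemma chernoff_lower (b : R) (M : nat) : 0 <= b < 1 -> 0 <= p <= 1 ->
  (Q [set w | (hits w < M)%N] <= (expR (- b * (#|S|%:R * p)) / (1 - b) ^+ M)%:E)%E.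
Proof.
move=> /andP[b0 b1] /andP[p0 p1]; have := @markov_tilt (1 - b) M [set w | (hits w < M)%N].
have -> : 1 - b - 1 = - b by ring.
apply.
- by rewrite subr_gt0.
- rewrite (_ : [set w | _] = ~` [set w | (M%:R : R) <= (hits w)%:R]).
    by apply: measurableC; apply: measurable_set_le => //; exact: measurable_hits.
  by apply/seteqP; split => w /=; rewrite ler_nat ltnNge => /negP.
- by rewrite mulNr subr_ge0 mulr_ile1// ltW.
- move=> w /= /ltnW Mw; apply: ler_wiXn2l => //; lra.
Qed.

End chernoff.

(** * Second moments of counts and a weighted square inequality *)

Section second_moment.
Context d (T : measurableType d) (R : realType) (I : finType).
Variables (Q : probability T R) (S : {pred I}) (E : I -> set T).
Hypothesis mE : forall j, j \in S -> measurable (E j).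

Lemma measurable_count : measurable_fun setT (fun w => \sum_(j in S) (\1_(E j) w : R)).
Proof.
by apply: measurable_sum_pred => j jS; apply: measurable_indic; exact: mE.
Qed.

(** Expanding the square leaves the pair probabilities, of size [a] off the diagonal and [b] on
    it. *)
Lemma second_moment_count (a b : R) : 0 <= a -> 0 <= b ->
  (forall j k, j \in S -> k \in S -> j != k -> (Q (E j `&` E k) <= a%:E)%E) ->
  (forall j, j \in S -> (Q (E j) <= b%:E)%E) ->
  (\int[Q]_w ((\sum_(j in S) \1_(E j) w) ^+ 2)%:E <= (#|S|%:R ^+ 2 * a + #|S|%:R * b)%:E)%E.
Proof.
move=> a0 b0 Ea Eb.
have -> : (\int[Q]_w ((\sum_(j in S) \1_(E j) w) ^+ 2)%:E =
    \sum_(j in S) \sum_(k in S) Q (E j `&` E k))%E.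
  pose SS := [pred p : I * I | (p.1 \in S) && (p.2 \in S)].
  transitivity (\int[Q]_w (\sum_(p <- enum SS) (\1_(E p.1 `&` E p.2) w)%:E))%E.
    apply: eq_integral => w _; rewrite big_enum/= expr2 big_distrlr/= sumEFin; congr (_%:E).
    rewrite (pair_big (mem S) (mem S) (fun j k => \1_(E j) w * \1_(E k) w))/=.
    by apply: eq_bigr => p _; rewrite indicI.
  have mEE p : p \in SS -> measurable (E p.1 `&` E p.2).
    by move=> /andP[? ?]; apply: measurableI; exact: mE.
  transitivity (\sum_(p <- enum SS) \int[Q]_w
      ((if p \in SS then \1_(E p.1 `&` E p.2) w else 0)%:E))%E.
    rewrite -ge0_integral_sum//.
    - by apply: eq_integral => w _; apply: eq_big_seq => p; rewrite mem_enum => ->.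
    - move=> p; case: (boolP (p \in SS)) => [/mEE m|_] //.
      by apply/measurable_EFinP; exact: measurable_indic.
    - by move=> p w _; rewrite lee_fin; case: ifP.
  rewrite big_enum/= (pair_big (mem S) (mem S) (fun j k => Q (E j `&` E k)))/=.
  by apply: eq_bigr => p pS; rewrite pS integral_indic ?setIT//; exact: mEE.
apply: (@le_trans _ _ (\sum_(j in S) (#|S|%:R * a + b)%:E)%E).
  apply: lee_sum => j jS; rewrite (bigD1 j)//= setIid addrC EFinD.
  apply: leeD; last exact: Eb.
  apply: (@le_trans _ _ (\sum_(k in S) a%:E)%E); last first.
    by rewrite sumEFin lee_fin sumr_const mulr_natl.
  rewrite [leRHS](bigD1 j)//= -[leLHS]add0e; apply: leeD; first by rewrite lee_fin.
  by apply: lee_sum => k /andP[kS kj]; rewrite Ea// eq_sym.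
by rewrite sumEFin lee_fin sumr_const -[leLHS]mulr_natl mulrDr mulrA expr2.
Qed.

End second_moment.

Lemma ler_indic (R : numDomainType) (T T' : Type) (A : set T) (B : set T') x y :
  (A x -> B y) -> (\1_A x : R) <= \1_B y.
Proof.
move=> AB; rewrite !indicE; case: (boolP (x \in A)) => // /set_mem/AB By.
by rewrite mem_set.
Qed.

Lemma sum_inv_consecutive (R : realType) (m : nat) :
  \sum_(k < m) ((k.+1 * k.+2)%:R^-1 : R) = 1 - m.+1%:R^-1.
Proof.
elim: m => [|m IH]; first by rewrite big_ord0 invr1 subrr.
by rewrite big_ord_recr/= IH natrM -!natr1; field; rewrite !natr1 !pnatr_eq0.
Qed.

(** Cauchy-Schwarz with the weights 1/((k+1)(k+2)), whose sum telescopes and stays below 1. The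
    bound does not depend on the number of terms. *)
Lemma weighted_square_sum (R : realType) (m : nat) (x : 'I_m -> R) :
  (\sum_k x k) ^+ 2 <= \sum_(k < m) x k ^+ 2 * (k.+1 * k.+2)%:R.
Proof.
pose a (k : 'I_m) : R := Num.sqrt ((k.+1 * k.+2)%:R^-1).
have a2 k : a k ^+ 2 = (k.+1 * k.+2)%:R^-1.
  by rewrite sqr_sqrtr// invr_ge0.
have a0 k : a k != 0 by rewrite -sqrf_eq0 a2 invr_eq0 pnatr_eq0 muln_eq0.
have := cauchy_schwarz_sum a (fun k => x k / a k).
under eq_bigr do rewrite mulrC divfK//.
under [in X in _ <= _ * X]eq_bigr do rewrite expr_div_n a2 invrK.
move=> /le_trans; apply; rewrite ler_piMl//.
  by apply: sumr_ge0 => k _; rewrite mulr_ge0// sqr_ge0.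
under eq_bigr do rewrite a2.
by rewrite sum_inv_consecutive gerBl.
Qed.

(** * Failures of a deterministic prediction of the selected points *)

Section matching_events.
Context d (U : measurableType d) (R : realType) (n : nat).
Variables (G : 'I_n -> probability U R) (Q : probability (n.-tuple U) R).
Hypothesis indepQ : forall A : 'I_n -> set U, (forall i, measurable (A i)) ->
  Q [set w | forall i, A i (tnth w i)] = (\prod_i G i (A i))%E.
Variables (Dn Tr : {pred 'I_n}) (G1 : probability U R).
Hypothesis disjTD : forall j, j \in Tr -> j \notin Dn.
Hypothesis G1E : forall j, j \in Tr -> G j = G1.
Variable B : U -> U -> bool.
Hypothesis mB : measurable [set p : U * U | B p.1 p.2].

Definition within (z : U) (w : n.-tuple U) : nat :=
  (\sum_(l in Dn) B z (tnth w l))%N.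

(* [z] is selected when fewer than [M] donors are nearer; [good] is a deterministic
   prediction of the selected points, and [wrong] says that it fails at [z]. *)
Definition wrong (good : set U) (M : nat) (z : U) (w : n.-tuple U) : bool :=
  if z \in good then (M <= within z w)%N else (within z w < M)%N.

(** The set [C] localises the failure, for instance to a shell. Two degenerate predictions are used
    as well: with [good = set0] being wrong means being selected, and with [good = setT] and [M = 0]
    the prediction always fails, so that only the presence in [C] is left. *)
Definition wrong_at (C good : set U) (M : nat) (j : 'I_n) : set (n.-tuple U) :=
  [set w | C (tnth w j) /\ wrong good M (tnth w j) w].

Lemma measurable_within :
  measurable_fun setT (fun p : U * n.-tuple U => (within p.1 p.2)%:R : R).
Proof.
rewrite (_ : (fun p => _) = fun p : U * n.-tuple U =>
    \sum_(l in Dn) \1_[set q : U * U | B q.1 q.2] (p.1, tnth p.2 l)).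
  apply: measurable_sum_pred => l _.
  apply: (measurableT_comp (measurable_indic mB)).
  apply/measurable_fun_pairP; split; first exact: measurable_fst.
  exact: (measurableT_comp (measurable_tnth l) measurable_snd).
apply/funext => p; rewrite /within natr_sum; apply: eq_bigr => l _.
rewrite indicE; case: (boolP (B _ _)) => h; first by rewrite mem_set.
by rewrite memNset//=; exact/negP.
Qed.

Lemma measurable_wrong good M : measurable good ->
  measurable [set p : U * n.-tuple U | wrong good M p.1 p.2].
Proof.
move=> mg; have mle : measurable [set p : U * n.-tuple U | (M <= within p.1 p.2)%N].
  rewrite (_ : [set p | _] = [set p : U * n.-tuple U | M%:R <= (within p.1 p.2)%:R :> R]).
    by apply: measurable_set_le => //; exact: measurable_within.
  by apply/seteqP; split => p /=; rewrite ler_nat.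
have mg' : measurable [set p : U * n.-tuple U | good p.1].
  by apply: (@measurable_preimage _ _ _ _ fst) => //; exact: measurable_fst.
rewrite (_ : [set p | _] =
   ([set p : U * n.-tuple U | good p.1] `&` [set p | (M <= within p.1 p.2)%N]) `|`
   (~` [set p | good p.1] `&` ~` [set p | (M <= within p.1 p.2)%N])).
  by apply: measurableU; apply: measurableI => //; exact: measurableC.
apply/seteqP; split => p /=; rewrite /wrong.
  case: ifPn => [/set_mem gp h|/negP gp h]; [left|right] => //; split.
    by move=> gg; apply: gp; exact/mem_set.
  by apply/negP; rewrite -ltnNge.
case=> -[gp h]; first by rewrite mem_set.
by rewrite memNset// ltnNge; exact/negP.
Qed.

Lemma measurable_wrong_section good M z : measurable good ->
  measurable [set w : n.-tuple U | wrong good M z w].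
Proof.
move=> mg.
apply: (@measurable_preimage _ _ _ _ (fun w => (z, w)) _ _ (measurable_wrong M mg)).
exact: pair1_measurable.
Qed.

Lemma measurable_wrong_at C good M j : measurable C -> measurable good ->
  measurable (wrong_at C good M j).
Proof.
move=> mC mg; apply: measurableI.
  apply: (@measurable_preimage _ _ _ _ (fun w => tnth w j)) => //.
  exact: measurable_tnth.
apply: (@measurable_preimage _ _ _ _ (fun w => (tnth w j, w)) _ _ (measurable_wrong M mg)).
by apply: measurable_fun_pair => //; exact: (measurable_tnth j).
Qed.

Lemma within_upd j u z w : j \in Tr -> within z (upd j u w) = within z w.
Proof.
move=> jT; apply: eq_bigr => l lD; rewrite tnth_upd; case: eqP => // lj.
by move: (disjTD jT); rewrite -lj lD.
Qed.

(** Conditioning on coordinate [j]: the event forces it into [C], which costs a factor [g], and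
    given its position the remaining randomness costs a factor [p]. *)
Lemma resample_bound j C E (g p : R) : measurable C -> measurable E -> 0 <= p ->
  (G j C <= g%:E)%E -> (forall u w, E (upd j u w) -> C u) ->
  (forall u, C u -> (Q [set w | E (upd j u w)] <= p%:E)%E) -> (Q E <= (g * p)%:E)%E.
Proof.
move=> mC mE p0 Cg EC Qp.
rewrite -[E]setIT -integral_indic// (resample indepQ j); last 2 first.
- by apply/measurable_EFinP; exact: measurable_indic.
- by move=> w; rewrite lee_fin.
apply: (@le_trans _ _ (\int[G j]_u (\1_C u * p)%:E)%E).
  apply: ge0_le_integral => //.
  - by move=> u _; apply: integral_ge0 => w _; rewrite lee_fin.
  - apply: (measurable_resampled Q j (F := fun w => (\1_(_ : set (n.-tuple U)) w)%:E)) => [|w].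
      by apply/measurable_EFinP; exact: measurable_indic.
    by rewrite lee_fin.
  - by apply/measurable_EFinP; apply: measurable_funM.
  have mEu u : measurable [set w | E (upd j u w)].
    apply: (@measurable_preimage _ _ _ _ (upd j u)) => //.
    exact: (measurableT_comp (measurable_upd j) (pair1_measurable u)).
  move=> u _; case: (boolP (u \in C)) => uC.
    rewrite indicE uC mul1r; apply: le_trans (Qp u (set_mem uC)).
    by rewrite -[X in Q X]setIT -integral_indic.
  rewrite indicE (negbTE uC) mul0r integral0_eq// => w _.
  by rewrite indicE memNset// => /EC Cu; move: uC; rewrite mem_set.
under eq_integral do rewrite EFinM.
rewrite ge0_integralZr//; last exact/measurable_EFinP.
rewrite integral_indic// setIT EFinM lee_pmul//; exact: measure_ge0.
Qed.

Lemma wrong_at_le C good M j (g p : R) : measurable C -> measurable good ->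
  j \in Tr -> 0 <= p -> (G1 C <= g%:E)%E ->
  (forall z, C z -> (Q [set w | wrong good M z w] <= p%:E)%E) ->
  (Q (wrong_at C good M j) <= (g * p)%:E)%E.
Proof.
move=> mC mg jT p0 Cg Qp.
have E u w : wrong_at C good M j (upd j u w) <-> C u /\ wrong good M u w.
  by rewrite /wrong_at /= tnth_upd eqxx /wrong within_upd.
apply: (resample_bound (j := j) mC) => //; [exact: measurable_wrong_at|by rewrite G1E| |].
  by move=> u w /E[].
move=> u Cu; apply: le_trans (Qp u Cu); apply: le_measure; rewrite ?inE.
- apply: (@measurable_preimage _ _ _ _ (upd j u)); last exact: measurable_wrong_at.
  exact: (measurableT_comp (measurable_upd j) (pair1_measurable u)).
- exact: measurable_wrong_section.
- by move=> w /E[].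
Qed.

(** The positions of the two seekers are independent and give [g ^+ 2]. Their failures depend on the
    same donors, so the failure at [k] is dropped and [p] is gained only once. *)
Lemma wrong_at2_le C good M j k (g p : R) : measurable C -> measurable good ->
  j \in Tr -> k \in Tr -> j != k -> 0 <= g -> 0 <= p -> (G1 C <= g%:E)%E ->
  (forall z, C z -> (Q [set w | wrong good M z w] <= p%:E)%E) ->
  (Q (wrong_at C good M j `&` wrong_at C good M k) <= (g ^+ 2 * p)%:E)%E.
Proof.
move=> mC mg jT kT jk g0 p0 Cg Qp.
have mW i : measurable (wrong_at C good M i) by exact: measurable_wrong_at.
rewrite expr2 -mulrA; apply: (resample_bound (j := k) mC); [exact: measurableI|exact: mulr_ge0|
  by rewrite G1E| |].
  by move=> u w [_ []]; rewrite tnth_upd eqxx.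
move=> u Cu; apply: le_trans (wrong_at_le mC mg jT p0 Cg Qp); apply: le_measure; rewrite ?inE//.
- apply: (@measurable_preimage _ _ _ _ (upd k u)); last exact: measurableI.
  exact: (measurableT_comp (measurable_upd k) (pair1_measurable u)).
- by move=> w [+ _]; rewrite /wrong_at /= tnth_upd (negbTE jk) /wrong within_upd.
Qed.

Lemma wrong_at_second_moment C good M (g p : R) : measurable C -> measurable good ->
  0 <= g -> 0 <= p -> (G1 C <= g%:E)%E ->
  (forall z, C z -> (Q [set w | wrong good M z w] <= p%:E)%E) ->
  (\int[Q]_w ((\sum_(j in Tr) \1_(wrong_at C good M j) w) ^+ 2)%:E <=
    (#|Tr|%:R ^+ 2 * (g ^+ 2 * p) + #|Tr|%:R * (g * p))%:E)%E.
Proof.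
move=> mC mg g0 p0 Cg Qp; apply: second_moment_count.
- by move=> j _; exact: measurable_wrong_at.
- by rewrite mulr_ge0// sqr_ge0.
- by rewrite mulr_ge0.
- by move=> j k jT kT jk; exact: wrong_at2_le.
- by move=> j jT; exact: wrong_at_le.
Qed.

Lemma wrong_at_trivial C j : wrong_at C setT 0 j = [set w | C (tnth w j)].
Proof.
apply/seteqP; split => w /= => [[]//|Cj]; split => //.
by rewrite /wrong in_setT.
Qed.

Lemma occupancy_second_moment C (g : R) : measurable C -> 0 <= g ->
  (G1 C <= g%:E)%E ->
  (\int[Q]_w ((\sum_(j in Tr) \1_C (tnth w j)) ^+ 2)%:E <=
    (#|Tr|%:R ^+ 2 * g ^+ 2 + #|Tr|%:R * g)%:E)%E.
Proof.
move=> mC g0 Cg.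
have := @wrong_at_second_moment C setT 0 g 1 mC measurableT g0 ler01 Cg.
rewrite !mulr1; under eq_integral do under eq_bigr do rewrite wrong_at_trivial.
by apply => z _; apply: probability_le1; exact: measurable_wrong_section.
Qed.

Lemma measurable_occupancy C : measurable C ->
  measurable_fun setT (fun w : n.-tuple U => \sum_(j in Tr) \1_C (tnth w j) : R).
Proof.
move=> mC; apply: measurable_sum_pred => j _.
exact: (measurableT_comp (measurable_indic mC) (measurable_tnth j)).
Qed.

Lemma occupancy_mean C (g : R) : measurable C -> G1 C = g%:E ->
  (\int[Q]_w (\sum_(j in Tr) \1_C (tnth w j))%:E = (#|Tr|%:R * g)%:E)%E.
Proof.
move=> mC Cg.
transitivity (\int[Q]_w (\sum_(j <- enum Tr) (\1_C (tnth w j))%:E))%E.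
  by apply: eq_integral => w _; rewrite big_enum/= sumEFin.
rewrite ge0_integral_sum//; last first.
  move=> j; apply/measurable_EFinP.
  exact: (measurableT_comp (measurable_indic mC) (measurable_tnth j)).
rewrite big_enum/= mulr_natl -sumr_const -sumEFin; apply: eq_bigr => j jT.
rewrite (resample indepQ j); last 2 first.
- apply/measurable_EFinP.
  exact: (measurableT_comp (measurable_indic mC) (measurable_tnth j)).
- by move=> w; rewrite lee_fin.
transitivity (\int[G j]_u (\1_C u)%:E)%E.
  apply: eq_integral => u _; under eq_integral do rewrite tnth_upd eqxx.
  by rewrite integral_cst//= probability_setT mule1.
by rewrite integral_indic// setIT G1E.
Qed.

Lemma occupancy_variance C (g : R) : measurable C -> 0 <= g -> G1 C = g%:E ->
  (\int[Q]_w ((\sum_(j in Tr) \1_C (tnth w j) - #|Tr|%:R * g) ^+ 2)%:E <=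
    (#|Tr|%:R * g)%:E)%E.
Proof.
move=> mC g0 Cg; set S := fun w : n.-tuple U => \sum_(j in Tr) \1_C (tnth w j) : R.
set c := #|Tr|%:R * g; have c0 : 0 <= c by rewrite mulr_ge0.
have mS : measurable_fun setT S := measurable_occupancy mC.
have S0 w : 0 <= S w by apply: sumr_ge0.
(* The cross term of the square is kept on the left as a mean of [2 * c * S], which avoids
   subtracting integrals in the extended reals. *)
have : (\int[Q]_w ((S w - c) ^+ 2)%:E + (2 * c * c)%:E <= (2 * c * c + c)%:E)%E.
  rewrite [X in (_ + X)%E](_ : _ = \int[Q]_w (2 * c * S w)%:E)%E; last first.
    under eq_integral do rewrite EFinM.
    rewrite ge0_integralZl_EFin ?mulr_ge0//; last 2 first.
    - by move=> w _; rewrite lee_fin.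
    - exact/measurable_EFinP.
    by rewrite (occupancy_mean mC Cg).
  rewrite -ge0_integralD//; last 4 first.
  - by move=> w _; rewrite lee_fin sqr_ge0.
  - by apply/measurable_EFinP; apply: measurable_funX; exact: measurable_funB.
  - by move=> w _; rewrite lee_fin !mulr_ge0.
  - by apply/measurable_EFinP; exact: measurable_funM.
  have E w : (((S w - c) ^+ 2)%:E + (2 * c * S w)%:E = (S w ^+ 2)%:E + (c ^+ 2)%:E)%E.
    by rewrite -!EFinD; congr (_%:E); ring.
  under eq_integral do rewrite E.
  rewrite ge0_integralD//; last 3 first.
  - by move=> w _; rewrite lee_fin sqr_ge0.
  - by apply/measurable_EFinP; exact: measurable_funX.
  - by move=> w _; rewrite lee_fin sqr_ge0.
  rewrite integral_cst//= probability_setT mule1.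
  apply: (@le_trans _ _ ((#|Tr|%:R ^+ 2 * g ^+ 2 + #|Tr|%:R * g)%:E + (c ^+ 2)%:E)%E).
    by apply: leeD => //; apply: occupancy_second_moment => //; rewrite Cg.
  by rewrite -EFinD lee_fin /c; apply: eq_ler; ring.
rewrite addrC EFinD leeD2lE//.
Qed.

Definition selected (M : nat) (w : n.-tuple U) : nat :=
  (\sum_(j in Tr) (within (tnth w j) w < M))%N.

Lemma selectedE M w : (selected M w)%:R =
  \sum_(j in Tr) \1_(wrong_at setT set0 M j) w :> R.
Proof.
rewrite /selected natr_sum; apply: eq_bigr => j _; rewrite indicE; congr (_%:R).
rewrite -[in LHS](_ : wrong set0 M (tnth w j) w = (within (tnth w j) w < M)%N); last first.
  by rewrite /wrong in_set0.
case: (boolP (wrong _ _ _ _)) => h; first by rewrite mem_set.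
by rewrite memNset// => -[_]; exact/negP.
Qed.

Lemma measurable_selected M : measurable_fun setT (fun w => (selected M w)%:R : R).
Proof.
under eq_fun do rewrite selectedE.
by apply: measurable_count => j _; exact: measurable_wrong_at.
Qed.

(* Far from the base point a selection is unlikely, near to it selection is
   compared with membership in the deterministic set [good], shell by shell. *)
Section selected_deviation.
Variables (M kmax : nat) (near good : set U) (bin : nat -> set U).
Variables (b beta far : R) (p : nat -> R) (cp : R).
Hypotheses (mnear : measurable near) (mgood : measurable good).
Hypothesis mbin : forall k, measurable (bin k).
Hypotheses (b0 : 0 <= b) (beta0 : 0 <= beta) (far0 : 0 <= far).
Hypothesis p0 : forall k, 0 <= p k.
Hypothesis goodS : good `<=` near.
Hypothesis nearS : forall z, near z -> exists2 k, (k < kmax)%N & bin k z.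
Hypothesis Gbin : forall k, (k < kmax)%N -> (G1 (bin k) <= b%:E)%E.
Hypothesis Ggood : G1 good = beta%:E.
Hypothesis Qfar : forall z, ~ near z -> (Q [set w | (within z w < M)%N] <= far%:E)%E.
Hypothesis Qbin : forall k z, (k < kmax)%N -> near z -> bin k z ->
  (Q [set w | wrong good M z w] <= (p k)%:E)%E.
Hypothesis sum_p : \sum_(k < kmax) p k * (k.+1 * k.+2)%:R <= cp.

Let nT : R := #|Tr|%:R.

(** The count of selected seekers differs from the occupancy of [good] by at most the selected far
    seekers plus the failures in the bins. The bins contribute, after the weighted square
    inequality, the same second moment times [p k * (k.+1 * k.+2)], summed to [cp]. The last term is
    the binomial variance of the occupancy. *)
Lemma selected_deviation :
  (\int[Q]_w (((selected M w)%:R - nT * beta) ^+ 2)%:E <=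
   (3 * (nT ^+ 2 * far + nT * far + cp * (nT ^+ 2 * b ^+ 2 + nT * b) + nT * beta))%:E)%E.
Proof.
pose Far w : R := \sum_(j in Tr) \1_(wrong_at (~` near) set0 M j) w.
pose Bad (k : 'I_kmax) w : R := \sum_(j in Tr) \1_(wrong_at (near `&` bin k) good M j) w.
pose Occ w : R := \sum_(j in Tr) \1_good (tnth w j).
have mFar : measurable_fun setT Far.
  by apply: measurable_count => j _; apply: measurable_wrong_at => //; exact: measurableC.
have mBad k : measurable_fun setT (Bad k).
  by apply: measurable_count => j _; apply: measurable_wrong_at => //; exact: measurableI.
have mOcc : measurable_fun setT Occ := measurable_occupancy mgood.
have Far0 w : 0 <= Far w by apply: sumr_ge0.
have Bad0 k w : 0 <= Bad k w by apply: sumr_ge0.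
have key w : `|(selected M w)%:R - Occ w| <= Far w + \sum_k Bad k w.
  rewrite selectedE /Occ -sumrB (le_trans (ler_norm_sum _ _ _))//.
  rewrite /Far /Bad exchange_big/= -big_split/=; apply: ler_sum => j jT.
  have s0 : 0 <= \sum_(k < kmax) \1_(wrong_at (near `&` bin k) good M j) w :> R.
    by apply: sumr_ge0.
  have f0 : 0 <= \1_(wrong_at (~` near) set0 M j) w :> R by [].
  have [nj|nj] := pselect (near (tnth w j)); last first.
    have ng : ~ good (tnth w j) by move/goodS.
    rewrite [X in _ - X]indicE memNset// subr0 ger0_norm//.
    by rewrite ler_wpDr// ler_indic// => -[_ h]; split.
  have [k kk bk] := nearS nj.
  apply: (@le_trans _ _ (\1_(wrong_at (near `&` bin k) good M j) w)); last first.
    rewrite ler_wpDl// (bigD1 (Ordinal kk))//= lerDl.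
    by apply: sumr_ge0.
  rewrite !indicE; case: (boolP (tnth w j \in good)) => gj;
      case: (boolP (w \in wrong_at setT set0 M j)) => wj;
      rewrite /= ?subrr ?normr0// ?subr0 ?sub0r ?normrN ?normr1.
    rewrite mem_set//; split; first by split.
    rewrite /wrong gj leqNgt; apply/negP => h; move/negP: wj; apply.
    by apply/mem_set; split => //; rewrite /wrong in_set0.
  rewrite mem_set//; split; first by split.
  move/set_mem: wj => -[_]; rewrite /wrong (negbTE gj) in_set0//.
have pw w : ((selected M w)%:R - nT * beta) ^+ 2 <=
    3 * (Far w ^+ 2 + \sum_k Bad k w ^+ 2 * (k.+1 * k.+2)%:R + (Occ w - nT * beta) ^+ 2).
  have sB0 : 0 <= \sum_k Bad k w by apply: sumr_ge0.
  have h1 := weighted_square_sum (fun k => Bad k w).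
  have h2 := key w.
  set s := (selected M w)%:R in h2 *; set o := Occ w in h2 *.
  set F := Far w in h2 *; set B' := \sum_k Bad k w in h1 h2 sB0 *.
  apply: (@le_trans _ _ (3 * (F ^+ 2 + B' ^+ 2 + (o - nT * beta) ^+ 2))); last first.
    by rewrite ler_pM2l// lerD2r lerD2l.
  have h3 : (s - o) ^+ 2 <= (F + B') ^+ 2.
    by rewrite -(real_normK (num_real (s - o))) ler_pXn2r ?nnegrE ?addr_ge0 ?Far0.
  have -> : s - nT * beta = (s - o) + (o - nT * beta) by ring.
  set x := s - o in h3 *; set y := o - nT * beta.
  have q1 : 0 <= (x *+ 1 - y *+ 2) ^+ 2 by exact: sqr_ge0.
  have q2 : 0 <= (F - B') ^+ 2 by exact: sqr_ge0.
  rewrite -subr_ge0 in h3; rewrite -subr_ge0.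
  (* The square of [x + y] is 3/2 x^2 + 3 y^2 - (x - 2y)^2/2, and 3/2 (F + B')^2 is 3 F^2 + 3 B'^2 -
     3/2 (F - B')^2. *)
  have -> : 3 * (F ^+ 2 + B' ^+ 2 + y ^+ 2) - (x + y) ^+ 2 =
    3 / 2 * ((F + B') ^+ 2 - x ^+ 2) + 3 / 2 * (F - B') ^+ 2 + 1 / 2 * (x *+ 1 - y *+ 2) ^+ 2.
    by field.
  by rewrite !addr_ge0// mulr_ge0.
apply: (@le_trans _ _ (\int[Q]_w ((3 * Far w ^+ 2)%:E +
    (\sum_k (3 * (Bad k w ^+ 2 * (k.+1 * k.+2)%:R))%:E +
     (3 * (Occ w - nT * beta) ^+ 2)%:E)))%E).
  apply: ge0_le_integral => //.
  - by move=> w _; rewrite lee_fin sqr_ge0.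
  - apply/measurable_EFinP; apply: measurable_funX; apply: measurable_funB => //.
    exact: measurable_selected.
  - apply: emeasurable_funD.
      by apply/measurable_EFinP; apply: measurable_funM => //; exact: measurable_funX.
    apply: emeasurable_funD.
      apply: emeasurable_sum => k; apply/measurable_EFinP.
      by do 2 (apply: measurable_funM => //); exact: measurable_funX.
    apply/measurable_EFinP; apply: measurable_funM => //; apply: measurable_funX.
    exact: measurable_funB.
  - move=> w _; rewrite sumEFin -!EFinD lee_fin (le_trans (pw w))//.
    by rewrite -mulr_sumr !mulrDr addrA.
have mO2 : measurable_fun setT (fun w => (3 * (Occ w - nT * beta) ^+ 2)%:E).
  apply/measurable_EFinP; apply: measurable_funM => //; apply: measurable_funX.
  exact: measurable_funB.
have mB2 (k : 'I_kmax) : measurable_fun setT (fun w => (3 * (Bad k w ^+ 2 * (k.+1 * k.+2)%:R))%:E).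
  apply/measurable_EFinP.
  by do 2 (apply: measurable_funM => //); exact: measurable_funX.
rewrite ge0_integralD//; last 4 first.
- by move=> w _; rewrite lee_fin mulr_ge0// sqr_ge0.
- by apply/measurable_EFinP; apply: measurable_funM => //; exact: measurable_funX.
- move=> w _; rewrite adde_ge0//; last by rewrite lee_fin mulr_ge0// sqr_ge0.
  by apply: sume_ge0 => k _; rewrite lee_fin !mulr_ge0// sqr_ge0.
- by apply: emeasurable_funD => //; exact: emeasurable_sum.
rewrite ge0_integralD//; last 3 first.
- by move=> w _; apply: sume_ge0 => k _; rewrite lee_fin !mulr_ge0// sqr_ge0.
- exact: emeasurable_sum.
- by move=> w _; rewrite lee_fin mulr_ge0// sqr_ge0.
rewrite ge0_integral_sum//; last first.
  by move=> k w _; rewrite lee_fin !mulr_ge0// sqr_ge0.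
have -> : 3 * (nT ^+ 2 * far + nT * far + cp * (nT ^+ 2 * b ^+ 2 + nT * b) + nT * beta)
   = 3 * (nT ^+ 2 * far + nT * far) + (3 * (cp * (nT ^+ 2 * b ^+ 2 + nT * b)) + 3 * (nT * beta)).
  by ring.
have pull (f : n.-tuple U -> R) (c : R) : 0 <= c -> measurable_fun setT f ->
    (forall w, 0 <= f w) ->
    (\int[Q]_w (c * f w)%:E = c%:E * \int[Q]_w (f w)%:E)%E.
  move=> c0 mf f0; under eq_integral do rewrite EFinM.
  by rewrite ge0_integralZl_EFin//; [move=> w _; rewrite lee_fin|exact/measurable_EFinP].
rewrite !EFinD; apply: leeD; last apply: leeD.
- rewrite pull//; [|exact: measurable_funX|by move=> w; exact: sqr_ge0].
  rewrite EFinM lee_pmul2l// (le_trans (wrong_at_second_moment (g := 1) _ _ _ far0 _ _))//.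
  + exact: measurableC.
  + by apply: probability_le1; exact: measurableC.
  + move=> z nz; rewrite (_ : [set w | _] = [set w | (within z w < M)%N]); first exact: Qfar.
    by apply/seteqP; split => w /=; rewrite /wrong in_set0.
  + by rewrite expr1n !mul1r.
- apply: (@le_trans _ _ (\sum_(k < kmax) (3 * ((nT ^+ 2 * b ^+ 2 + nT * b) * (p k * (k.+1 * k.+2)%:R)))%:E)%E).
    apply: lee_sum => k _.
    have E w : 3 * (Bad k w ^+ 2 * (k.+1 * k.+2)%:R) = (3 * (k.+1 * k.+2)%:R) * Bad k w ^+ 2 by ring.
    under eq_integral do rewrite E.
    rewrite pull//; [|exact: measurable_funX|by move=> w; exact: sqr_ge0].
    apply: (@le_trans _ _ ((3 * (k.+1 * k.+2)%:R)%:E *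
       (nT ^+ 2 * (b ^+ 2 * p k) + nT * (b * p k))%:E)%E).
      apply: lee_wpmul2l; first by rewrite lee_fin mulr_ge0.
      apply: wrong_at_second_moment => //; first exact: measurableI.
        apply: le_trans (Gbin (ltn_ord k)); apply: le_measure; rewrite ?inE//.
          exact: measurableI.
      by move=> z [nz bz]; exact: Qbin.
    by rewrite -EFinM lee_fin; apply: eq_ler; ring.
  rewrite sumEFin lee_fin -mulr_sumr ler_pM2l// -mulr_sumr mulrC ler_wpM2r//.
  by rewrite addr_ge0 ?mulr_ge0 ?sqr_ge0.
- rewrite pull//; [|by apply: measurable_funX; exact: measurable_funB|by move=> w; exact: sqr_ge0].
  by rewrite [leRHS]EFinM lee_pmul2l//; exact: occupancy_variance.
Qed.

(** Without a prediction: every seeker in [near] is counted as if it were selected. This is the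
    estimate available for base points close to the boundary of the support. *)
Lemma selected_second_moment (bn : R) : 0 <= bn -> (G1 near <= bn%:E)%E ->
  (\int[Q]_w (((selected M w)%:R) ^+ 2)%:E <=
   (2 * (nT ^+ 2 * far + nT * far + nT ^+ 2 * bn ^+ 2 + nT * bn))%:E)%E.
Proof.
move=> bn0 Gn.
pose Far w : R := \sum_(j in Tr) \1_(wrong_at (~` near) set0 M j) w.
pose Occ w : R := \sum_(j in Tr) \1_near (tnth w j).
have mFar : measurable_fun setT Far.
  by apply: measurable_count => j _; apply: measurable_wrong_at => //; exact: measurableC.
have mOcc : measurable_fun setT Occ := measurable_occupancy mnear.
have Far0 w : 0 <= Far w by apply: sumr_ge0.
have Occ0 w : 0 <= Occ w by apply: sumr_ge0.
have key w : (selected M w)%:R <= Far w + Occ w.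
  rewrite selectedE /Occ /Far -big_split/=; apply: ler_sum => j jT.
  have [nj|nj] := pselect (near (tnth w j)).
    by rewrite ler_wpDl// ler_indic.
  by rewrite ler_wpDr// ler_indic// => -[_ h]; split.
apply: (@le_trans _ _ (\int[Q]_w ((2 * Far w ^+ 2)%:E + (2 * Occ w ^+ 2)%:E))%E).
  apply: ge0_le_integral => //.
  - by apply/measurable_EFinP; apply: measurable_funX; exact: measurable_selected.
  - by apply: emeasurable_funD; apply/measurable_EFinP; apply: measurable_funM => //;
      exact: measurable_funX.
  - move=> w _; rewrite -EFinD lee_fin.
    apply: (@le_trans _ _ ((Far w + Occ w) ^+ 2)).
      by rewrite ler_pXn2r ?nnegrE ?addr_ge0.
    rewrite -subr_ge0 (_ : _ - _ = (Far w - Occ w) ^+ 2) ?sqr_ge0//; ring.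
rewrite ge0_integralD//; last 4 first.
- by move=> w _; rewrite lee_fin mulr_ge0// sqr_ge0.
- by apply/measurable_EFinP; apply: measurable_funM => //; exact: measurable_funX.
- by move=> w _; rewrite lee_fin mulr_ge0// sqr_ge0.
- by apply/measurable_EFinP; apply: measurable_funM => //; exact: measurable_funX.
have pull (f : n.-tuple U -> R) (c : R) : 0 <= c -> measurable_fun setT f ->
    (forall w, 0 <= f w) ->
    (\int[Q]_w (c * f w)%:E = c%:E * \int[Q]_w (f w)%:E)%E.
  move=> c0 mf f0; under eq_integral do rewrite EFinM.
  by rewrite ge0_integralZl_EFin//; [move=> w _; rewrite lee_fin|exact/measurable_EFinP].
have -> : 2 * (nT ^+ 2 * far + nT * far + nT ^+ 2 * bn ^+ 2 + nT * bn) =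
  2 * (nT ^+ 2 * far + nT * far) + 2 * (nT ^+ 2 * bn ^+ 2 + nT * bn) by ring.
rewrite EFinD; apply: leeD.
- rewrite pull//; [|exact: measurable_funX|by move=> w; exact: sqr_ge0].
  rewrite EFinM lee_pmul2l// (le_trans (wrong_at_second_moment (g := 1) _ _ _ far0 _ _))//.
  + exact: measurableC.
  + by apply: probability_le1; exact: measurableC.
  + move=> z nz; rewrite (_ : [set w | _] = [set w | (within z w < M)%N]); first exact: Qfar.
    by apply/seteqP; split => w /=; rewrite /wrong in_set0.
  + by rewrite expr1n !mul1r.
- rewrite pull//; [|exact: measurable_funX|by move=> w; exact: sqr_ge0].
  by rewrite EFinM lee_pmul2l//; exact: occupancy_second_moment.
Qed.

End selected_deviation.

End matching_events.

(** * Balls, supports and convex sets *)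

Section ball_volume.
Variables (R : realType) (m : nat).
Hypothesis m_gt0 : (0 < m)%N.
Local Notation V := (unit_ball_volume R m).
Local Notation lam := (lebesgue_rV R m).

Lemma lebesgue_cube (x : 'rV[R]_m) (b : R) : 0 <= b ->
  lam [set v | forall i, x ord0 i - b <= v ord0 i <= x ord0 i + b] =
  ((2 * b) ^+ m)%:E.
Proof.
move=> b0; pose lo := \row_i (x ord0 i - b); pose hi := \row_i (x ord0 i + b).
have lohi i : lo ord0 i <= hi ord0 i by rewrite !mxE; lra.
rewrite (_ : [set v | _] = [set v | forall i, lo ord0 i <= v ord0 i <= hi ord0 i]).
  rewrite lebesgue_rV_box//; congr (_%:E).
  rewrite -[in RHS](card_ord m) -prodr_const; apply: eq_bigr => i _.
  by rewrite !mxE; ring.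
by apply/seteqP; split => v /= h i; have := h i; rewrite !mxE.
Qed.

Lemma measurable_cube (x : 'rV[R]_m) (b : R) :
  measurable [set v : 'rV[R]_m | forall i, x ord0 i - b <= v ord0 i <= x ord0 i + b].
Proof.
rewrite (_ : [set v | _] = \bigcap_(i in [set: 'I_m])
   (@Defs.coord R m i @^-1` `[x ord0 i - b, x ord0 i + b]%classic)).
  apply: fin_bigcap_measurable => // i _.
  apply: (@measurable_preimage _ _ _ (measurableTypeR R)) => //.
  exact: measurable_coord.
by apply/seteqP; split => v /= h i; have := h i; rewrite /Defs.coord /= in_itv//= => /(_ I).
Qed.

Lemma unit_ball_volumeE : lam (eball 0 1) = V%:E.
Proof.
rewrite /unit_ball_volume fineK// ge0_fin_numE//.
apply: (@le_lt_trans _ _ (((2 * 1) ^+ m)%:E)); last exact: ltry.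
rewrite -(@lebesgue_cube 0 1)//; apply: le_measure; rewrite ?inE.
- exact: measurable_eball.
- exact: measurable_cube.
move=> v; rewrite /eball/= /Defs.edist subr0 => v1 i.
have := le_trans (ler_coord_enorm v i) v1; rewrite mxE ler_norml; lra.
Qed.

Lemma unit_ball_volume_gt0 : 0 < V.
Proof.
have m0 : 0 < m%:R :> R by rewrite ltr0n.
rewrite -lte_fin -unit_ball_volumeE.
apply: (@lt_le_trans _ _ (((2 * m%:R^-1) ^+ m)%:E)).
  by rewrite lte_fin exprn_gt0// mulr_gt0// invr_gt0.
rewrite -(@lebesgue_cube 0) ?invr_ge0//; apply: le_measure; rewrite ?inE.
- exact: measurable_cube.
- exact: measurable_eball.
move=> v h; rewrite /eball/= /Defs.edist subr0.
rewrite (le_trans (enorm_le_box (b := m%:R^-1) m_gt0 _))//.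
  by move=> i; have := h i; rewrite !mxE !add0r -ler_norml.
by rewrite mulfV// lt0r_neq0.
Qed.

Lemma lebesgue_eball (x : 'rV[R]_m) r : 0 <= r -> lam (eball x r) = (V * r ^+ m)%:E.
Proof.
rewrite le_eqVlt => /predU1P[<-|r0]; last first.
  rewrite (lebesgue_rV_affine x r0 (measurable_eball x r)).
  rewrite (_ : _ @^-1` _ = eball 0 1) ?unit_ball_volumeE; first by rewrite -EFinM mulrC.
  apply/seteqP; split => y; rewrite /eball/= /Defs.edist subr0 addrK enormZ gtr0_norm//;
    by have -> : (r * enorm y <= r) = (enorm y <= 1) by rewrite -[X in _ <= X]mulr1 ler_pM2l.
(* The ball of radius zero is a point, hence a cube of side zero, and is null because the dimension
   is positive. *)
rewrite expr0n (gtn_eqF m_gt0) mulr0.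
transitivity (lam [set v | forall i, x ord0 i - 0 <= v ord0 i <= x ord0 i + 0]); last first.
  by rewrite lebesgue_cube// mulr0 expr0n (gtn_eqF m_gt0).
congr (lam _); apply/seteqP; split => y.
  by rewrite /eball/= => /edist_eq0 -> i; rewrite subr0 addr0 lexx.
move=> h; suff -> : y = x by rewrite /eball/= edistxx.
by apply/rowP => i; apply/le_anti; have := h i; rewrite subr0 addr0 andbC.
Qed.

Lemma lebesgue_rV_shift (t : 'rV[R]_m) (A : set 'rV[R]_m) : measurable A ->
  lam ((fun y : 'rV[R]_m => y + t) @^-1` A) = lam A.
Proof.
move=> mA; rewrite (lebesgue_rV_affine t ltr01 mA) expr1n mul1e.
by congr (lam _); apply/seteqP; split => y; rewrite /= scale1r.
Qed.

End ball_volume.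

(** * The support of a law is measurable and has full mass *)

Section support.
Variables (R : realType) (m : nat) (G : probability 'rV[R]_m R).
Hypothesis m_gt0 : (0 < m)%N.

Definition msupport : set 'rV[R]_m :=
  [set x | forall r, 0 < r -> (0 < G (eball x r))%E].

(* The complement of the support is the union of the null balls with rational
   centre and radius. *)
Let null_ball (k : nat) : set 'rV[R]_m :=
  if unpickle k is Some (q, s) then
    let x := map_mx (@ratr R) (q : 'rV[rat]_m) in
    if G (eball x (ratr (s : rat))) == 0%E then ~` [set y | ratr s <= edist y x] else set0
  else set0.

Let measurable_null_ball k : measurable (null_ball k).
Proof.
rewrite /null_ball; case: (unpickle k) => [[q s]|//]; case: ifP => // _.
by apply: measurableC; apply: measurable_set_le => //; exact: measurable_edist.
Qed.

Let msupportC : ~` msupport = \bigcup_k null_ball k.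
Proof.
apply/seteqP; split => x.
  move=> /existsNP[r /not_implyP[r0 /negP]]; rewrite -leNgt => Gr.
  have G0 : G (eball x r) = 0%E by apply/le_anti; rewrite Gr measure_ge0.
  (* Rational coordinates within r/(4m) of those of [x] put the centre at distance at most r/4. A
     rational radius strictly between r/4 and r/2 then gives an open ball that contains [x], while
     the closed one lies in the null ball of radius [r] around [x]. *)
  have r4 : 0 < r / (4 * m%:R) by rewrite divr_gt0// mulr_gt0// ltr0n.
  have /choice[q qP] (i : 'I_m) : exists q : rat, ratr q \in `]x ord0 i - r / (4 * m%:R), x ord0 i[.
    by apply: rat_in_itvoo; rewrite ltrBlDr ltrDl.
  have [s] : exists s : rat, ratr s \in `]r / 4, r / 2[ by apply: rat_in_itvoo; lra.
  rewrite in_itv/= => /andP[s1 s2].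
  exists (pickle (\row_i q i, s)) => //; rewrite /null_ball pickleK.
  set y := map_mx _ _.
  have xy : edist x y <= r / 4.
    rewrite /Defs.edist (le_trans (enorm_le_box (b := r / (4 * m%:R)) m_gt0 _))//.
      move=> i; rewrite !mxE; have := qP i; rewrite in_itv/= => /andP[? ?].
      rewrite ler_norml; apply/andP; split; lra.
    by apply: eq_ler; field; rewrite pnatr_eq0 -lt0n.
  have -> : G (eball y (ratr s)) == 0%E.
    apply/eqP/le_anti; rewrite measure_ge0 andbT -G0; apply: le_measure; rewrite ?inE.
    - exact: measurable_eball.
    - exact: measurable_eball.
    move=> z; rewrite /eball/= => zy.
    by have := edist_triangle y z x; rewrite [edist y x]edistC; lra.
  by move=> /=; apply/negP; rewrite -ltNge (le_lt_trans xy).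
move=> [k _]; rewrite /null_ball; case: (unpickle k) => [[q s]|//]; case: ifP => //.
set y := map_mx _ _ => /eqP G0 /= /negP; rewrite -ltNge => xy h.
have r0 : 0 < ratr s - edist x y by rewrite subr_gt0.
have := h _ r0; apply/negP; rewrite -leNgt -G0; apply: le_measure; rewrite ?inE.
- exact: measurable_eball.
- exact: measurable_eball.
move=> z; rewrite /eball/= => zx; rewrite (le_trans (edist_triangle x _ _))//; lra.
Qed.

Lemma measurable_msupport : measurable msupport.
Proof.
rewrite -[msupport]setCK msupportC; apply: measurableC; exact: bigcupT_measurable.
Qed.

Lemma msupport_full : G (~` msupport) = 0%E.
Proof.
rewrite msupportC; apply: measure_negligible; first exact: bigcupT_measurable.
apply: negligible_bigcup => k; apply/negligibleP; first exact: measurable_null_ball.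
rewrite /null_ball; case: (unpickle k) => [[q s]|]; last exact: measure0.
case: ifP; last by move=> _; exact: measure0.
set y := map_mx _ _ => /eqP G0; apply/le_anti; rewrite measure_ge0 andbT -G0.
apply: le_measure; rewrite ?inE.
- by apply: measurableC; apply: measurable_set_le => //; exact: measurable_edist.
- exact: measurable_eball.
by move=> z /= /negP; rewrite -ltNge => /ltW.
Qed.

End support.

(** * Convex sets: inscribed balls and cores *)

Section convex_geometry.
Variables (R : realType) (m : nat) (XX : set 'rV[R]_m).
Hypothesis m_gt0 : (0 < m)%N.
Hypothesis cvx : forall x y t, XX x -> XX y -> 0 <= t <= 1 ->
  XX (t *: x + (1 - t) *: y).
Hypothesis mXX : measurable XX.
Local Notation lam := (lebesgue_rV R m).

Lemma convex_average (k : nat) (z : nat -> 'rV[R]_m) :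
  (forall i, (i <= k)%N -> XX (z i)) -> XX (k.+1%:R^-1 *: \sum_(i < k.+1) z i).
Proof.
elim: k => [|k IH] zX; first by rewrite invr1 scale1r big_ord1; exact: zX.
rewrite big_ord_recr/= scalerDr.
have -> : k.+2%:R^-1 *: \sum_(i < k.+1) z i =
    (1 - k.+2%:R^-1) *: (k.+1%:R^-1 *: \sum_(i < k.+1) z i).
  rewrite scalerA; congr (_ *: _); rewrite -[k.+2%:R]natr1; field.
  have k0 : 0 <= k%:R :> R := ler0n _ k.
  by apply/andP; split; apply: lt0r_neq0; lra.
rewrite addrC; apply: cvx; first exact: zX.
  by apply: IH => i ik; apply: zX; rewrite (leq_trans ik).
by rewrite invr_ge0 ler0n/= invf_le1 ?ltr0n// ler1n.
Qed.

(** If no two points of [XX] differed in coordinate [i] alone, the translates of [XX] by the vectors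
    e_i/(k+1) would be pairwise disjoint. They all have the same positive measure and lie in a
    common cube, which has room for finitely many of them only. *)
Lemma convex_direction (K : R) (i : 'I_m) : (forall x j, XX x -> `|x ord0 j| <= K) ->
  (0 < lam XX)%E ->
  exists p : 'rV[R]_m * R, [/\ 0 < p.2, XX p.1 & XX (p.1 + p.2 *: delta_mx ord0 i)].
Proof.
move=> XK lamX; apply: contrapT => noX.
pose e : 'rV[R]_m := delta_mx ord0 i.
pose A k : set 'rV[R]_m := (fun y => y + k.+1%:R^-1 *: e) @^-1` XX.
have mA k : measurable (A k).
  apply: measurable_preimage => //; under eq_fun do rewrite -[X in X + _]scale1r.
  exact: measurable_affine.
have lamA k : lam (A k) = lam XX by exact: lebesgue_rV_shift.
have tA : trivIset setT A.
  apply/trivIsetP => j k _ _; wlog jk : j k / (j < k)%N.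
    move=> H; rewrite neq_ltn => /orP[jk|kj].
      by apply: H => //; rewrite neq_ltn jk.
    by rewrite setIC; apply: H => //; rewrite neq_ltn kj.
  move=> _; apply/seteqP; split => // y [/= yj yk]; apply: noX.
  exists (y + k.+1%:R^-1 *: e, j.+1%:R^-1 - k.+1%:R^-1); split => //=.
    by rewrite subr_gt0 ltf_pV2 ?posrE ?ltr0n// ltr_nat.
  by rewrite -addrA -scalerDl [X in X *: _]addrC subrK.
have K0 : 0 <= K.
  have [x Xx] : XX !=set0.
    by apply/set0P; apply: contraTneq lamX => ->; rewrite measure0 ltxx.
  exact: le_trans (XK x i Xx).
pose W := [set v : 'rV[R]_m | forall j, (0 : 'rV[R]_m) ord0 j - (K + 1) <= v ord0 j <= (0 : 'rV[R]_m) ord0 j + (K + 1)].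
have AW k : A k `<=` W.
  move=> y /XK h j; have := h j; rewrite !mxE ler_norml eqxx /=.
  have k1 : 0 <= (k.+1%:R^-1 : R) <= 1.
    by rewrite invr_ge0 ler0n/= invf_le1 ?ltr0n// ler1n.
  move: k1; set q := _^-1; case: (j == i) => /= /andP[q0 q1];
    rewrite ?mulr1 ?mulr0 => /andP[h1 h2]; apply/andP; split; lra.
have bound N : (N%:R%:E * lam XX <= ((2 * (K + 1)) ^+ m)%:E)%E.
  rewrite -(@lebesgue_cube R m 0) ?addr_ge0//.
  have -> : (N%:R%:E * lam XX = lam (\big[setU/set0]_(k < N) A k))%E.
    rewrite measure_bigsetU_ord//; last first.
      apply/trivIsetP => j k _ _ jk; move/trivIsetP : tA; apply => //.
    transitivity (\sum_(k < N) lam XX)%E; last by apply: eq_bigr => k _; exact/esym/lamA.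
    elim: N => [|N IH]; first by rewrite big_ord0 mul0e.
    by rewrite big_ord_recr/= -IH -natr1 EFinD ge0_muleDl ?lee_fin// mul1e.
  apply: le_measure; rewrite ?inE.
  - by apply: bigsetU_measurable.
  - exact: measurable_cube.
  by apply: (big_ind (fun S => S `<=` W)) => [//|S1 S2 h1 h2 z [/h1|/h2]//|k _]; exact: AW.
have lamfin : lam XX \is a fin_num.
  rewrite ge0_fin_numE// (le_lt_trans _ (ltry ((2 * (K + 1)) ^+ m)))//.
  by rewrite -[leLHS]mul1e; exact: (bound 1%N).
have f0 : 0 < fine (lam XX) by rewrite fine_gt0// lamX/= ltey_eq lamfin.
set c := (2 * (K + 1)) ^+ m in bound.
have := bound (Num.truncn (c / fine (lam XX))).+1.
rewrite -(fineK lamfin) -EFinM lee_fin leNgt => /negP; apply.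
by rewrite -ltr_pdivrMr// truncnS_gt.
Qed.

(** A set of positive measure contains the ends of a segment in each coordinate direction, and
    averages of points taken from the [m] segments fill a ball. *)
Lemma convex_interior_ball (K : R) : (forall x j, XX x -> `|x ord0 j| <= K) ->
  (0 < lam XX)%E -> exists c : 'rV[R]_m, exists2 rho, 0 < rho & eball c rho `<=` XX.
Proof.
move=> XK lamX; have /choice[p pP] i := convex_direction i XK lamX.
pose e i : 'rV[R]_m := delta_mx ord0 i.
have m0 : 0 < m%:R :> R by rewrite ltr0n.
have [t0 t0_gt0 t0P] : exists2 t0 : R, 0 < t0 & forall i, t0 <= (p i).2.
  exists (\big[Num.min/1]_i (p i).2).
    by apply: (big_ind (fun x => 0 < x)) => // [x y x0 y0|i _]; [rewrite lt_min x0|case: (pP i)].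
  by move=> i; rewrite (bigD1 i)//= ge_min lexx.
(* The centre is the mean of the midpoints. A displacement [u] is obtained by sliding the i-th point
   along its segment by [m] times the i-th coordinate of [u]; it stays in the segment as long as
   this is at most half of the least length [t0]. *)
exists (m%:R^-1 *: \sum_i ((p i).1 + ((p i).2 / 2) *: e i)).
exists (t0 / (2 * m%:R)); first by rewrite divr_gt0// mulr_gt0.
move=> y; rewrite /eball/= /Defs.edist; set c := _ *: _ => yc.
pose u := y - c.
have ub i : `|u ord0 i| <= t0 / (2 * m%:R) by exact: le_trans (ler_coord_enorm _ _) yc.
pose w i := (p i).1 + ((p i).2 / 2 + m%:R * u ord0 i) *: e i.
have wX i : XX (w i).
  have [p2 X1 X2] := pP i.
  have r01 : 0 <= 2^-1 + m%:R * u ord0 i / (p i).2 <= 1.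
    have : `|m%:R * u ord0 i / (p i).2| <= 2^-1.
      rewrite !normrM normfV (gtr0_norm m0) (gtr0_norm p2) ler_pdivrMr//.
      apply: (@le_trans _ _ (m%:R * (t0 / (2 * m%:R)))); first by rewrite ler_pM2l.
      have -> : m%:R * (t0 / (2 * m%:R)) = 2^-1 * t0 by field; rewrite lt0r_neq0.
      by rewrite ler_pM2l ?invr_gt0.
    by rewrite ler_norml => /andP[? ?]; apply/andP; split; lra.
  have := cvx X2 X1 r01; congr XX.
  rewrite scalerDr addrAC -scalerDl addrCA subrr addr0 scale1r scalerA /w.
  by congr (_ + _ *: _); field; exact: lt0r_neq0.
have -> : y = m%:R^-1 *: \sum_i w i.
  rewrite /w; under eq_bigr do rewrite scalerDl addrA.
  rewrite big_split/= scalerDr -/c.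
  under [X in _ + _ *: X]eq_bigr do rewrite -scalerA.
  rewrite -scaler_sumr scalerA mulVf ?scale1r ?lt0r_neq0//.
  by rewrite -(row_sum_delta u) /u addrC subrK.
(* [f] extends the family to all naturals, with a default point of [XX] beyond [m]. *)
pose f k := oapp w (w (Ordinal m_gt0)) (insub k).
have := @convex_average m.-1 f _; rewrite -(big_mkord xpredT f) prednK// big_mkord.
under eq_bigr do rewrite /f valK.
by apply => k _; rewrite /f; case: (insub k) => [i|] /=; exact: wX.
Qed.

Variables (c : 'rV[R]_m) (rho : R).
Hypothesis rho_gt0 : 0 < rho.
Hypothesis ballX : eball c rho `<=` XX.

(* The image of [XX] under the homothety of centre [c] and ratio [1 - th]. *)
Definition core (th : R) : set 'rV[R]_m :=
  (fun x => (1 - th)^-1 *: x + (- th / (1 - th)) *: c) @^-1` XX.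

Lemma measurable_core th : measurable (core th).
Proof. by apply: measurable_preimage => //; exact: measurable_affine. Qed.

(** If [x] is the image under the homothety of a point x' of [XX], then y = (1 - th) x' + th (c + (y
    - x)/th), and the second point lies in the inscribed ball when [y] is within [th * rho] of
    [x]. *)
Lemma core_eball th x : 0 < th < 1 -> core th x -> eball x (th * rho) `<=` XX.
Proof.
move=> /andP[th0 th1]; rewrite /core/= => Xx y; rewrite /eball/= => yx.
have X2 : XX (c + th^-1 *: (y - x)).
  apply: ballX; rewrite /eball/= /Defs.edist addrC addKr enormZ gtr0_norm ?invr_gt0//.
  by rewrite ler_pdivrMl.
have := cvx Xx X2 (t := 1 - th); rewrite subr_ge0 (ltW th1) gerBl (ltW th0) => /(_ isT).
congr XX; rewrite opprB addrCA subrr addr0 !scalerDr !scalerA.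
have th1' : 1 - th != 0 by rewrite subr_eq0 gt_eqF.
have th0' : th != 0 by rewrite gt_eqF.
rewrite mulfV// scale1r mulfV// scale1r.
rewrite (_ : (1 - th) * (- th / (1 - th)) = - th); last by field.
by rewrite scaleNr scale1r addrA subrK addrCA subrr addr0.
Qed.

Lemma core_sub th : 0 < th < 1 -> core th `<=` XX.
Proof.
move=> th01 x /(core_eball th01); apply; rewrite /eball/= edistxx.
by case/andP: th01 => th0 _; rewrite mulr_ge0// ltW.
Qed.

(** The core has (1 - th)^m times the measure of [XX], and Bernoulli's inequality bounds 1 - (1 -
    th)^m by m th. No information on the boundary enters. *)
Lemma lebesgue_shell th : 0 < th < 1 -> lam XX \is a fin_num ->
  (lam (XX `\` core th) <= (m%:R * th)%:E * lam XX)%E.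
Proof.
move=> th01 fX; have [th0 th1] := andP th01.
have th1' : 0 < 1 - th by rewrite subr_gt0.
have cX := core_sub th01.
have fC : lam (core th) \is a fin_num.
  rewrite ge0_fin_numE// (le_lt_trans _ (_ : lam XX < +oo)%E) ?ltey_eq ?fX//.
  by apply: le_measure => //; rewrite inE//; exact: measurable_core.
have E : fine (lam (core th)) = (1 - th) ^+ m * fine (lam XX).
  have := lebesgue_rV_affine ((- th / (1 - th)) *: c) (_ : 0 < (1 - th)^-1) mXX.
  rewrite invr_gt0 => /(_ th1'); rewrite -/(core th) => ->.
  rewrite -(fineK fC) -EFinM/= mulrA -exprMn mulfV ?lt0r_neq0// expr1n mul1r//.
rewrite measureD//; [|exact: measurable_core|by rewrite ltey_eq fX].
have -> : XX `&` core th = core th.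
  by apply/seteqP; split => [x []|x Cx] //; split => //; exact: cX.
apply: (@le_trans _ _ ((fine (lam XX))%:E - (fine (lam (core th)))%:E)%E).
  by rewrite !fineK.
rewrite -[in leRHS](fineK fX) -EFinB -EFinM lee_fin E.
have X0 : 0 <= fine (lam XX) by rewrite fine_ge0.
rewrite -[X in X - _]mul1r -mulrBl ler_wpM2r// lerBlDr.
have : forall k, 1 <= k%:R * th + (1 - th) ^+ k; last exact.
elim=> [|k IH]; first by rewrite mul0r add0r expr0.
rewrite exprS -natr1 mulrDl mul1r mulrBl mul1r.
have : th * (1 - th) ^+ k <= th.
  by apply: ler_piMr; [exact: ltW|apply: exprn_ile1; lra].
lra.
Qed.

End convex_geometry.

(** * The error given the treatments *)

Section tails.
Variable R : realType.
Implicit Types (a b s u : R) (M k : nat).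

Lemma invr_1D_le a : 0 <= a -> (1 + a)^-1 <= expR (- (a / (1 + a))).
Proof.
move=> a0; have a1 : 1 + a != 0 by rewrite lt0r_neq0// ltr_pwDl.
apply: le_trans (expR_ge1Dx _).
by apply: eq_ler; field.
Qed.

Lemma invr_1B_le b : 0 <= b < 1 -> (1 - b)^-1 <= expR (b / (1 - b)).
Proof.
move=> /andP[b0 b1]; have b1' : 1 - b != 0 by rewrite subr_eq0 gt_eqF.
apply: le_trans (expR_ge1Dx _).
by apply: eq_ler; field.
Qed.

(** With tilt a the exponent is at most a (M - s) - M (a - a^2) = M a^2 - a s, least at a = s/(2M)
    with value -s^2/(4M). The weaker constant 6 is the one shared with the other tail. *)
Lemma tail_upper M u s : (0 < M)%N -> 0 <= s -> u <= M%:R - s ->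
  expR (s / (2 * M%:R) * u) / (1 + s / (2 * M%:R)) ^+ M <= expR (- (s ^+ 2 / (6 * M%:R))).
Proof.
move=> M0 s0 us; have M0' : 0 < M%:R :> R by rewrite ltr0n.
set a := s / (2 * M%:R); have a0 : 0 <= a by rewrite divr_ge0// mulr_ge0// ltW.
rewrite -exprVn; apply: (@le_trans _ _ (expR (a * u) * expR (- (a / (1 + a))) ^+ M)).
  rewrite ler_pM2l ?expR_gt0// lerXn2r ?nnegrE ?expR_ge0 ?invr_ge0 ?addr_ge0//.
  exact: invr_1D_le.
rewrite -expRM_natl -expRD ler_expR.
have sE : s = 2 * M%:R * a by rewrite /a; field; rewrite lt0r_neq0.
have q0 : a - a ^+ 2 <= a / (1 + a).
  rewrite ler_pdivlMr ?ltr_pwDl//.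
  have : 0 <= a ^+ 3 by rewrite exprn_ge0.
  by rewrite !exprS expr0; lra.
have q1 : a * u <= a * (M%:R - s) by rewrite ler_wpM2l.
have q2 : M%:R * (a - a ^+ 2) <= M%:R * (a / (1 + a)) by rewrite ler_wpM2l// ltW.
have -> : s ^+ 2 / (6 * M%:R) = 4 / 6 * (M%:R * a ^+ 2).
  by rewrite sE; field; rewrite lt0r_neq0.
have q3 : 0 <= M%:R * a ^+ 2 by rewrite mulr_ge0 ?sqr_ge0// ltW.
rewrite sE in q1; rewrite mulrN.
have q4 : a * (M%:R - 2 * M%:R * a) = M%:R * a - 2 * (M%:R * a ^+ 2) by ring.
have q5 : M%:R * (a - a ^+ 2) = M%:R * a - M%:R * a ^+ 2 by ring.
lra.
Qed.

(** The tilt b = s/(4M) is at most 1/4, where b/(1 - b) <= b + 4/3 b^2. The exponent is then at most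
    4/3 M b^2 - b s = -s^2/(6M). *)
Lemma tail_lower M u s : (0 < M)%N -> 0 <= s <= M%:R -> M%:R + s <= u ->
  expR (- (s / (4 * M%:R)) * u) / (1 - s / (4 * M%:R)) ^+ M <= expR (- (s ^+ 2 / (6 * M%:R))).
Proof.
move=> M0 /andP[s0 sM] us; have M0' : 0 < M%:R :> R by rewrite ltr0n.
set b := s / (4 * M%:R); have b0 : 0 <= b by rewrite divr_ge0// mulr_ge0// ltW.
have b4 : b <= 1 / 4.
  by rewrite /b ler_pdivrMr ?mulr_gt0// mulrA divfK ?pnatr_eq0// mul1r.
rewrite -exprVn; apply: (@le_trans _ _ (expR (- b * u) * expR (b / (1 - b)) ^+ M)).
  rewrite ler_pM2l ?expR_gt0// lerXn2r ?nnegrE ?expR_ge0 ?invr_ge0 ?subr_ge0//; first by lra.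
  by apply: invr_1B_le; lra.
rewrite -expRM_natl -expRD ler_expR.
have sE : s = 4 * M%:R * b by rewrite /b; field; rewrite lt0r_neq0.
have q0 : b / (1 - b) <= b + 4 / 3 * b ^+ 2.
  rewrite ler_pdivrMr; last by lra.
  have : 0 <= b ^+ 2 * (1 / 4 - b) by rewrite mulr_ge0 ?sqr_ge0// subr_ge0.
  by rewrite !exprS expr0; lra.
have q1 : b * (M%:R + s) <= b * u by rewrite ler_wpM2l.
have q2 : M%:R * (b / (1 - b)) <= M%:R * (b + 4 / 3 * b ^+ 2) by rewrite ler_wpM2l// ltW.
have -> : s ^+ 2 / (6 * M%:R) = 16 / 6 * (M%:R * b ^+ 2).
  by rewrite sE; field; rewrite lt0r_neq0.
have q3 : 0 <= M%:R * b ^+ 2 by rewrite mulr_ge0 ?sqr_ge0// ltW.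
rewrite sE in q1; rewrite mulNr.
have q4 : b * (M%:R + 4 * M%:R * b) = M%:R * b + 4 * (M%:R * b ^+ 2) by ring.
have q5 : M%:R * (b + 4 / 3 * b ^+ 2) = M%:R * b + 4 / 3 * (M%:R * b ^+ 2) by ring.
lra.
Qed.

(** Tilt 1/2 turns a mean of at least 2M into exp(-M) 2^M. *)
Lemma tail_far M u : 2 * M%:R <= u ->
  expR (- 2^-1 * u) / (1 - 2^-1) ^+ M <= expR (- (1 - ln 2) * M%:R).
Proof.
move=> Mu; have -> : 1 - 2^-1 = 2^-1 :> R by field.
rewrite -exprVn invrK -[X in X ^+ M](@lnK R 2) ?posrE//.
rewrite -expRM_natl -expRD ler_expR; have : 2^-1 * (2 * M%:R) <= 2^-1 * u by rewrite ler_pM2l ?invr_gt0.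
by rewrite mulKf// ?pnatr_eq0//; lra.
Qed.

(** The Gaussian decay in [k] is weakened to a power through exp(2y) >= y^2 with y = k^2/(12 C^2),
    and (k+1)(k+2) <= 6 k^2. Of the two factors (k+1)(k+2) one is spent on the weights of the square
    inequality, the other makes the sum over the shells converge. *)
Lemma expR_le_shell (C s0 : R) k M : 0 < C -> (0 < M)%N -> (0 < k)%N ->
  s0 = k%:R * Num.sqrt M%:R / C ->
  expR (- (s0 ^+ 2 / (6 * M%:R))) <= (72 * C ^+ 2) ^+ 2 / ((k.+1 * k.+2)%:R) ^+ 2.
Proof.
move=> C0 M0 k0 ->; have M0' : 0 < M%:R :> R by rewrite ltr0n.
rewrite expr_div_n exprMn sqr_sqrtr ?ler0n//.
have -> : k%:R ^+ 2 * M%:R / C ^+ 2 / (6 * M%:R) = k%:R ^+ 2 / (12 * C ^+ 2) * 2.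
  by field; rewrite !lt0r_neq0.
set y := k%:R ^+ 2 / (12 * C ^+ 2).
have y0 : 0 < y by rewrite divr_gt0 ?exprn_gt0 ?ltr0n ?mulr_gt0 ?exprn_gt0.
have -> : expR (- (y * 2)) = (expR y)^-1 ^+ 2.
  by rewrite expRN [y * 2]mulrC expRM_natl exprVn.
rewrite -expr_div_n lerXn2r ?nnegrE ?invr_ge0 ?expR_ge0//.
  by rewrite divr_ge0// mulr_ge0// exprn_ge0// ltW.
apply: (@le_trans _ _ y^-1).
  rewrite lef_pV2 ?posrE ?expR_gt0//; apply: le_trans (expR_ge1Dx _).
  by rewrite lerDr.
rewrite /y invf_div ler_pdivrMr ?exprn_gt0 ?ltr0n// mulrAC ler_pdivlMr ?ltr0n ?muln_gt0//.
have h : (k.+1 * k.+2)%:R <= 6 * k%:R ^+ 2 :> R.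
  by rewrite -natrX -natrM ler_nat; nia.
apply: (@le_trans _ _ (12 * C ^+ 2 * (6 * k%:R ^+ 2))).
  by rewrite ler_pM2l// mulr_gt0// exprn_gt0.
apply: eq_ler; ring.
Qed.

End tails.

Section root.
Variables (R : realType) (m : nat).
Hypothesis m_gt0 : (0 < m)%N.

Definition root_dim (y : R) : R := y `^ m%:R^-1.

Lemma root_dimK y : 0 <= y -> root_dim y ^+ m = y.
Proof.
move=> y0; rewrite /root_dim -powR_mulrn ?powR_ge0// -powRrM mulVf ?powRr1//.
by rewrite pnatr_eq0 -lt0n.
Qed.

Lemma root_dim_ge0 y : 0 <= root_dim y.
Proof. exact: powR_ge0. Qed.

Lemma root_dim_gt0 y : 0 < y -> 0 < root_dim y.
Proof. exact: powR_gt0. Qed.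

Lemma le_root_dim s y : 0 <= s -> 0 <= y -> (s <= root_dim y) = (s ^+ m <= y).
Proof.
by move=> s0 y0; rewrite -[in RHS](root_dimK y0) ler_pXn2r// ?nnegrE ?root_dim_ge0.
Qed.

End root.

Lemma measureU_null_le d (T : measurableType d) (R : realType)
    (P : {measure set T -> \bar R}) (A B : set T) :
  measurable A -> measurable B -> P B = 0%E -> (P (A `|` B) <= P A)%E.
Proof.
move=> mA mB PB; rewrite -[leRHS]adde0 -PB; exact: measureU2.
Qed.

(** * Laws with bounded Lipschitz densities *)

Section regular_densities.
Variables (R : realType) (m : nat) (XX : set 'rV[R]_m) (gm gM L : R).
Hypothesis m_gt0 : (0 < m)%N.
Hypothesis mXX : measurable XX.
Hypothesis gm_gt0 : 0 < gm.
Hypothesis gM_gt0 : 0 < gM.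
Local Notation lam := (lebesgue_rV R m).
Local Notation V := (unit_ball_volume R m).

Definition regular_density (G : probability 'rV[R]_m R) (g : 'rV[R]_m -> R) : Prop :=
  [/\ [/\ measurable_fun setT g, forall x, 0 <= g x &
       forall A, measurable A -> G A = (\int[lam]_(x in A) (g x)%:E)%E],
      G (~` XX) = 0%E,
      forall x, XX x -> gm <= g x <= gM &
      forall x z, XX x -> XX z -> `|g z - g x| <= L * edist x z].

Variables (G : probability 'rV[R]_m R) (g : 'rV[R]_m -> R).
Hypothesis rg : regular_density G g.

Lemma density_upper A : measurable A -> (G A <= gM%:E * lam A)%E.
Proof.
move=> mA; have [[mg g0 gE] GX gb _] := rg.
have mAX : measurable (A `&` XX) by exact: measurableI.
apply: (@le_trans _ _ (G (A `&` XX))).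
  apply: (@le_trans _ _ (G ((A `&` XX) `|` ~` XX))).
    apply: le_measure; rewrite ?inE//; first by apply: measurableU => //; exact: measurableC.
    by move=> x Ax; have [Xx|Xx] := pselect (XX x); [left|right].
  by apply: measureU_null_le => //; exact: measurableC.
rewrite gE//; apply: (@le_trans _ _ (\int[lam]_(x in A `&` XX) gM%:E)%E).
  apply: ge0_le_integral => //.
  - by move=> x _; rewrite lee_fin.
  - by apply/measurable_EFinP; exact: measurable_funTS.
  - by move=> x [_ /gb /andP[]]; rewrite lee_fin.
rewrite integral_cst// lee_pmul2l// ?lte_fin//; apply: le_measure; rewrite ?inE//.
Qed.

Lemma density_lower A : measurable A -> (gm%:E * lam (A `&` XX) <= G A)%E.
Proof.
move=> mA; have [[mg g0 gE] GX gb _] := rg.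
have mAX : measurable (A `&` XX) by exact: measurableI.
apply: (@le_trans _ _ (G (A `&` XX))); last by apply: le_measure; rewrite ?inE.
rewrite gE// -integral_cst//; apply: ge0_le_integral => //.
- by move=> x _; rewrite lee_fin ltW.
- by apply/measurable_EFinP; exact: measurable_funTS.
- by move=> x [_ /gb /andP[]]; rewrite lee_fin.
Qed.

(** The density is frozen at [x], which need not be the centre [z]: the donors near a seeker [z] are
    compared with the density at the base point. The Lipschitz bound holds on [XX] only, hence the
    ball has to lie in it. *)
Lemma density_ball x z s e : 0 <= s -> 0 <= e -> XX x -> eball z s `<=` XX ->
  (forall y, eball z s y -> edist x y <= e) -> 0 < L ->
  `|fine (G (eball z s)) - g x * (V * s ^+ m)| <= L * e * (V * s ^+ m).
Proof.
move=> s0 e0 Xx zX ze L0; have [[mg g0 gE] GX gb gL] := rg.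
have mB := measurable_eball z s; have lB := lebesgue_eball m_gt0 z s0.
have V0 : 0 <= V * s ^+ m.
  by rewrite mulr_ge0 ?exprn_ge0//; exact/ltW/unit_ball_volume_gt0.
have fB : G (eball z s) \is a fin_num by exact: fin_num_measure.
have gy y : eball z s y -> `|g y - g x| <= L * e.
  by move=> By; rewrite (le_trans (gL _ _ Xx (zX _ By)))// ler_pM2l// ze.
have le1 : fine (G (eball z s)) <= (g x + L * e) * (V * s ^+ m).
  rewrite -lee_fin fineK// EFinM -lB -integral_cst// gE//.
  apply: ge0_le_integral => //.
  - by move=> y _; rewrite lee_fin.
  - by apply/measurable_EFinP; exact: measurable_funTS.
  - by move=> y /gy; rewrite ler_norml lee_fin; lra.
have le2 : (g x - L * e) * (V * s ^+ m) <= fine (G (eball z s)).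
  have [gx|gx] := leP (g x - L * e) 0.
    by apply: (@le_trans _ _ 0); [rewrite mulr_le0_ge0|rewrite fine_ge0].
  rewrite -lee_fin fineK// EFinM -lB -integral_cst// gE//.
  apply: ge0_le_integral => //.
  - by move=> y _; rewrite lee_fin ltW.
  - by apply/measurable_EFinP; exact: measurable_funTS.
  - by move=> y /gy; rewrite ler_norml lee_fin; lra.
rewrite ler_norml; move: le1 le2; rewrite mulrDl mulrBl; lra.
Qed.

End regular_densities.

(** * The selection count around a fixed base point *)

Section local_model.
Variables (R : realType) (m : nat) (XX : set 'rV[R]_m) (gm gM L a : R).
Hypothesis m_gt0 : (0 < m)%N.
Hypothesis mXX : measurable XX.
Hypothesis gm_gt0 : 0 < gm.
Hypothesis gmM : gm <= gM.
Hypothesis L_gt0 : 0 < L.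
Hypothesis a01 : 0 < a <= 1.
Local Notation lam := (lebesgue_rV R m).
Local Notation V := (unit_ball_volume R m).
Hypothesis fatX : forall z delta, XX z -> 0 < delta -> (delta%:E <= ediam XX)%E ->
  (a%:E * lam (eball z delta) <= lam (eball z delta `&` XX))%E.

(* [kap] is such that a ball of radius [nnradius] around a point of [XX] has mass at
   least [4 M / N], so that at least [2 M] donors are expected in it. *)
Definition cvol : R := 4 * gM / (gm * a).
Definition kap : R := root_dim m (4 / (gm * a * V)).
(** The bias of the linearised donor count, in units of [nnrate * M]: the first term comes from the
    Lipschitz bound over distances up to [2 * nnradius], the second from counting [N - 1] donors
    instead of [N]. *)
Definition cbias : R := 8 * L * kap / (gm * a) + cvol.
(** Beyond this shell the bias is at most half of the distance between the level and [M]. The shells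
    up to it get the trivial probability 1, paid for by the second summand in [cshell]. *)
Definition kstart : nat := (Num.truncn (2 * cbias)).+1.
Definition cshell : R := (72 * cvol ^+ 2 + (kstart.+1 * kstart.+2)%:R) ^+ 2.

Let gM_gt0 : 0 < gM. Proof. exact: lt_le_trans gmM. Qed.
Let gM_ge0 : 0 <= gM. Proof. exact: ltW. Qed.
Let gm_ge0 : 0 <= gm. Proof. exact: ltW. Qed.
Let L_ge0 : 0 <= L. Proof. exact: ltW. Qed.
Let a_gt0 : 0 < a. Proof. by case/andP: a01. Qed.
Let V_gt0 : 0 < V. Proof. exact: unit_ball_volume_gt0. Qed.
Let a_ge0 : 0 <= a. Proof. exact: ltW. Qed.
Let V_ge0 : 0 <= V. Proof. exact: ltW. Qed.
Let gma_gt0 : 0 < gm * a. Proof. exact: mulr_gt0. Qed.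
Let kap_gt0 : 0 < kap.
Proof. by apply: root_dim_gt0; rewrite divr_gt0// !mulr_gt0. Qed.
Let cvol_ge4 : 4 <= cvol.
Proof.
rewrite /cvol ler_pdivlMr// ler_pM2l//.
by case/andP: a01 => _ a1; rewrite (le_trans _ gmM)// ler_piMr// ltW.
Qed.
Let kap_ge0 : 0 <= kap. Proof. exact: ltW. Qed.
Let cvol_gt0 : 0 < cvol. Proof. exact: lt_le_trans cvol_ge4. Qed.
Let cvol_ge0 : 0 <= cvol. Proof. exact: ltW. Qed.
Let cbias_gt0 : 0 < cbias.
Proof.
by rewrite /cbias ltr_wpDl// divr_ge0 ?(ltW gma_gt0)// !mulr_ge0.
Qed.

Let cvol2_ge0 : 0 <= 72 * cvol ^+ 2.
Proof. by rewrite mulr_ge0// sqr_ge0. Qed.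
Let cshell_base_ge0 : 0 <= 72 * cvol ^+ 2 + (kstart.+1 * kstart.+2)%:R.
Proof. exact: addr_ge0. Qed.

Variables (M N : nat).
Hypothesis M_gt0 : (0 < M)%N.
Hypothesis MN : (2 * M <= N)%N.

Definition nnrate : R := root_dim m (M%:R / N%:R).
Definition nnradius : R := kap * nnrate.
(** The standard deviation of a count of mean [M] plus the order of its bias: on shell [k] both are
    small against the distance to [M] as soon as [k] is large. *)
Definition shell_width : R := Num.sqrt M%:R + nnrate * M%:R.

Let N_gt0 : (0 < N)%N. Proof. by move: M_gt0 MN; clear; lia. Qed.
Let M0 : 0 < M%:R :> R. Proof. by rewrite ltr0n. Qed.
Let N0 : 0 < N%:R :> R. Proof. by rewrite ltr0n. Qed.
Let M_ge0 : 0 <= M%:R :> R. Proof. exact: ler0n. Qed.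
Let N_ge0 : 0 <= N%:R :> R. Proof. exact: ler0n. Qed.
Let MN0 : 0 < M%:R / N%:R :> R. Proof. exact: divr_gt0. Qed.
Let MN1 : M%:R / N%:R <= 1 :> R.
Proof. by rewrite ler_pdivrMr// mul1r ler_nat; move: MN; clear; lia. Qed.
Let rho_gt0 : 0 < nnrate. Proof. exact: root_dim_gt0. Qed.
Let rho_ge0 : 0 <= nnrate. Proof. exact: ltW. Qed.
Let rho_le1 : nnrate <= 1.
Proof.
have := root_dimK m_gt0 (ltW MN0); rewrite -/nnrate => E.
rewrite leNgt; apply/negP => r1; move: MN1; rewrite -E leNgt => /negP; apply.
by rewrite exprn_egt1// -lt0n.
Qed.
Let MN_rho : M%:R / N%:R <= nnrate.
Proof.
rewrite -(root_dimK m_gt0 (ltW MN0)) -/nnrate.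
by rewrite ler_iXnr// ltW.
Qed.
Let rad_gt0 : 0 < nnradius. Proof. exact: mulr_gt0. Qed.
Let rad_ge0 : 0 <= nnradius. Proof. exact: ltW. Qed.
Let radX : nnradius ^+ m = 4 / (gm * a * V) * (M%:R / N%:R).
Proof.
rewrite /nnradius exprMn root_dimK// ?root_dimK// ?ltW//.
by rewrite divr_gt0// !mulr_gt0.
Qed.
Let width_gt0 : 0 < shell_width.
Proof. by rewrite /shell_width ltr_wpDr ?mulr_gt0// ?sqrtr_gt0// mulr_ge0// ltW. Qed.

Let width_ge0 : 0 <= shell_width. Proof. exact: ltW. Qed.

Variables (G0 G1 : probability 'rV[R]_m R) (g0 g1 : 'rV[R]_m -> R).
Hypothesis rg0 : regular_density XX gm gM L G0 g0.
Hypothesis rg1 : regular_density XX gm gM L G1 g1.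
Variable x : 'rV[R]_m.
Hypothesis Xx : XX x.

Let g0x : gm <= g0 x <= gM.
Proof. by have [_ _ gb _] := rg0; exact: gb. Qed.
Let g0x_gt0 : 0 < g0 x. Proof. by case/andP: g0x => /(lt_le_trans gm_gt0). Qed.
Let g0x_ge0 : 0 <= g0 x. Proof. exact: ltW. Qed.

Definition level (z : 'rV[R]_m) : R := N%:R * g0 x * (V * edist x z ^+ m).

Let level_ge0 z : 0 <= level z.
Proof. by rewrite /level !mulr_ge0 ?exprn_ge0 ?edist_ge0// ltW. Qed.

Let Ng0 : 0 < N%:R * g0 x. Proof. exact: mulr_gt0. Qed.

Let sublevelE c : 0 <= c ->
  [set z | level z <= c] = eball x (root_dim m (c / (N%:R * g0 x * V))).
Proof.
move=> c0; have q0 : 0 < N%:R * g0 x * V by rewrite mulr_gt0.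
have E z : level z = edist x z ^+ m * (N%:R * g0 x * V) by rewrite /level; ring.
by apply/seteqP; split => z; rewrite /eball/= [edist z x]edistC E le_root_dim ?edist_ge0//
  ?divr_ge0 ?(ltW q0)// ler_pdivlMr.
Qed.

Let lebesgue_sublevel c : 0 <= c ->
  lam [set z | level z <= c] = (c / (N%:R * g0 x))%:E.
Proof.
move=> c0; have q0 : 0 < N%:R * g0 x * V by rewrite mulr_gt0.
rewrite sublevelE// lebesgue_eball ?root_dim_ge0// root_dimK ?divr_ge0 ?(ltW q0)//.
congr (_%:E); field; rewrite !lt0r_neq0//.
Qed.

Lemma measurable_level : measurable_fun setT level.
Proof.
apply: measurable_funM => //; apply: measurable_funM => //; apply: measurable_funX.
exact: measurable_edist.
Qed.

(** The level sets are concentric balls of volume proportional to the level. The slack [h] places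
    the closed shell inside a difference of two closed balls, so that spheres need no separate
    treatment. *)
Lemma lebesgue_shell_level lo hi h : lo <= hi -> 0 < h ->
  (lam [set z | (lo <= level z <= hi)%R] <= ((hi - lo + h) / (N%:R * gm))%:E)%E.
Proof.
move=> lohi h0.
have mle c : measurable [set z | level z <= c].
  by apply: measurable_set_le => //; exact: measurable_level.
have mS : measurable [set z | lo <= level z <= hi].
  rewrite (_ : [set z | _] = [set z | lo <= level z] `&` [set z | level z <= hi]).
    apply: measurableI => //; apply: measurable_set_le => //; exact: measurable_level.
  by apply/seteqP; split => z /= => [/andP[]|[-> ->]].
have d0 : 0 <= hi - lo + h by rewrite addr_ge0 ?subr_ge0//; exact: ltW.
have toG : (hi - lo + h) / (N%:R * g0 x) <= (hi - lo + h) / (N%:R * gm).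
  rewrite ler_wpM2l// lef_pV2 ?posrE ?mulr_gt0// ler_pM2l//.
  by case/andP: g0x.
have [hi0|hi0] := ltP hi 0.
  rewrite (_ : [set z | _] = set0).
    by rewrite measure0 lee_fin divr_ge0// mulr_ge0.
  apply/seteqP; split => // z /= /andP[_ z2].
  by have := le_lt_trans (le_trans (level_ge0 z) z2) hi0; rewrite ltxx.
have [lo0|lo0] := ltP (lo - h) 0.
  apply: (@le_trans _ _ (lam [set z | level z <= hi])).
    by apply: le_measure; rewrite ?inE// => z /andP[].
  rewrite lebesgue_sublevel// lee_fin (le_trans _ toG)// ler_pM2r ?invr_gt0//.
  by lra.
apply: (@le_trans _ _ (lam ([set z | level z <= hi] `\` [set z | level z <= lo - h]))).
  apply: le_measure; rewrite ?inE//; first exact: measurableD.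
  move=> z /andP[z1 z2]; split => //=; apply/negP; rewrite -ltNge; lra.
rewrite measureD//; last first.
  by apply: (@le_lt_trans _ _ (hi / (N%:R * g0 x))%:E); [rewrite -lebesgue_sublevel|exact: ltry].
rewrite (_ : _ `&` _ = [set z | level z <= lo - h]); last first.
  by apply/seteqP; split => [z []//|z /= zz]; split => //; lra.
apply: (@le_trans _ _ ((hi / (N%:R * g0 x))%:E - ((lo - h) / (N%:R * g0 x))%:E)%E).
  by apply: leeB; rewrite -lebesgue_sublevel.
by rewrite -EFinB lee_fin (le_trans _ toG)// -mulrBl opprB addrA addrAC.
Qed.

Let level_near z : edist x z <= nnradius -> level z <= cvol * M%:R.
Proof.
move=> xz; rewrite /level.
apply: (@le_trans _ _ (N%:R * gM * (V * nnradius ^+ m))).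
  apply: ler_pM; rewrite ?mulr_ge0 ?exprn_ge0 ?edist_ge0//.
    by rewrite ler_pM2l//; case/andP: g0x.
  by rewrite ler_pM2l// ler_pXn2r ?nnegrE ?edist_ge0.
rewrite radX /cvol; apply: eq_ler.
by field; rewrite !lt0r_neq0.
Qed.

Variables (n : nat) (G : 'I_n -> probability 'rV[R]_m R)
  (Q : probability (n.-tuple 'rV[R]_m) R) (Dn Tr : {pred 'I_n}).
Hypothesis indepQ : forall A : 'I_n -> set 'rV[R]_m, (forall i, measurable (A i)) ->
  Q [set w | forall i, A i (tnth w i)] = (\prod_i G i (A i))%E.
Hypothesis disjTD : forall j, j \in Tr -> j \notin Dn.
Hypothesis G0E : forall j, j \in Dn -> G j = G0.
Hypothesis G1E : forall j, j \in Tr -> G j = G1.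
Hypothesis cardDn : #|Dn|.+1 = N.

Definition nearer (z y : 'rV[R]_m) : bool := edist y z <= edist x z.

Lemma measurable_nearer :
  measurable [set p : 'rV[R]_m * 'rV[R]_m | nearer p.1 p.2].
Proof.
by apply: measurable_set_le; apply: measurable_edist => //.
Qed.

Let within_hits z w :
  within Dn nearer z w = hits Dn (eball z (edist x z)) w.
Proof.
rewrite /within /hits; apply: eq_bigr => l _; congr (nat_of_bool _).
by apply/idP/idP; rewrite inE.
Qed.

Let p z : R := fine (G0 (eball z (edist x z))).

Let pE z l : l \in Dn -> G l (eball z (edist x z)) = (p z)%:E.
Proof.
by move=> lD; rewrite G0E// /p fineK// fin_num_measure//; exact: measurable_eball.
Qed.

Let p01 z : 0 <= p z <= 1.
Proof.
rewrite /p fine_ge0 ?measure_ge0//= -lee_fin fineK ?fin_num_measure//; last exact: measurable_eball.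
by apply: probability_le1; exact: measurable_eball.
Qed.

Let cardDnR : #|Dn|%:R = N%:R - 1 :> R.
Proof. by rewrite -cardDn -natr1 addrK. Qed.

Definition far_tail : R := expR (- (1 - ln 2) * M%:R).

(** By [fatX] the ball around [z] through [x] has donor mass at least 4M/N. Since N - 1 >= N/2, at
    least 2M donors are expected in it, and fewer than M of them is a large deviation. *)
Lemma selected_far z : XX z -> nnradius < edist x z ->
  (Q [set w | (within Dn nearer z w < M)%N] <= far_tail%:E)%E.
Proof.
move=> Xz xz; under eq_fun do rewrite within_hits.
have mB := measurable_eball z (edist x z).
have := chernoff_lower indepQ mB (pE z) (b := 2^-1) M _ (p01 z).
move=> /(_ _)/le_trans; apply.
  by apply/andP; split; lra.
rewrite lee_fin; apply: tail_far; rewrite cardDnR.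
have s0 : 0 < edist x z by exact: lt_trans xz.
(* The radius is admissible in [fatX] because [x] and [z] both belong to [XX]. *)
have diam : ((edist x z)%:E <= ediam XX)%E.
  by apply: ereal_sup_ubound; exists x => //; exists z.
have pz : 4 * (M%:R / N%:R) <= p z.
  rewrite -lee_fin fineK ?fin_num_measure//.
  apply: le_trans (density_lower mXX gm_gt0 rg0 mB).
  apply: (@le_trans _ _ (gm%:E * (a%:E * lam (eball z (edist x z))))%E); last first.
    by rewrite lee_pmul2l// fatX.
  rewrite (lebesgue_eball m_gt0 _ (ltW s0)) -!EFinM lee_fin.
  apply: (@le_trans _ _ (gm * (a * (V * nnradius ^+ m)))).
    rewrite radX; apply: eq_ler.
    by field; rewrite !lt0r_neq0.
  by rewrite !ler_pM2l// ler_pXn2r ?nnegrE ?edist_ge0// ltW.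
have N2 : N%:R / 2 <= N%:R - 1 :> R.
  have : 2%:R <= N%:R :> R by rewrite ler_nat; move: M_gt0 MN; clear; lia.
  by lra.
apply: (@le_trans _ _ (N%:R / 2 * (4 * (M%:R / N%:R)))).
  by apply: eq_ler; field; rewrite lt0r_neq0.
by apply: ler_pM => //; rewrite ?mulr_ge0 ?divr_ge0.
Qed.

(** The complement of [XX], null for the seekers, is added so that every point that is not near
    belongs to [XX], where [selected_far] applies. *)
Let near := eball x nnradius `|` ~` XX.

Let mnear : measurable near.
Proof. by apply: measurableU; [exact: measurable_eball|exact: measurableC]. Qed.

Let Qfar z : ~ near z -> (Q [set w | (within Dn nearer z w < M)%N] <= far_tail%:E)%E.
Proof.
move=> /not_orP[nb /contrapT Xz]; apply: selected_far => //.
by rewrite ltNge edistC; apply/negP.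
Qed.

Let far_tail_ge0 : 0 <= far_tail. Proof. exact: expR_ge0. Qed.

Let Gnear : (G1 near <= (cvol * (M%:R / N%:R))%:E)%E.
Proof.
have [_ GX _ _] := rg1.
apply: (le_trans (measureU_null_le _ _ GX)).
- exact: measurable_eball.
- exact: measurableC.
apply: le_trans (density_upper mXX gM_gt0 rg1 (measurable_eball _ _)) _.
rewrite (lebesgue_eball m_gt0 _ rad_ge0) -EFinM lee_fin radX /cvol; apply: eq_ler.
by field; rewrite !lt0r_neq0.
Qed.

Local Notation K := (selected Dn Tr nearer M).
Local Notation nT := (#|Tr|%:R : R).

Lemma crude_deviation :
  (\int[Q]_w ((K w)%:R ^+ 2)%:E <=
   (2 * (nT ^+ 2 * far_tail + nT * far_tail +
     nT ^+ 2 * (cvol * (M%:R / N%:R)) ^+ 2 + nT * (cvol * (M%:R / N%:R))))%:E)%E.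
Proof.
apply: (selected_second_moment indepQ disjTD G1E measurable_nearer mnear) => //.
by rewrite mulr_ge0// ltW.
Qed.

Hypothesis ballX : eball x (2 * nnradius) `<=` XX.

(** The factor 4 counts the two sides of the level [M], each of width [shell_width] plus a slack of
    the same size. *)
Let binb : R := 4 * gM / gm * (shell_width / N%:R).
(* The complement of [XX] is null; putting it into the first bin makes the bins
   cover [near]. *)
Let bin (k : nat) : set 'rV[R]_m :=
  [set z | edist x z <= nnradius /\
     k%:R * shell_width <= `|level z - M%:R| <= k.+1%:R * shell_width] `|`
  (if k == 0%N then ~` XX else set0).
Let pk (k : nat) : R := cshell / (k.+1 * k.+2)%:R ^+ 2.
Let kmax := (Num.truncn (cvol * M%:R / shell_width)).+1.
Let good := [set z | level z <= M%:R].
Let beta := fine (G1 good).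

Let mgood : measurable good.
Proof. by apply: measurable_set_le => //; exact: measurable_level. Qed.

Let mbin k : measurable (bin k).
Proof.
apply: measurableU; last by case: ifP => _ //; exact: measurableC.
have ml : measurable_fun setT (fun z => `|level z - M%:R|).
  by apply: measurableT_comp => //; apply: measurable_funB => //; exact: measurable_level.
apply: measurableI; first by apply: measurable_set_le => //; exact: measurable_edist.
rewrite (_ : (fun z => _) = [set z | k%:R * shell_width <= `|level z - M%:R|] `&`
   [set z | `|level z - M%:R| <= k.+1%:R * shell_width]).
  by apply: measurableI; exact: measurable_set_le.
by apply/seteqP; split => z /= => [/andP[]|[-> ->]].
Qed.

Let good_radius z : good z -> edist x z <= nnradius.
Proof.
rewrite /good/= /level => gz.
rewrite -(ler_pXn2r m_gt0) ?nnegrE ?edist_ge0// radX.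
have q0 : 0 < N%:R * gm * V by rewrite !mulr_gt0.
apply: (@le_trans _ _ (M%:R / (N%:R * gm * V))).
  rewrite ler_pdivlMr//; apply: le_trans gz.
  have -> : edist x z ^+ m * (N%:R * gm * V) = N%:R * gm * (V * edist x z ^+ m) by ring.
  rewrite ler_wpM2r ?mulr_ge0 ?exprn_ge0 ?edist_ge0// ler_pM2l//; by case/andP: g0x.
have -> : M%:R / (N%:R * gm * V) = 1 / (gm * V) * (M%:R / N%:R).
  by field; rewrite !lt0r_neq0.
rewrite ler_pM2r// ler_pdivrMr ?mulr_gt0//.
have -> : 4 / (gm * a * V) * (gm * V) = 4 / a by field; rewrite !lt0r_neq0.
by rewrite ler_pdivlMr// mul1r; case/andP: a01 => _; lra.
Qed.

Let goodS : good `<=` near.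
Proof. by move=> z /good_radius xz; left; rewrite /eball/= edistC. Qed.

Let nearS z : near z -> exists2 k, (k < kmax)%N & bin k z.
Proof.
move=> nz; have [Xz|Xz] := pselect (XX z); last by exists 0%N => //; right.
have xz : edist x z <= nnradius by case: nz => //; rewrite /eball/= edistC.
pose t := `|level z - M%:R| / shell_width.
have t0 : 0 <= t by rewrite divr_ge0.
have /andP[tl tu] := truncn_itv t0.
exists (Num.truncn t); last first.
  left; split => //; apply/andP; split.
    by rewrite -ler_pdivlMr.
  by rewrite -ler_pdivrMr// ltW.
rewrite /kmax ltnS; apply: le_truncn; rewrite ler_pM2r ?invr_gt0//.
have := level_near xz; have := level_ge0 z; rewrite ler_norml.
have : 4 * M%:R <= cvol * M%:R by rewrite ler_pM2r.
by move: M0; lra.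
Qed.

Let binb_ge0 : 0 <= binb.
Proof. by rewrite /binb mulr_ge0// divr_ge0 ?mulr_ge0. Qed.

Let Gbin k : (k < kmax)%N -> (G1 (bin k) <= binb%:E)%E.
Proof.
move=> _; have [_ GX _ _] := rg1.
pose S1 := [set z | M%:R + k%:R * shell_width <= level z <= M%:R + k.+1%:R * shell_width].
pose S2 := [set z | M%:R - k.+1%:R * shell_width <= level z <= M%:R - k%:R * shell_width].
have mS lo hi : measurable [set z | lo <= level z <= hi].
  rewrite (_ : [set z | _] = [set z | lo <= level z] `&` [set z | level z <= hi]).
    apply: measurableI => //; apply: measurable_set_le => //; exact: measurable_level.
  by apply/seteqP; split => z /= => [/andP[]|[-> ->]].
have m1 : measurable S1 by exact: mS.
have m2 : measurable S2 by exact: mS.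
have k0 : 0 <= k%:R * shell_width by rewrite mulr_ge0.
have kS : k.+1%:R * shell_width = k%:R * shell_width + shell_width by rewrite -natr1 mulrDl mul1r.
apply: (@le_trans _ _ (G1 ((S1 `|` S2) `|` ~` XX))).
  apply: le_measure; rewrite ?inE//.
    by apply: measurableU; [exact: measurableU|exact: measurableC].
  move=> z [[_ /andP[h1 h2]]|]; last by case: ifP => // _ ?; right.
  left; have [lz|lz] := leP 0 (level z - M%:R).
    by left; rewrite ger0_norm// in h1 h2; rewrite /S1/=; apply/andP; split; lra.
  by right; rewrite ltr0_norm// in h1 h2; rewrite /S2/=; apply/andP; split; lra.
apply: (le_trans (measureU_null_le _ _ GX)); [exact: measurableU|exact: measurableC|].
apply: le_trans (density_upper mXX gM_gt0 rg1 _) _; first exact: measurableU.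
have -> : binb = gM * (2 * shell_width / (N%:R * gm) + 2 * shell_width / (N%:R * gm)).
  by rewrite /binb; field; rewrite !lt0r_neq0.
rewrite EFinM lee_pmul2l//; apply: (le_trans (measureU2 _ _ _)) => //.
rewrite EFinD.
have h0 := width_ge0; have q0 : 0 < N%:R * gm by exact: mulr_gt0.
apply: leeD; apply: le_trans (lebesgue_shell_level _ width_gt0) _;
  rewrite ?lee_fin ?ler_pM2r ?invr_gt0// kS; lra.
Qed.

Let Ggood : G1 good = beta%:E.
Proof. by rewrite /beta fineK// fin_num_measure. Qed.

Let beta_ge0 : 0 <= beta. Proof. by rewrite fine_ge0. Qed.

Let beta_le : beta <= cvol * (M%:R / N%:R).
Proof.
rewrite -lee_fin -Ggood; apply: le_trans Gnear.
by apply: le_measure; rewrite ?inE//; exact: mnear.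
Qed.

(* The donor mass of the ball through [x] around a near point [z] agrees with
   [level z / N] up to the relative error [nnrate]. *)
Let mass_level z : edist x z <= nnradius ->
  `|(N%:R - 1) * p z - level z| <= cbias * (nnrate * M%:R).
Proof.
move=> xz; set s := edist x z.
have s0 : 0 <= s by exact: edist_ge0.
have zs y : eball z s y -> edist x y <= 2 * nnradius.
  rewrite /eball/= edistC => yz; rewrite (le_trans (edist_triangle z _ _))//.
  by move: xz; rewrite -/s; lra.
have zX : eball z s `<=` XX.
  by move=> y /zs xy; apply: ballX; rewrite /eball/= edistC.
have e0 : 0 <= 2 * nnradius by rewrite mulr_ge0.
have := density_ball m_gt0 rg0 s0 e0 Xx zX zs L_gt0; rewrite -/(p z) => pz.
have Vs : V * s ^+ m <= 4 / (gm * a) * (M%:R / N%:R).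
  apply: (@le_trans _ _ (V * nnradius ^+ m)).
    by rewrite ler_pM2l// ler_pXn2r ?nnegrE.
  rewrite radX; apply: eq_ler.
  by field; rewrite !lt0r_neq0.
have Vs0 : 0 <= V * s ^+ m by rewrite mulr_ge0 ?exprn_ge0.
have h1 : N%:R * `|p z - g0 x * (V * s ^+ m)| <= 8 * L * kap / (gm * a) * (nnrate * M%:R).
  apply: (@le_trans _ _ (N%:R * (L * (2 * nnradius) * (4 / (gm * a) * (M%:R / N%:R))))).
    rewrite ler_pM2l// (le_trans pz)// ler_wpM2l// !mulr_ge0//.
  rewrite /nnradius; apply: eq_ler.
  by field; rewrite !lt0r_neq0.
have h2 : p z <= cvol * (nnrate * M%:R).
  apply: (@le_trans _ _ (cvol * (M%:R / N%:R))).
    rewrite -lee_fin fineK ?fin_num_measure//; last exact: measurable_eball.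
    apply: le_trans (density_upper mXX gM_gt0 rg0 (measurable_eball _ _)) _.
    rewrite (lebesgue_eball m_gt0 _ s0) -EFinM lee_fin.
    apply: (@le_trans _ _ (gM * (4 / (gm * a) * (M%:R / N%:R)))).
      by rewrite ler_pM2l.
    by rewrite /cvol; apply: eq_ler; field; rewrite !lt0r_neq0.
  by rewrite ler_pM2l// (le_trans MN_rho)// ler_peMr// ler1n.
have /andP[p0 _] := p01 z.
have -> : (N%:R - 1) * p z - level z = N%:R * (p z - g0 x * (V * s ^+ m)) - p z.
  by rewrite /level -/s; ring.
apply: le_trans (ler_normB _ _) _; rewrite normrM (ger0_norm N_ge0).
by rewrite /cbias mulrDl lerD// (ger0_norm p0).
Qed.

(** The expected donor count at [z] is on the same side of [M] as the level, at distance at least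
    half of that of the level, once the bias has been absorbed. Chernoff's upper bound treats the
    levels below [M], the lower bound those above. *)
Let Qbin k z : (k < kmax)%N -> near z -> bin k z ->
  (Q [set w | wrong Dn nearer good M z w] <= (pk k)%:E)%E.
Proof.
move=> _ nz bz.
have mW : measurable [set w | wrong Dn nearer good M z w].
  by apply: measurable_wrong_section => //; exact: measurable_nearer.
have d0 : 0 < (k.+1 * k.+2)%:R :> R by rewrite ltr0n muln_gt0.
have [kk|kk] := leqP k kstart.
  apply: (@le_trans _ _ 1%E); first exact: probability_le1.
  rewrite lee_fin /pk ler_pdivlMr ?exprn_gt0// mul1r /cshell.
  rewrite lerXn2r ?nnegrE ?(ltW d0)//.
  apply: (@le_trans _ _ (kstart.+1 * kstart.+2)%:R).
    by rewrite ler_nat leq_mul// !ltnS.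
  by rewrite lerDr.
have k_gt0 : (0 < k)%N by apply: leq_ltn_trans kk.
have [xz /andP[lz uz]] : edist x z <= nnradius /\
    k%:R * shell_width <= `|level z - M%:R| <= k.+1%:R * shell_width.
  by case: bz => //; rewrite gtn_eqF.
(* Division by [cvol] serves twice: [cvol >= 4] keeps [s] below half of the distance to [M], and the
   bound [cvol * M] on this distance gives [s <= M], as the lower tail requires. *)
pose s := k%:R * Num.sqrt M%:R / cvol.
have s0 : 0 <= s by rewrite !mulr_ge0 ?sqrtr_ge0 ?invr_ge0.
have sq : k%:R * Num.sqrt M%:R <= `|level z - M%:R|.
  apply: le_trans lz; by rewrite ler_wpM2l// /shell_width lerDl mulr_ge0.
have kb : 2 * cbias <= k%:R.
  apply: (@le_trans _ _ kstart%:R); last by rewrite ler_nat ltnW.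
  by apply/ltW/truncnS_gt.
have bias2 : 2 * (cbias * (nnrate * M%:R)) <= `|level z - M%:R|.
  apply: le_trans lz; rewrite mulrA; apply: ler_pM => //.
  - by rewrite mulr_ge0// ltW.
  - by rewrite mulr_ge0.
  - by rewrite /shell_width lerDr sqrtr_ge0.
have tM : `|level z - M%:R| <= cvol * M%:R.
  have := level_near xz; have := level_ge0 z; rewrite ler_norml.
  have : 4 * M%:R <= cvol * M%:R by rewrite ler_pM2r.
  by move: M0; lra.
have sM : s <= M%:R.
  by rewrite /s ler_pdivrMr// mulrC [M%:R * _]mulrC mulrC (le_trans sq)// mulrC.
have s2 : s <= `|level z - M%:R| / 2.
  rewrite /s ler_pdivrMr// (le_trans sq)// -mulrA ler_peMr//.
  by rewrite mulrC ler_pdivlMr// mul1r (le_trans _ cvol_ge4)// ler_nat.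
have mass := mass_level xz.
have final : expR (- (s ^+ 2 / (6 * M%:R))) <= pk k.
  apply: le_trans (expR_le_shell cvol_gt0 M_gt0 k_gt0 (erefl s)) _.
  rewrite /pk ler_pM2r ?invr_gt0 ?exprn_gt0// /cshell.
  by rewrite lerXn2r ?nnegrE// lerDl.
have mB := measurable_eball z (edist x z).
have /andP[p0 p1] := p01 z.
apply: (@le_trans _ _ (expR (- (s ^+ 2 / (6 * M%:R))))%:E); last by rewrite lee_fin.
have [gz|gz] := leP (level z) M%:R.
  have -> : [set w | wrong Dn nearer good M z w] =
      [set w | (M <= hits Dn (eball z (edist x z)) w)%N].
    by apply/seteqP; split => w; rewrite /wrong/= mem_set// within_hits.
  have a0 : 0 <= s / (2 * M%:R) by rewrite divr_ge0// mulr_ge0.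
  apply: le_trans (chernoff_upper indepQ mB (pE z) M a0 p0) _.
  rewrite lee_fin; apply: tail_upper => //; rewrite cardDnR.
  have nE : `|level z - M%:R| = M%:R - level z by rewrite ler0_norm ?subr_le0// opprB.
  move: mass s2 bias2; rewrite nE ler_norml => /andP[_ ?] ? ?.
  by lra.
have -> : [set w | wrong Dn nearer good M z w] =
    [set w | (hits Dn (eball z (edist x z)) w < M)%N].
  have ng : (z \in good) = false by apply: memNset; rewrite /good/=; apply/negP; rewrite -ltNge.
  by apply/seteqP; split => w; rewrite /wrong/= ng within_hits.
have b01 : 0 <= s / (4 * M%:R) < 1.
  apply/andP; split; first by rewrite divr_ge0// mulr_ge0.
  rewrite ltr_pdivrMr ?mulr_gt0// mul1r.
  by apply: le_lt_trans sM _; move: M0; lra.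
apply: le_trans (chernoff_lower indepQ mB (pE z) M b01 (p01 z)) _.
rewrite lee_fin; apply: tail_lower => //; first by rewrite s0.
have nE : `|level z - M%:R| = level z - M%:R by rewrite gtr0_norm ?subr_gt0.
rewrite cardDnR; move: mass s2 bias2; rewrite nE ler_norml => /andP[? _] ? ?.
by lra.
Qed.

Let sum_pk : \sum_(k < kmax) pk k * (k.+1 * k.+2)%:R <= cshell.
Proof.
have -> : \sum_(k < kmax) pk k * (k.+1 * k.+2)%:R = cshell * \sum_(k < kmax) (k.+1 * k.+2)%:R^-1.
  rewrite mulr_sumr; apply: eq_bigr => k _; rewrite /pk; field.
  have k0 : 0 <= (k : nat)%:R :> R by exact: ler0n.
  by apply/andP; split; apply: lt0r_neq0; lra.
by rewrite ler_piMr ?sqr_ge0// sum_inv_consecutive gerBl.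
Qed.

(** The predicted set is exactly a ball around [x], of volume M/(N g0(x)). Freezing the seeker
    density at [x] yields the density ratio. *)
Lemma beta_bias : `|beta - g1 x / g0 x * (M%:R / N%:R)| <=
  L * nnradius * (M%:R / N%:R / gm).
Proof.
pose r := root_dim m (M%:R / (N%:R * g0 x * V)).
have gE : good = eball x r by exact: (sublevelE M_ge0).
have r0 : 0 <= r by exact: root_dim_ge0.
have q0 : 0 < N%:R * g0 x * V by rewrite mulr_gt0.
have rX : V * r ^+ m = M%:R / N%:R / g0 x.
  by rewrite /r root_dimK ?divr_ge0 ?(ltW q0)//; field; rewrite !lt0r_neq0.
have gy y : eball x r y -> edist x y <= nnradius by rewrite -gE; exact: good_radius.
have gX : eball x r `<=` XX.
  move=> y /gy xy; apply: ballX; rewrite /eball/= edistC (le_trans xy)//.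
  by move: rad_gt0; lra.
have := density_ball m_gt0 rg1 r0 rad_ge0 Xx gX gy L_gt0.
rewrite -gE -/beta rX => h.
rewrite (_ : g1 x / g0 x * (M%:R / N%:R) = g1 x * (M%:R / N%:R / g0 x)); last by field; rewrite !lt0r_neq0.
apply: (le_trans h); rewrite ler_pM2l ?mulr_gt0// ler_pM2l// lef_pV2 ?posrE//.
by case/andP: g0x.
Qed.

Lemma fine_deviation :
  (\int[Q]_w (((K w)%:R - nT * beta) ^+ 2)%:E <=
   (3 * (nT ^+ 2 * far_tail + nT * far_tail +
     cshell * (nT ^+ 2 * binb ^+ 2 + nT * binb) + nT * (cvol * (M%:R / N%:R))))%:E)%E.
Proof.
have pk0 k : 0 <= pk k by rewrite divr_ge0 ?sqr_ge0.
apply: le_trans (selected_deviation indepQ disjTD G1E measurable_nearer mnear mgood mbin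
  binb_ge0 beta_ge0 far_tail_ge0 pk0 goodS nearS Gbin Ggood Qfar Qbin sum_pk) _.
by rewrite lee_fin ler_pM2l// lerD2l ler_wpM2l.
Qed.

End local_model.

Lemma integral_affine_le d (T : measurableType d) (R : realType) (P : probability T R)
    (f F : T -> R) (c e b : R) :
  measurable_fun setT f -> measurable_fun setT F -> (forall t, 0 <= f t) ->
  (forall t, 0 <= F t) -> 0 <= c -> 0 <= e ->
  (forall t, f t <= c * F t + e) -> (\int[P]_t (F t)%:E <= b%:E)%E ->
  (\int[P]_t (f t)%:E <= (c * b + e)%:E)%E.
Proof.
move=> mf mF f0 F0 c0 e0 fF Fb.
have mcF : measurable_fun setT (fun t => (c * F t)%:E).
  by apply/measurable_EFinP; exact: measurable_funM.
apply: (@le_trans _ _ (\int[P]_t ((c * F t)%:E + e%:E))%E).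
  apply: ge0_le_integral => //.
  - by move=> t _; rewrite lee_fin.
  - exact/measurable_EFinP.
  - exact: emeasurable_funD.
  - by move=> t _; rewrite -EFinD lee_fin.
rewrite ge0_integralD//; last first.
  by move=> t _; rewrite lee_fin mulr_ge0.
rewrite integral_cst//= probability_setT mule1 EFinD leeD2r//.
under eq_integral do rewrite EFinM.
rewrite ge0_integralZl_EFin//; last 2 first.
- by move=> t _; rewrite lee_fin.
- exact/measurable_EFinP.
by rewrite EFinM lee_wpmul2l// lee_fin.
Qed.

Lemma sqrrB_le2 (R : realDomainType) (x y : R) :
  (x - y) ^+ 2 <= 2 * x ^+ 2 + 2 * y ^+ 2.
Proof.
rewrite -subr_ge0 (_ : _ - _ = (x + y) ^+ 2) ?sqr_ge0//; ring.
Qed.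

(** * Algebra of the conditional error rates *)

Section bound_algebra.
Variable R : realType.

(* The error rate given the treatments: [n1] and [N] are the sizes of the two arms,
   [rho = (M / N)^(1/m)] and [eM] bounds the probability of a far match. *)
Definition arm_rate (n1 N M rho eM : R) : R :=
  (n1 / N) ^+ 2 * (rho + M^-1) + n1 / N / M + (n1 / M) ^+ 2 * eM.

(** Compared with [arm_rate] the leading term lacks the small factor [rho + M^-1]. The rate is used
    on a set of base points of mass of order [rho], which restores it. *)
Definition crude_rate (n1 N M eM : R) : R :=
  (n1 / N) ^+ 2 + n1 / N / M + (n1 / M) ^+ 2 * eM.

Lemma crude_algebra (n1 N M eM cv rr : R) :
  0 <= n1 -> n1 <= n1 ^+ 2 -> 0 < N -> 0 < M -> 0 <= eM -> 0 <= cv -> 0 <= rr ->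
  2 / M ^+ 2 * (2 * (n1 ^+ 2 * eM + n1 * eM + n1 ^+ 2 * (cv * (M / N)) ^+ 2 +
    n1 * (cv * (M / N)))) + 2 * (n1 / N * rr) ^+ 2 <=
  (8 + 4 * cv ^+ 2 + 4 * cv + 2 * rr ^+ 2) * crude_rate n1 N M eM.
Proof.
move=> n0 n12 N0 M0 e0 cv0 rr0; rewrite /crude_rate.
set q := n1 / N; set t := n1 / M.
have q0 : 0 <= q by rewrite divr_ge0// ltW.
have M1 : 0 <= M^-1 by rewrite invr_ge0 ltW.
have E1 : n1 ^+ 2 * eM / M ^+ 2 = t ^+ 2 * eM.
  by rewrite /t; field; rewrite !lt0r_neq0.
have E2 : n1 * eM / M ^+ 2 <= t ^+ 2 * eM.
  by rewrite -E1 ler_pM2r ?invr_gt0 ?exprn_gt0// ler_wpM2r.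
have -> : 2 / M ^+ 2 * (2 * (n1 ^+ 2 * eM + n1 * eM + n1 ^+ 2 * (cv * (M / N)) ^+ 2 +
    n1 * (cv * (M / N)))) = 4 * (n1 ^+ 2 * eM / M ^+ 2) + 4 * (n1 * eM / M ^+ 2) +
    4 * cv ^+ 2 * q ^+ 2 + 4 * cv * (q / M).
  by rewrite /q; field; rewrite !lt0r_neq0.
have -> : (q * rr) ^+ 2 = q ^+ 2 * rr ^+ 2 by rewrite exprMn.
rewrite E1.
have h1 : 0 <= t ^+ 2 * eM by rewrite mulr_ge0// sqr_ge0.
have h2 : 0 <= q / M by rewrite mulr_ge0.
have h3 : 0 <= q ^+ 2 by exact: sqr_ge0.
set a := t ^+ 2 * eM in E2 h1 *; set b := q / M in h2 *; set c := q ^+ 2 in h3 *.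
have k1 : 0 <= cv ^+ 2 by exact: sqr_ge0.
have k2 : 0 <= rr ^+ 2 by exact: sqr_ge0.
set u := cv ^+ 2 in k1 *; set v := rr ^+ 2 in k2 *.
have : 0 <= u * a by rewrite mulr_ge0. have : 0 <= u * b by rewrite mulr_ge0.
have : 0 <= cv * a by rewrite mulr_ge0. have : 0 <= cv * c by rewrite mulr_ge0.
have : 0 <= v * a by rewrite mulr_ge0. have : 0 <= v * b by rewrite mulr_ge0.
lra.
Qed.

(** The relative shell width u = (sqrt M + rho M)/M satisfies u^2 <= 2 (rho + 1/M) and u <= 2. The
    first controls the term quadratic in the shell mass [b], the second the linear one. *)
Lemma fine_algebra (n1 N M rho eM cv cs kb lk b : R) :
  0 <= n1 -> n1 <= n1 ^+ 2 -> 0 < N -> 1 <= M -> 0 <= eM -> 0 <= cv -> 0 <= cs ->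
  0 <= kb -> 0 <= lk -> 0 <= rho <= 1 ->
  b = kb * ((Num.sqrt M + rho * M) / N) ->
  2 / M ^+ 2 * (3 * (n1 ^+ 2 * eM + n1 * eM + cs * (n1 ^+ 2 * b ^+ 2 + n1 * b) +
    n1 * (cv * (M / N)))) + 2 * (n1 / M * (lk * rho * (M / N))) ^+ 2 <=
  (12 + 12 * cs * kb ^+ 2 + 12 * cs * kb + 6 * cv + 2 * lk ^+ 2) * arm_rate n1 N M rho eM.
Proof.
move=> n0 n12 N0 M1 e0 cv0 cs0 kb0 lk0 /andP[r0 r1] bdef; rewrite /arm_rate.
have M0 : 0 < M by exact: lt_le_trans M1.
set q := n1 / N; set t := n1 / M; set u := (Num.sqrt M + rho * M) / M.
have q0 : 0 <= q by rewrite divr_ge0// ltW.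
have Mi : 0 <= M^-1 by rewrite invr_ge0 ltW.
have sM : Num.sqrt M ^+ 2 = M by rewrite sqr_sqrtr// ltW.
have sM1 : Num.sqrt M <= M.
  by rewrite -[X in X <= _]mulr1 -[X in _ <= X]sM expr2 ler_wpM2l ?sqrtr_ge0// -sqrtr1 ler_wsqrtr.
have u0 : 0 <= u by rewrite divr_ge0 ?addr_ge0 ?sqrtr_ge0 ?mulr_ge0// ltW.
have u2 : u <= 2.
  rewrite ler_pdivrMr//; have : rho * M <= M by rewrite ler_piMl// ltW.
  by lra.
have uu : u ^+ 2 <= 2 * rho + 2 * M^-1.
  have uE : u = Num.sqrt M / M + rho by rewrite /u mulrDl mulfK// lt0r_neq0.
  have sE : (Num.sqrt M / M) ^+ 2 = M^-1.
    by rewrite expr_div_n sM; field; rewrite lt0r_neq0.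
  rewrite uE; apply: (@le_trans _ _ (2 * (Num.sqrt M / M) ^+ 2 + 2 * rho ^+ 2)).
    by rewrite -[rho in leLHS]opprK (le_trans (sqrrB_le2 _ _))// sqrrN.
  rewrite sE; have : rho ^+ 2 <= rho by rewrite expr2 ler_piMl.
  by lra.
have E1 : n1 ^+ 2 * eM / M ^+ 2 = t ^+ 2 * eM.
  by rewrite /t; field; rewrite !lt0r_neq0.
have E2 : n1 * eM / M ^+ 2 <= t ^+ 2 * eM.
  by rewrite -E1 ler_pM2r ?invr_gt0 ?exprn_gt0// ler_wpM2r.
have bE : b = kb * (u * (M / N)) by rewrite bdef /u; field; rewrite !lt0r_neq0.
have -> : 2 / M ^+ 2 * (3 * (n1 ^+ 2 * eM + n1 * eM + cs * (n1 ^+ 2 * b ^+ 2 + n1 * b) +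
    n1 * (cv * (M / N)))) = 6 * (n1 ^+ 2 * eM / M ^+ 2) + 6 * (n1 * eM / M ^+ 2) +
    6 * cs * kb ^+ 2 * (q ^+ 2 * u ^+ 2) + 6 * cs * kb * (q / M * u) + 6 * cv * (q / M).
  by rewrite bE /q; field; rewrite !lt0r_neq0.
have -> : (t * (lk * rho * (M / N))) ^+ 2 = lk ^+ 2 * (q ^+ 2 * rho ^+ 2).
  by rewrite /t /q; field; rewrite !lt0r_neq0.
rewrite E1.
have h0 : 0 <= q ^+ 2 by exact: sqr_ge0.
have h1 : 0 <= t ^+ 2 * eM by rewrite mulr_ge0// sqr_ge0.
have h2 : 0 <= q / M by rewrite mulr_ge0.
have h3 : 0 <= q ^+ 2 * (rho + M^-1) by rewrite mulr_ge0// addr_ge0.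
have h4 : q ^+ 2 * u ^+ 2 <= 2 * (q ^+ 2 * (rho + M^-1)).
  have -> : 2 * (q ^+ 2 * (rho + M^-1)) = q ^+ 2 * (2 * rho + 2 * M^-1) by ring.
  exact: ler_wpM2l.
have h5 : q / M * u <= 2 * (q / M) by rewrite mulrC ler_wpM2r.
have h6 : q ^+ 2 * rho ^+ 2 <= q ^+ 2 * (rho + M^-1).
  rewrite ler_wpM2l//; have : rho ^+ 2 <= rho by rewrite expr2 ler_piMl.
  by lra.
have k1 : 0 <= cs * kb ^+ 2 by rewrite mulr_ge0// sqr_ge0.
have k2 : 0 <= cs * kb by rewrite mulr_ge0.
have k3 : 0 <= lk ^+ 2 by exact: sqr_ge0.
have g4 := ler_wpM2l k1 h4; have g5 := ler_wpM2l k2 h5; have g6 := ler_wpM2l k3 h6.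
set A := t ^+ 2 * eM in E2 h1 *; set B := q / M in h2 h5 g5 *.
set D := q ^+ 2 * (rho + M^-1) in h3 h4 h6 g4 g6 *.
set K1 := cs * kb ^+ 2 in k1 g4 *; set K2 := cs * kb in k2 g5 *; set K3 := lk ^+ 2 in k3 g6 *.
have -> : 6 * cs * kb ^+ 2 * (q ^+ 2 * u ^+ 2) = 6 * (K1 * (q ^+ 2 * u ^+ 2)) by rewrite /K1; ring.
have -> : 6 * cs * kb * (B * u) = 6 * (K2 * (B * u)) by rewrite /K2; ring.
have -> : 12 * cs * kb ^+ 2 = 12 * K1 by rewrite /K1; ring.
have -> : 12 * cs * kb = 12 * K2 by rewrite /K2; ring.
have : 0 <= K1 * A by rewrite mulr_ge0. have : 0 <= K1 * B by rewrite mulr_ge0.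
have : 0 <= K2 * A by rewrite mulr_ge0. have : 0 <= K2 * D by rewrite mulr_ge0.
have : 0 <= K3 * A by rewrite mulr_ge0. have : 0 <= K3 * B by rewrite mulr_ge0.
have : 0 <= cv * A by rewrite mulr_ge0. have : 0 <= cv * D by rewrite mulr_ge0.
lra.
Qed.

End bound_algebra.

(** * The matching count as a selection count *)

Section match_count_selected.
Variables (R : realType) (m n : nat) (v : 'I_n -> bool) (w : bool) (i : 'I_n).
Hypothesis vi : v i = w.

Definition donors : {pred 'I_n} := [pred l | (v l == w) && (l != i)].
Definition seekers : {pred 'I_n} := [pred l | v l == ~~ w].

(** Unit [i] is counted in its own rank. Removing it from the donors turns a rank of at most [M]
    into fewer than [M] donors. *)
Lemma match_countE (M : nat) (x : 'I_n -> 'rV[R]_m) :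
  match_count x v w M i =
  (\sum_(j in seekers) (\sum_(l in donors) nearer (x i) (x j) (x l) < M))%N.
Proof.
rewrite /match_count; apply: eq_big => // j _.
congr (nat_of_bool _); rewrite /matched vi eqxx/=.
rewrite (bigD1 i) ?vi ?eqxx//= lexx /=; congr (_ <= M)%N.
Qed.

Lemma disjoint_seekers j : j \in seekers -> j \notin donors.
Proof. by rewrite !inE => /eqP ->; case: w. Qed.

Lemma card_donors : #|donors|.+1 = arm_size v w.
Proof.
rewrite /arm_size; transitivity #|[pred l | v l == w]|; last first.
  rewrite -sum1_card big_mkcond/=; apply: eq_bigr => l _; rewrite inE.
  by case: (v l == w).
rewrite [RHS](cardD1 i) inE vi eqxx add1n; congr (_.+1); apply: eq_card => l.
by rewrite !inE andbC.
Qed.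

Lemma card_seekers : #|seekers| = arm_size v (~~ w).
Proof.
rewrite /arm_size -sum1_card big_mkcond/=; apply: eq_bigr => l _; rewrite inE.
by case: (v l == ~~ w).
Qed.

Lemma match_count_selected (M : nat) (W : n.-tuple 'rV[R]_m) :
  match_count (tnth W) v w M i = selected donors seekers (nearer (tnth W i)) M W.
Proof. exact: match_countE. Qed.

(** Unit [i] is neither a donor nor a seeker. After conditioning on its position, the base point is
    a free parameter and the other units keep their law. *)
Lemma selected_upd (M : nat) u (x : 'rV[R]_m) (W : n.-tuple 'rV[R]_m) :
  selected donors seekers (nearer x) M (upd i u W) =
  selected donors seekers (nearer x) M W.
Proof.
rewrite /selected; apply: eq_bigr => j jS; congr (nat_of_bool _); congr (_ < M)%N.
have ji : j != i by apply: contraTneq jS => ->; rewrite inE vi; case: w.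
rewrite tnth_upd (negbTE ji); apply: eq_bigr => l; rewrite !inE => /andP[_ li].
by rewrite tnth_upd (negbTE li).
Qed.

Lemma measurable_match_count (M : nat) :
  measurable_fun setT (fun W : n.-tuple 'rV[R]_m => (match_count (tnth W) v w M i)%:R : R).
Proof.
pose near_set (j l : 'I_n) :=
  [set W : n.-tuple 'rV[R]_m | edist (tnth W l) (tnth W j) <= edist (tnth W i) (tnth W j)].
have mnear j l : measurable (near_set j l).
  apply: measurable_set_le; apply: measurable_edist; exact: measurable_tnth.
pose f j (W : n.-tuple 'rV[R]_m) : R := \sum_(l in donors) \1_(near_set j l) W.
have fE j W : f j W = (\sum_(l in donors) nearer (tnth W i) (tnth W j) (tnth W l))%:R.
  rewrite /f natr_sum; apply: eq_bigr => l _; rewrite indicE; congr (_%:R).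
  by congr (nat_of_bool _); apply/idP/idP; rewrite inE.
have mf j : measurable_fun setT (f j).
  by apply: measurable_sum_pred => l _; exact: measurable_indic.
pose E j := ~` [set W | M%:R <= f j W].
have mE j : measurable (E j).
  by apply: measurableC; apply: measurable_set_le => //.
rewrite (_ : (fun W => _) = fun W => \sum_(j in seekers) \1_(E j) W).
  by apply: measurable_sum_pred => j _; exact: measurable_indic.
apply/funext => W; rewrite match_countE natr_sum; apply: eq_bigr => j _.
rewrite indicE; congr (_%:R); congr (nat_of_bool _); apply/idP/idP.
  by move=> h; rewrite inE /E/=; apply/negP; rewrite fE ler_nat -ltnNge.
by rewrite inE /E/= => /negP; rewrite fE ler_nat -ltnNge.
Qed.

Lemma match_count_le (M : nat) (x : 'I_n -> 'rV[R]_m) :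
  (match_count x v w M i <= #|seekers|)%N.
Proof.
rewrite match_countE -sum1_card; apply: leq_sum => j _; exact: leq_b1.
Qed.

End match_count_selected.

(** * The error given the treatments, averaged over the base point *)

Section arm_bound.
Variables (R : realType) (m : nat) (XX : set 'rV[R]_m) (gm gM L a : R).
Hypothesis m_gt0 : (0 < m)%N.
Hypothesis mXX : measurable XX.
Hypothesis cvx : forall x y t, XX x -> XX y -> 0 <= t <= 1 ->
  XX (t *: x + (1 - t) *: y).
Hypothesis gm_gt0 : 0 < gm.
Hypothesis gmM : gm <= gM.
Hypothesis L_gt0 : 0 < L.
Hypothesis a01 : 0 < a <= 1.
Local Notation lam := (lebesgue_rV R m).
Local Notation V := (unit_ball_volume R m).
Hypothesis fatX : forall z delta, XX z -> 0 < delta -> (delta%:E <= ediam XX)%E ->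
  (a%:E * lam (eball z delta) <= lam (eball z delta `&` XX))%E.
Variables (ctr : 'rV[R]_m) (inr : R).
Hypothesis inr_gt0 : 0 < inr.
Hypothesis ballX : eball ctr inr `<=` XX.

Let kp := kap m gm a.
Let cv := cvol gm gM a.
Let cs := cshell m gm gM L a.

(* [ccrude] is for arbitrary points of [XX], [cfine] for those of its core, [cshadow]
   for the mass of the complement of the core, and [ctriv] for arms of size [O(M)]. *)
Definition ratio_max : R := gM / gm.
Definition ccrude : R := 8 + 4 * cv ^+ 2 + 4 * cv + 2 * ratio_max ^+ 2.
Definition cfine : R := 12 + 12 * cs * (4 * gM / gm) ^+ 2 + 12 * cs * (4 * gM / gm) +
  6 * cv + 2 * (L * kp / gm) ^+ 2.
Definition cshadow : R := gM * (m%:R * (2 * kp / inr)) / gm.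
(** Below this value of [rho] one has [2 * M <= N], and the homothety parameter that gives the core
    room for the required balls is less than 1. *)
Definition rate_cap : R := Num.min (root_dim m 2^-1) (inr / (2 * kp)).
Definition ctriv : R := 2 * ((rate_cap ^+ m)^-1 ^+ 2 + ratio_max ^+ 2) / rate_cap.
Definition carm : R := cfine + ccrude * cshadow + ctriv.

Let gM_gt0 : 0 < gM. Proof. exact: lt_le_trans gmM. Qed.
Let a_gt0 : 0 < a. Proof. by case/andP: a01. Qed.
Let V_gt0 : 0 < V. Proof. exact: unit_ball_volume_gt0. Qed.
Let kp_gt0 : 0 < kp.
Proof. by apply: root_dim_gt0; rewrite divr_gt0// !mulr_gt0. Qed.
Let cv_ge0 : 0 <= cv.
Proof. by rewrite /cv /cvol divr_ge0 ?mulr_ge0// ltW. Qed.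
Let cs_ge0 : 0 <= cs. Proof. exact: sqr_ge0. Qed.
Let ratio_ge0 : 0 <= ratio_max. Proof. by rewrite divr_ge0// ltW. Qed.
Let ccrude_ge0 : 0 <= ccrude.
Proof. by move: (sqr_ge0 cv) (sqr_ge0 ratio_max) cv_ge0; rewrite /ccrude; lra. Qed.
Let kb_ge0 : 0 <= 4 * gM / gm. Proof. by rewrite divr_ge0 ?mulr_ge0// ltW. Qed.
Let cfine_ge0 : 0 <= cfine.
Proof.
have h1 : 0 <= cs * (4 * gM / gm) ^+ 2 by rewrite mulr_ge0 ?sqr_ge0.
have h2 : 0 <= cs * (4 * gM / gm) by rewrite mulr_ge0.
have h3 := sqr_ge0 (L * kp / gm).
by move: cv_ge0; rewrite /cfine -!mulrA in h1 h2 h3 *; lra.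
Qed.
Let cshadow_ge0 : 0 <= cshadow.
Proof. by rewrite /cshadow !mulr_ge0 ?invr_ge0// ltW. Qed.
Let cap_gt0 : 0 < rate_cap.
Proof.
rewrite /rate_cap lt_min root_dim_gt0 ?invr_gt0//=.
by rewrite divr_gt0// mulr_gt0.
Qed.
Let ctriv_ge0 : 0 <= ctriv.
Proof. by rewrite /ctriv mulr_ge0 ?invr_ge0 ?(ltW cap_gt0)// mulr_ge0// addr_ge0 ?sqr_ge0. Qed.

Lemma carm_ge0 : 0 <= carm.
Proof.
have h := mulr_ge0 ccrude_ge0 cshadow_ge0.
by rewrite /carm; move: h cfine_ge0 ctriv_ge0; lra.
Qed.

Variables (n : nat) (v : 'I_n -> bool) (w : bool) (i : 'I_n) (M : nat).
Hypothesis vi : v i = w.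
Hypothesis M_gt0 : (0 < M)%N.
Variables (G : bool -> probability 'rV[R]_m R) (g : bool -> 'rV[R]_m -> R).
Hypothesis rg : forall b, regular_density XX gm gM L (G b) (g b).
Variable Q : probability (n.-tuple 'rV[R]_m) R.
Hypothesis indepQ : forall A : 'I_n -> set 'rV[R]_m, (forall j, measurable (A j)) ->
  Q [set W | forall j, A j (tnth W j)] = (\prod_j G (v j) (A j))%E.
Variable r : 'rV[R]_m -> R.
Hypothesis mr : measurable_fun setT r.
Hypothesis rE : {ae G w, forall x, r x = g (~~ w) x / g w x}.

Let N := arm_size v w.
Let n1 : R := (arm_size v (~~ w))%:R.
Let NR : R := N%:R.
Let MR : R := M%:R.
Let rho := nnrate R m M N.
Let eM := far_tail R M.
Let q := n1 / NR.

Let N_gt0 : (0 < N)%N.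
Proof. by rewrite /N -(card_donors vi). Qed.
Let NR_gt0 : 0 < NR. Proof. by rewrite ltr0n. Qed.
Let MR_gt0 : 0 < MR. Proof. by rewrite ltr0n. Qed.
Let q_ge0 : 0 <= q. Proof. by rewrite divr_ge0// ltW. Qed.
Let n1_sq : n1 <= n1 ^+ 2.
Proof. by rewrite -natrX ler_nat; case: (arm_size _ _) => // k; rewrite leq_pmulr. Qed.
Let eM_ge0 : 0 <= eM. Proof. exact: expR_ge0. Qed.
Let MN_gt0 : 0 < MR / NR. Proof. exact: divr_gt0. Qed.
Let rho_gt0 : 0 < rho. Proof. exact: root_dim_gt0. Qed.
Let rate := arm_rate n1 NR MR rho eM.

Let K u (W : n.-tuple 'rV[R]_m) : R := (selected (donors v w i) (seekers v w) (nearer u) M W)%:R.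
Let F (W : n.-tuple 'rV[R]_m) : R :=
  ((match_count (tnth W) v w M i)%:R / MR - q * r (tnth W i)) ^+ 2.

Let mF : measurable_fun setT F.
Proof.
apply: measurable_funX; apply: measurable_funB.
  by apply: measurable_funM => //; exact: measurable_match_count.
apply: measurable_funM => //.
exact: (measurableT_comp mr (measurable_tnth i)).
Qed.

Let F_upd u W : F (upd i u W) = (K u W / MR - q * r u) ^+ 2.
Proof.
rewrite /F (match_count_selected vi) tnth_upd eqxx /K.
by rewrite selected_upd.
Qed.

Let mK u : measurable_fun setT (K u).
Proof. by apply: measurable_selected; exact: measurable_nearer. Qed.

Let inner u : \bar R := (\int[Q]_W (F (upd i u W))%:E)%E.

Let minner : measurable_fun setT inner.
Proof.
apply: (measurable_resampled Q i (F := fun W => (F W)%:E)).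
  exact/measurable_EFinP.
by move=> W; rewrite lee_fin sqr_ge0.
Qed.

Let inner_ge0 u : (0 <= inner u)%E.
Proof. by apply: integral_ge0 => W _; rewrite lee_fin sqr_ge0. Qed.

Let intF : (\int[Q]_W (F W)%:E = \int[G w]_u inner u)%E.
Proof.
rewrite (resample (G := fun j => G (v j)) indepQ i) ?vi//.
- exact/measurable_EFinP.
- by move=> W; rewrite lee_fin sqr_ge0.
Qed.

Let rate_ge : [/\ 0 <= q ^+ 2 * rho, q ^+ 2 * rho <= rate,
  crude_rate n1 NR MR eM * rho <= rate \/ 1 < rho & 0 <= crude_rate n1 NR MR eM].
Proof.
have h1 : 0 <= q ^+ 2 * MR^-1 by rewrite mulr_ge0 ?sqr_ge0// invr_ge0 ltW.
have h2 : 0 <= q / MR by rewrite divr_ge0// ltW.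
have h3 : 0 <= (n1 / MR) ^+ 2 * eM by rewrite mulr_ge0 ?sqr_ge0.
have h4 : 0 <= q ^+ 2 * rho by rewrite mulr_ge0 ?sqr_ge0// ltW.
have h5 : 0 <= q ^+ 2 by exact: sqr_ge0.
split => //.
- by rewrite /rate /arm_rate -/q mulrDr; lra.
- have [r1|] := leP rho 1; [left|by right].
  rewrite /rate /arm_rate /crude_rate -/q !mulrDr !mulrDl.
  have : q / MR * rho <= q / MR by rewrite ler_piMr.
  have : (n1 / MR) ^+ 2 * eM * rho <= (n1 / MR) ^+ 2 * eM by rewrite ler_piMr.
  by lra.
- by rewrite /crude_rate -/q !addr_ge0.
Qed.

Let ratio_bound x : XX x -> r x = g (~~ w) x / g w x -> 0 <= r x <= ratio_max.
Proof.
move=> Xx ->; have [_ _ /(_ _ Xx)/andP[h1 h2] _] := rg (~~ w).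
have [_ _ /(_ _ Xx)/andP[h3 h4] _] := rg w.
have p1 : 0 < g w x by exact: lt_le_trans h3.
have p2 : 0 < g (~~ w) x by exact: lt_le_trans h1.
apply/andP; split; first by apply: divr_ge0; exact: ltW.
rewrite /ratio_max; apply: ler_pM => //.
- exact: ltW.
- by rewrite invr_ge0 ltW.
- by rewrite lef_pV2.
Qed.

Let sq_bound x : 0 <= r x <= ratio_max ->
  2 * (q * r x) ^+ 2 <= 2 * (q * ratio_max) ^+ 2.
Proof.
move=> /andP[r0 r1]; have h1 := mulr_ge0 q_ge0 r0.
have h2 := mulr_ge0 q_ge0 ratio_ge0.
by rewrite ler_pM2l// lerXn2r ?nnegrE//; exact: ler_wpM2l.
Qed.

Let inner_triv x : XX x -> r x = g (~~ w) x / g w x ->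
  (inner x <= (2 * (n1 / MR) ^+ 2 + 2 * (q * ratio_max) ^+ 2)%:E)%E.
Proof.
move=> Xx rx; have rb := ratio_bound Xx rx.
set b := _ + _; rewrite -[X in (_ <= X)%E]mule1 -(probability_setT Q).
rewrite -integral_cst//; apply: ge0_le_integral => //.
- by move=> W _; rewrite lee_fin sqr_ge0.
- apply/measurable_EFinP; under eq_fun do rewrite F_upd; apply: measurable_funX.
  by apply: measurable_funB => //; exact: measurable_funM.
- move=> W _; rewrite F_upd lee_fin (le_trans (sqrrB_le2 _ _))// /b lerD ?(sq_bound rb)//.
  rewrite ler_pM2l// lerXn2r ?nnegrE ?divr_ge0 ?ler0n ?(ltW MR_gt0)//.
  rewrite ler_pM2r ?invr_gt0// /K -(selected_upd vi _ x) /n1 -card_seekers ler_nat.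
  rewrite (_ : selected _ _ _ _ _ = match_count (tnth (upd i x W)) v w M i).
    exact: match_count_le.
  by rewrite (match_count_selected vi) tnth_upd eqxx.
Qed.

Let cardsE : (#|seekers v w|%:R : R) = n1. Proof. by rewrite card_seekers. Qed.

Let G0E j : j \in donors v w i -> G (v j) = G w.
Proof. by rewrite inE => /andP[/eqP ->]. Qed.
Let G1E j : j \in seekers v w -> G (v j) = G (~~ w).
Proof. by rewrite inE => /eqP ->. Qed.

Section fine_case.
Hypothesis MN : (2 * M <= N)%N.
Hypothesis rad : 2 * kp * rho < inr.

(** Chosen so that [th * inr] is [2 * nnradius], the radius of the ball that [fine_deviation] needs
    inside [XX]. *)
Let th := 2 * kp * rho / inr.

Let th01 : 0 < th < 1.
Proof. by rewrite /th divr_gt0 ?mulr_gt0//= ltr_pdivrMr// mul1r. Qed.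

Let rho_le1 : rho <= 1.
Proof.
rewrite leNgt; apply/negP => r1.
have : 1 < rho ^+ m by rewrite exprn_egt1// -lt0n.
rewrite root_dimK ?(ltW MN_gt0)// ltr_pdivlMr// mul1r ltr_nat => NM.
by move: NM MN; clear; lia.
Qed.

Let inner_crude x : XX x -> r x = g (~~ w) x / g w x ->
  (inner x <= (ccrude * crude_rate n1 NR MR eM)%:E)%E.
Proof.
move=> Xx rx; have rb := ratio_bound Xx rx.
have := crude_deviation m_gt0 mXX gm_gt0 gmM a01 fatX M_gt0 MN (rg w) (rg (~~ w)) Xx
  (G := fun j => G (v j)) indepQ (@disjoint_seekers _ v w i) G0E G1E (card_donors vi).
rewrite cardsE -/eM -/MR -/NR -/cv => H.
have e0 : 0 <= 2 * (q * ratio_max) ^+ 2 by rewrite mulr_ge0// sqr_ge0.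
have c0 : 0 <= 2 / MR ^+ 2 by rewrite divr_ge0// exprn_ge0// ltW.
apply: (@le_trans _ _ ((2 / MR ^+ 2 * (2 * (n1 ^+ 2 * eM + n1 * eM + n1 ^+ 2 * (cv * (MR / NR)) ^+ 2 +
    n1 * (cv * (MR / NR)))) + 2 * (q * ratio_max) ^+ 2)%:E)); last first.
  by rewrite lee_fin; exact: crude_algebra.
apply: (integral_affine_le (F := fun W => K x W ^+ 2)) => //.
- under eq_fun do rewrite F_upd; apply: measurable_funX.
  by apply: measurable_funB => //; exact: measurable_funM.
- exact: measurable_funX.
- by move=> W; exact: sqr_ge0.
- by move=> W; exact: sqr_ge0.
- move=> W; rewrite F_upd (le_trans (sqrrB_le2 _ _))// lerD ?(sq_bound rb)//.
  by apply: eq_ler; field; rewrite lt0r_neq0.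
Qed.

Let inner_fine x : core XX ctr th x -> r x = g (~~ w) x / g w x ->
  (inner x <= (cfine * rate)%:E)%E.
Proof.
move=> cx rx.
have Xx : XX x by exact: (core_sub cvx inr_gt0 ballX th01 cx).
have bx : eball x (2 * nnradius m gm a M N) `<=` XX.
  rewrite (_ : 2 * _ = th * inr); first exact: (core_eball cvx ballX th01 cx).
  by rewrite /th /nnradius -/kp -/rho divfK ?lt0r_neq0// mulrA.
have := fine_deviation m_gt0 mXX gm_gt0 gmM L_gt0 a01 fatX M_gt0 MN (rg w) (rg (~~ w)) Xx
  (G := fun j => G (v j)) indepQ (@disjoint_seekers _ v w i) G0E G1E (card_donors vi) bx.
have := beta_bias m_gt0 gm_gt0 L_gt0 a01 M_gt0 MN (rg w) (rg (~~ w)) Xx bx.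
set beta := fine _; rewrite -rx cardsE -/eM -/MR -/NR -/cv -/cs => hb H.
set b := 4 * gM / gm * (shell_width R m M N / NR) in H.
have hb' : `|beta - r x * (MR / NR)| <= L * kp / gm * rho * (MR / NR).
  apply: (le_trans hb); rewrite /nnradius -/kp -/rho; apply: eq_ler.
  by field; rewrite !lt0r_neq0.
have e0 : 0 <= 2 * (n1 / MR * (L * kp / gm * rho * (MR / NR))) ^+ 2 by rewrite mulr_ge0// sqr_ge0.
have c0 : 0 <= 2 / MR ^+ 2 by rewrite divr_ge0// exprn_ge0// ltW.
apply: (@le_trans _ _ ((2 / MR ^+ 2 * (3 * (n1 ^+ 2 * eM + n1 * eM + cs * (n1 ^+ 2 * b ^+ 2 + n1 * b) +
    n1 * (cv * (MR / NR)))) + 2 * (n1 / MR * (L * kp / gm * rho * (MR / NR))) ^+ 2)%:E)); last first.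
  rewrite lee_fin; apply: fine_algebra => //.
  - by rewrite ler1n.
  - by rewrite divr_ge0 ?mulr_ge0// ltW.
  - by rewrite rho_le1 ltW.
apply: (integral_affine_le (F := fun W => (K x W - n1 * beta) ^+ 2)) => //.
- under eq_fun do rewrite F_upd; apply: measurable_funX.
  by apply: measurable_funB => //; exact: measurable_funM.
- by apply: measurable_funX; exact: measurable_funB.
- by move=> W; exact: sqr_ge0.
- by move=> W; exact: sqr_ge0.
- move=> W; rewrite F_upd.
  have -> : K x W / MR - q * r x =
      (K x W - n1 * beta) / MR - (n1 / MR * (r x * (MR / NR) - beta)).
    by rewrite /q; field; rewrite !lt0r_neq0.
  rewrite (le_trans (sqrrB_le2 _ _))// lerD//.
    by apply: eq_ler; field; rewrite lt0r_neq0.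
  rewrite ler_pM2l// -(real_normK (num_real (n1 / MR * (_ - _)))).
  have t0 : 0 <= n1 / MR by rewrite divr_ge0// ltW.
  rewrite lerXn2r ?nnegrE ?normr_ge0//.
    by rewrite mulr_ge0// (le_trans _ hb').
  by rewrite normrM (ger0_norm t0) distrC ler_wpM2l.
Qed.

(** The base point is integrated last. It misses the core with probability at most [cshadow * rho],
    because the density is at most [gM] and [XX] has measure at most 1/gm; there the crude rate is
    enough. *)
Lemma arm_bound_fine : (\int[Q]_W (F W)%:E <= ((cfine + ccrude * cshadow) * rate)%:E)%E.
Proof.
have [h1 h2 h3 h4] := rate_ge.
have h5 : crude_rate n1 NR MR eM * rho <= rate.
  by case: h3 => // r1; have := lt_le_trans r1 rho_le1; rewrite ltxx.
have rate0 : 0 <= rate by exact: le_trans h2.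
pose S := XX `\` core XX ctr th.
have mS : measurable S by apply: measurableD => //; exact: measurable_core.
have [_ GX _ _] := rg w.
have lamX1 : (gm%:E * lam XX <= 1)%E.
  rewrite -(probability_setT (G w)) -[XX in leLHS](setTI XX).
  exact: (density_lower mXX gm_gt0 (rg w) measurableT).
have lamX_fin : lam XX \is a fin_num.
  rewrite ge0_fin_numE// ltNge leye_eq; apply/eqP => lX.
  by move: lamX1; rewrite lX gt0_muley ?lte_fin// leye_eq.
have GS : (G w S <= (cshadow * rho)%:E)%E.
  apply: le_trans (density_upper mXX gM_gt0 (rg w) mS) _.
  apply: (@le_trans _ _ (gM%:E * ((m%:R * th)%:E * lam XX))%E).
    rewrite lee_pmul2l//; exact: (lebesgue_shell cvx mXX inr_gt0 ballX th01 lamX_fin).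
  rewrite -(fineK lamX_fin) -!EFinM lee_fin.
  have : gm * fine (lam XX) <= 1 by rewrite -lee_fin EFinM fineK.
  rewrite -ler_pdivlMl// mulr1 => lb.
  apply: (@le_trans _ _ (gM * (m%:R * th * gm^-1))).
    rewrite ler_pM2l// ler_wpM2l// mulr_ge0//; by case/andP: th01 => /ltW.
  rewrite /cshadow /th; apply: eq_ler.
  by field; rewrite !lt0r_neq0.
set bf := cfine * rate; set bc := ccrude * crude_rate n1 NR MR eM.
have bf0 : 0 <= bf by rewrite mulr_ge0.
have bc0 : 0 <= bc by rewrite mulr_ge0.
rewrite intF; apply: (@le_trans _ _ (\int[G w]_u (bf%:E + (bc * \1_S u)%:E))%E).
  apply: ae_ge0_le_integral => //.
  - by move=> u _; rewrite -EFinD lee_fin addr_ge0// mulr_ge0.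
  - apply: emeasurable_funD => //; apply/measurable_EFinP; apply: measurable_funM => //.
  have aeX : {ae G w, forall x, XX x}.
    exists (~` XX); split => //; exact: measurableC.
  apply: filterS2 aeX rE => x Xx rx _.
  have [cx|cx] := pselect (core XX ctr th x).
    apply: le_trans (inner_fine cx rx) _.
    by rewrite -EFinD lee_fin lerDl mulr_ge0.
  apply: le_trans (inner_crude Xx rx) _.
  by rewrite -EFinD lee_fin indicE mem_set// mulr1 lerDr.
rewrite ge0_integralD//; last 2 first.
- by move=> u _; rewrite lee_fin mulr_ge0.
- by apply/measurable_EFinP; exact: measurable_funM.
rewrite integral_cst//= probability_setT mule1.
under eq_integral do rewrite EFinM.
rewrite ge0_integralZl_EFin//; last exact/measurable_EFinP.
rewrite integral_indic// setIT mulrDl EFinD leeD//.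
apply: (@le_trans _ _ (bc%:E * (cshadow * rho)%:E)%E).
  by rewrite lee_wpmul2l ?lee_fin.
rewrite -EFinM lee_fin /bc.
have -> : ccrude * crude_rate n1 NR MR eM * (cshadow * rho) =
  ccrude * cshadow * (crude_rate n1 NR MR eM * rho) by ring.
by rewrite ler_wpM2l// mulr_ge0.
Qed.

End fine_case.

(** Here M/N is bounded below, so the trivial bound [n1] on the count gives n1/M of the order of
    n1/N, and a factor [rho / rate_cap >= 1] can be inserted. *)
Lemma arm_bound_coarse : rate_cap <= rho -> (\int[Q]_W (F W)%:E <= (ctriv * rate)%:E)%E.
Proof.
move=> cap; have [h1 h2 h3 h4] := rate_ge.
have [_ GX _ _] := rg w.
set b := 2 * (n1 / MR) ^+ 2 + 2 * (q * ratio_max) ^+ 2.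
have b0 : 0 <= b by rewrite addr_ge0// mulr_ge0// sqr_ge0.
rewrite intF; apply: (@le_trans _ _ (\int[G w]_u b%:E)%E).
  apply: ae_ge0_le_integral => //.
  have aeX : {ae G w, forall x, XX x}.
    exists (~` XX); split => //; exact: measurableC.
  by apply: filterS2 aeX rE => x Xx rx _; exact: inner_triv.
rewrite integral_cst//= probability_setT mule1 lee_fin.
apply: (@le_trans _ _ (ctriv * (q ^+ 2 * rho))); last by rewrite ler_wpM2l.
have capm : rate_cap ^+ m <= MR / NR.
  by rewrite -(root_dimK m_gt0 (ltW MN_gt0)) lerXn2r ?nnegrE ?root_dim_ge0// ltW.
have capm0 : 0 < rate_cap ^+ m by exact: exprn_gt0.
have t1 : (n1 / MR) ^+ 2 <= q ^+ 2 * (rate_cap ^+ m)^-1 ^+ 2.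
  have -> : n1 / MR = q * (MR / NR)^-1 by rewrite /q; field; rewrite !lt0r_neq0.
  rewrite exprMn ler_wpM2l ?sqr_ge0// lerXn2r ?nnegrE ?invr_ge0 ?(ltW capm0) ?(ltW MN_gt0)//.
  by rewrite lef_pV2.
have -> : ctriv * (q ^+ 2 * rho) =
    (2 * (q ^+ 2 * (rate_cap ^+ m)^-1 ^+ 2) + 2 * (q * ratio_max) ^+ 2) * (rho / rate_cap).
  by rewrite /ctriv; field; rewrite !lt0r_neq0.
apply: (@le_trans _ _ (2 * (q ^+ 2 * (rate_cap ^+ m)^-1 ^+ 2) + 2 * (q * ratio_max) ^+ 2)).
  by rewrite /b lerD2r ler_pM2l.
rewrite ler_peMr//; last by rewrite ler_pdivlMr// mul1r.
by rewrite addr_ge0// mulr_ge0 ?sqr_ge0// mulr_ge0 ?sqr_ge0.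
Qed.

Lemma arm_bound : (\int[Q]_W (((match_count (tnth W) v w M i)%:R / M%:R -
    (arm_size v (~~ w))%:R / (arm_size v w)%:R * r (tnth W i)) ^+ 2)%:E <=
  (carm * arm_rate (arm_size v (~~ w))%:R (arm_size v w)%:R M%:R
     (nnrate R m M (arm_size v w)) (far_tail R M))%:E)%E.
Proof.
have [h1 h2 h3 h4] := rate_ge.
have rate0 : 0 <= rate by exact: le_trans h2.
have cc0 : 0 <= ccrude * cshadow by rewrite mulr_ge0.
have [cap|cap] := leP rate_cap rho.
  apply: le_trans (arm_bound_coarse cap) _.
  by rewrite lee_fin ler_wpM2r// /carm lerDr addr_ge0.
have [c1 c2] : rho < root_dim m 2^-1 /\ rho < inr / (2 * kp).
  by move: cap; rewrite /rate_cap lt_min => /andP.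
have MN : (2 * M <= N)%N.
  have half0 : 0 <= 2^-1 :> R by rewrite invr_ge0.
  have : rho ^+ m <= (root_dim m 2^-1) ^+ m.
    by rewrite lerXn2r ?nnegrE ?root_dim_ge0 ?(ltW rho_gt0)// ltW.
  rewrite !root_dimK ?(ltW MN_gt0)// ler_pdivrMr// ler_pdivlMl// -natrM ler_nat.
  by [].
apply: le_trans (arm_bound_fine MN _) _.
  by move: c2; rewrite ltr_pdivlMr ?mulr_gt0// mulrC.
by rewrite lee_fin ler_wpM2r// /carm lerDl.
Qed.

End arm_bound.

(** * Inverse moments of the binomial law *)

Section binomial_inverse_moments.
Variables (R : realType) (q : R).
Hypothesis q01 : 0 < q <= 1.

Definition bin_mean (n : nat) (f : nat -> R) : R :=
  \sum_(k < n.+1) 'C(n, k)%:R * q ^+ k * (1 - q) ^+ (n - k) * f k.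

Let q0 : 0 < q. Proof. by case/andP: q01. Qed.
Let p0 : 0 <= 1 - q. Proof. by case/andP: q01 => _; rewrite subr_ge0. Qed.

Lemma bin_mean1 n : bin_mean n (fun=> 1) = 1.
Proof.
rewrite /bin_mean -[RHS](expr1n _ n) -[X in X ^+ n](subrK q 1) exprDn.
by apply: eq_bigr => k _; rewrite mulr1 -[RHS]mulr_natl mulrA mulrAC.
Qed.

Lemma bin_mean_le n (f h : nat -> R) : (forall k, f k <= h k) ->
  bin_mean n f <= bin_mean n h.
Proof.
move=> fh; apply: ler_sum => k _; rewrite ler_wpM2l// !mulr_ge0 ?exprn_ge0//.
exact: ltW.
Qed.

Lemma bin_meanZ n c (f : nat -> R) : bin_mean n (fun k => c * f k) = c * bin_mean n f.
Proof. by rewrite /bin_mean mulr_sumr; apply: eq_bigr => k _; rewrite mulrCA. Qed.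

Lemma bin_meanD n (f h : nat -> R) :
  bin_mean n (fun k => f k + h k) = bin_mean n f + bin_mean n h.
Proof. by rewrite /bin_mean -big_split; apply: eq_bigr => k _; rewrite mulrDr. Qed.

(* [(n + 1) C(n, k) = (k + 1) C(n + 1, k + 1)] *)
Lemma bin_mean_shift n (f : nat -> R) : (forall k, 0 <= f k) ->
  bin_mean n (fun k => f k.+1 / k.+1%:R) <= bin_mean n.+1 f / (n.+1%:R * q).
Proof.
move=> f0; have n0 : 0 < n.+1%:R * q by rewrite mulr_gt0// ltr0n.
rewrite ler_pdivlMr//.
have -> : bin_mean n (fun k => f k.+1 / k.+1%:R) * (n.+1%:R * q) =
    \sum_(k < n.+1) 'C(n.+1, k.+1)%:R * q ^+ k.+1 * (1 - q) ^+ (n.+1 - k.+1) * f k.+1.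
  rewrite /bin_mean mulr_suml; apply: eq_bigr => k _; rewrite subSS exprS.
  have := mul_bin_diag n.+1 k => /(congr1 (fun j => j%:R : R)); rewrite !natrM/= => E.
  have k1 : k.+1%:R != 0 :> R by rewrite pnatr_eq0.
  have -> : 'C(n.+1, k.+1)%:R = n.+1%:R * 'C(n, k)%:R / k.+1%:R :> R.
    by rewrite E mulrC mulKf.
  by field; have := ler0n R k; move=> k0; apply: lt0r_neq0; lra.
rewrite [leRHS]/bin_mean [leRHS]big_ord_recl /= lerDr.
by rewrite bin0 !mul1r mulr_ge0 ?exprn_ge0.
Qed.

Lemma bin_mean_inv2 n : bin_mean n (fun k => (k.+1 * k.+2)%:R^-1) <=
  (n.+1%:R * n.+2%:R * q ^+ 2)^-1.
Proof.
have h1 : bin_mean n.+1 (fun k => k.+1%:R^-1) <= (n.+2%:R * q)^-1.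
  have := @bin_mean_shift n.+1 (fun=> 1) (fun=> ler01).
  by under eq_fun do rewrite div1r; rewrite bin_mean1 div1r.
have := @bin_mean_shift n (fun k => k.+1%:R^-1) (fun k => _).
have -> : (fun k => k.+2%:R^-1 / k.+1%:R) = (fun k => (k.+1 * k.+2)%:R^-1 :> R).
  by apply/funext => k; rewrite natrM invfM mulrC.
move=> /(_ (fun k => _))/le_trans; apply; first by move=> k; rewrite invr_ge0.
apply: (le_trans (ler_wpM2r _ h1)); first by rewrite invr_ge0 mulr_ge0// ltW.
have n0 : 0 <= n%:R :> R by exact: ler0n.
apply: eq_ler; field.
by rewrite (lt0r_neq0 q0)/=; apply/andP; split; apply: lt0r_neq0; lra.
Qed.

Lemma bin_mean_inv3 n : bin_mean n (fun k => (k.+1 * k.+2 * k.+3)%:R^-1) <=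
  (n.+1%:R * n.+2%:R * n.+3%:R * q ^+ 3)^-1.
Proof.
have h1 := bin_mean_inv2 n.+1.
have := @bin_mean_shift n (fun k => (k.+1 * k.+2)%:R^-1) (fun k => _).
have -> : (fun k => (k.+2 * k.+3)%:R^-1 / k.+1%:R) = (fun k => (k.+1 * k.+2 * k.+3)%:R^-1 :> R).
  by apply/funext => k; rewrite -mulnA [in RHS]natrM invfM mulrC.
move=> /(_ (fun k => _))/le_trans; apply; first by move=> k; rewrite invr_ge0.
apply: (le_trans (ler_wpM2r _ h1)); first by rewrite invr_ge0 mulr_ge0// ltW.
apply: eq_ler.
rewrite -[n.+1%:R]natr1 -[n.+2%:R]natr1 -[n.+1%:R]natr1 -[n.+3%:R]natr1 -[n.+2%:R]natr1 -[n.+1%:R]natr1.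
have n0 : 0 <= n%:R :> R by exact: ler0n.
by field; rewrite (lt0r_neq0 q0)/=; do ?[apply/andP; split]; apply: lt0r_neq0; lra.
Qed.

(** For k >= 1 the inverse square is at most 6/((k+1)(k+2)), whose binomial mean is explicit; the
    event k = 0 is excluded by the indicator. For the cube the same comparison has the constant
    24. *)
Lemma bin_mean_pos_inv2 n : (0 < n)%N ->
  bin_mean n (fun k => (0 < k)%N%:R * (n%:R * q / k%:R) ^+ 2) <= 6.
Proof.
move=> n0; have nq : 0 < n%:R * q by rewrite mulr_gt0// ltr0n.
apply: (@le_trans _ _ (bin_mean n (fun k => 6 * (n%:R * q) ^+ 2 * (k.+1 * k.+2)%:R^-1))).
  apply: bin_mean_le => -[|k].
    by rewrite mul0r divr_ge0// mulr_ge0// sqr_ge0.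
  rewrite mul1r expr_div_n [leRHS]mulrAC [leLHS]mulrC ler_pM2r ?exprn_gt0//.
  rewrite -natrX -[X in X <= _]div1r ler_pdivrMr ?ltr0n ?expn_gt0// mulrAC.
  rewrite ler_pdivlMr ?ltr0n// mul1r -natrM ler_nat; nia.
rewrite bin_meanZ -mulrA ler_piMr//.
apply: (le_trans (ler_wpM2l (sqr_ge0 _) (bin_mean_inv2 n))).
rewrite ler_pdivrMr ?mul1r ?mulr_gt0 ?exprn_gt0 ?ltr0n// exprMn ler_pM2r ?exprn_gt0//.
by rewrite expr2 -!natrM ler_nat; nia.
Qed.

Lemma bin_mean_pos_inv3 n : (0 < n)%N ->
  bin_mean n (fun k => (0 < k)%N%:R * (n%:R * q / k%:R) ^+ 3) <= 24.
Proof.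
move=> n0; have nq : 0 < n%:R * q by rewrite mulr_gt0// ltr0n.
have nq3 : 0 <= (n%:R * q) ^+ 3 by rewrite exprn_ge0// ltW.
apply: (@le_trans _ _ (bin_mean n (fun k => 24 * (n%:R * q) ^+ 3 * (k.+1 * k.+2 * k.+3)%:R^-1))).
  apply: bin_mean_le => -[|k].
    by rewrite mul0r divr_ge0// mulr_ge0.
  rewrite mul1r expr_div_n [leRHS]mulrAC [leLHS]mulrC ler_pM2r ?exprn_gt0//.
  rewrite -natrX -[X in X <= _]div1r ler_pdivrMr ?ltr0n ?expn_gt0// mulrAC.
  rewrite ler_pdivlMr ?ltr0n// mul1r -natrM ler_nat !expnS expn0; nia.
rewrite bin_meanZ -mulrA ler_piMr//.
apply: (le_trans (ler_wpM2l nq3 (bin_mean_inv3 n))).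
rewrite ler_pdivrMr ?mul1r ?mulr_gt0 ?exprn_gt0 ?ltr0n// exprMn ler_pM2r ?exprn_gt0//.
by rewrite -natrX -!natrM ler_nat !expnS expn0; nia.
Qed.

(** An assignment is determined by the set of units in arm [w]. Grouping these sets by cardinality
    produces the binomial coefficients. *)
Lemma bin_mean_assignments n (w : bool) (p : bool -> R) (f : nat -> R) :
  p w = q -> p (~~ w) = 1 - q ->
  \sum_(v : {ffun 'I_n -> bool}) (\prod_l p (v l)) * f (arm_size v w) = bin_mean n f.
Proof.
move=> pw pw'.
have ww : (~~ w == w) = false by case: (w).
pose h (A : {set 'I_n}) : {ffun 'I_n -> bool} := [ffun l => if l \in A then w else ~~ w].
have hE A : arm_size (h A) w = #|A|.
  rewrite /arm_size -sum1_card big_mkcond/= [in RHS]big_mkcond; apply: eq_bigr => l _.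
  by rewrite ffunE; case: (l \in A); rewrite ?eqxx ?ww.
have hP A : \prod_l p (h A l) = q ^+ #|A| * (1 - q) ^+ (n - #|A|).
  rewrite (bigID (mem A))/=; congr (_ * _).
    rewrite -prodr_const; apply: eq_bigr => l lA; by rewrite ffunE lA.
  have -> : (n - #|A|)%N = #|~: A| by rewrite [RHS]cardsCs finset.setCK card_ord.
  rewrite -prodr_const; apply: eq_big => [l|l lA]; first by rewrite inE.
  by rewrite ffunE (negbTE lA).
rewrite (reindex h)/=; last first.
  exists (fun v => finset (fun l => v l == w)) => [A _|v _].
    by apply/setP => l; rewrite inE ffunE; case: (l \in A); rewrite ?eqxx ?ww.
  by apply/ffunP => l; rewrite ffunE inE; case: eqP => [->//|]; case: (v l); case: (w).
under eq_bigr do rewrite hP hE.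
rewrite (partition_big (fun A : {set 'I_n} => inord #|A| : 'I_n.+1) xpredT)//=.
rewrite /bin_mean; apply: eq_bigr => k _.
have cardle (A : {set 'I_n}) : (#|A| < n.+1)%N.
  by rewrite ltnS (leq_trans (max_card _))// card_ord.
transitivity (\sum_(A : {set 'I_n} | #|A| == k) q ^+ k * (1 - q) ^+ (n - k) * f k).
  apply: eq_big => [A|A /eqP <-].
    by rewrite -val_eqE /= inordK.
  by rewrite inordK.
rewrite sumr_const -[LHS]mulr_natl !mulrA; congr (_ * _ * _ * _).
rewrite -[X in 'C(X, _)]card_ord -[in RHS]card_draws; congr (_%:R).
by apply: eq_card => A; rewrite inE.
Qed.

End binomial_inverse_moments.

Lemma ler_root_dim (R : realType) m (x y : R) : 0 <= x -> x <= y ->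
  root_dim m x <= root_dim m y.
Proof.
move=> x0 xy; apply: ge0_ler_powR => //; rewrite ?nnegrE ?invr_ge0//.
exact: le_trans xy.
Qed.

(** This reduces the fractional inverse moments caused by (M/N)^(1/m) to moments of integer
    order. *)
Lemma root_dim_le1D (R : realType) m (y : R) : (0 < m)%N -> 0 <= y ->
  root_dim m y <= 1 + y.
Proof.
move=> m0 y0; have [y1|/ltW y1] := leP y 1.
  apply: (@le_trans _ _ 1); last by rewrite lerDl.
  have := ler_root_dim m y0 y1; by rewrite /root_dim powR1.
apply: (@le_trans _ _ y); last by rewrite lerDr.
rewrite -[leRHS]powRr1//; apply: ler_powR => //.
by rewrite invf_le1 ?ltr0n// ler1n.
Qed.

Lemma root_dimM (R : realType) m (x y : R) : 0 <= x -> 0 <= y ->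
  root_dim m (x * y) = root_dim m x * root_dim m y.
Proof. exact: powRM. Qed.

Lemma arm_size_le n (v : 'I_n -> bool) b : (arm_size v b <= n)%N.
Proof.
rewrite /arm_size -[leqRHS]card_ord -sum1_card; apply: leq_sum => i _; exact: leq_b1.
Qed.

Section error_terms_ge0.
Variables (R : realType) (n M eta : R).

Lemma delta_tail_ge0 r0 : 0 <= delta_tail r0 n M eta.
Proof. by apply: addr_ge0; exact: expR_ge0. Qed.

Lemma delta_H1_ge0 r0 : 0 <= eta -> 0 <= delta_H1 r0 n M eta.
Proof.
move=> eta0; have h := exprn_ge0 4 eta0.
by apply: addr_ge0; [rewrite invr_ge0; apply: mulr_ge0; rewrite ?sqr_ge0|
  apply: mulr_ge0; rewrite sqr_ge0].
Qed.

Lemma delta_H2_ge0 m r0 : 0 <= n -> 0 <= M -> 0 <= eta -> 0 <= delta_H2 m r0 n M eta.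
Proof.
move=> n0 M0 eta0; rewrite /delta_H2; apply: addr_ge0; first apply: addr_ge0.
- exact: powR_ge0.
- by rewrite invr_ge0 mulr_ge0.
- by rewrite mulr_ge0 ?delta_tail_ge0// divr_ge0.
Qed.

Lemma delta_H3_ge0 : 0 <= delta_H3 n M eta.
Proof. by rewrite mulr_ge0 ?sqr_ge0// expR_ge0. Qed.

End error_terms_ge0.

(** * Averaging the error rate over the treatments *)

Section mean_rate.
Variables (R : realType) (m : nat).
Hypothesis m_gt0 : (0 < m)%N.

(** All dependence on the random size [N] is moved into powers of [y], the ratio of its mean to its
    value. As n/N >= 1, the linear term n1/N is also bounded by a square. *)
Lemma arm_rate_le (q : R) (n n1 N M : nat) (eM y : R) : 0 < q -> 0 <= eM ->
  (0 < N)%N -> (0 < M)%N -> (n1 <= n)%N -> (N <= n)%N ->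
  y = n%:R * q / N%:R ->
  arm_rate n1%:R N%:R M%:R (nnrate R m M N) eM <=
  (q ^+ 2)^-1 * ((y ^+ 2 + y ^+ 3) * root_dim m (M%:R / (n%:R * q)) + 2 * y ^+ 2 / M%:R) +
  (n%:R / M%:R) ^+ 2 * eM.
Proof.
move=> q0 eM0 + + + + yd.
rewrite -!(ltr_nat R) -!(ler_nat R) => N0 M0 n1n Nn.
have n0 : 0 < n%:R :> R by exact: lt_le_trans Nn.
have y0 : 0 <= y by rewrite yd divr_ge0 ?mulr_ge0// ltW.
have n1N : n1%:R / N%:R <= n%:R / N%:R :> R by rewrite ler_pM2r ?invr_gt0.
have nN1 : 1 <= n%:R / N%:R :> R by rewrite ler_pdivlMr// mul1r.
have n1N0 : 0 <= n1%:R / N%:R :> R by rewrite divr_ge0// ltW.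
have nN0 : 0 <= n%:R / N%:R :> R by exact: le_trans nN1.
have yE : (q ^+ 2)^-1 * y ^+ 2 = (n%:R / N%:R) ^+ 2.
  by rewrite yd; field; rewrite !lt0r_neq0.
have rhoE : nnrate R m M N <= (1 + y) * root_dim m (M%:R / (n%:R * q)).
  rewrite /nnrate (_ : M%:R / N%:R = y * (M%:R / (n%:R * q))); last first.
    by rewrite yd; field; rewrite !lt0r_neq0.
  rewrite root_dimM ?divr_ge0 ?mulr_ge0 ?(ltW q0) ?(ltW M0)//.
  by rewrite ler_wpM2r ?root_dim_ge0// root_dim_le1D.
set ro := root_dim _ _ in rhoE *.
have -> : (q ^+ 2)^-1 * ((y ^+ 2 + y ^+ 3) * ro + 2 * y ^+ 2 / M%:R) =
    (n%:R / N%:R) ^+ 2 * ((1 + y) * ro + M%:R^-1) + (n%:R / N%:R) ^+ 2 / M%:R.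
  by rewrite -yE; ring.
have Mi0 : 0 <= M%:R^-1 :> R by rewrite invr_ge0 ltW.
have r0 : 0 <= nnrate R m M N by exact: root_dim_ge0.
have sq : (n1%:R / N%:R) ^+ 2 <= (n%:R / N%:R) ^+ 2 :> R by rewrite lerXn2r.
rewrite /arm_rate; apply: lerD; last first.
  by rewrite ler_wpM2r// lerXn2r ?nnegrE ?divr_ge0 ?ler_wpM2r// ltW.
apply: lerD.
  by apply: ler_pM; rewrite ?sqr_ge0 ?addr_ge0// lerD2r.
rewrite ler_wpM2r//; apply: le_trans n1N _; rewrite expr2 ler_peMr//.
Qed.

(** The inverse moments of order 2 and 3 are at most 6 and 24, whence 30 = 6 + 24 and 12 = 2 * 6. *)
Lemma mean_arm_rate (n M : nat) (w : bool) (p : bool -> R) (eM : R) :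
  (0 < n)%N -> (0 < M)%N -> 0 < p w <= 1 -> p (~~ w) = 1 - p w -> 0 <= eM ->
  \sum_(v : {ffun 'I_n -> bool}) (\prod_l p (v l)) * ((0 < arm_size v w)%N%:R *
     arm_rate (arm_size v (~~ w))%:R (arm_size v w)%:R M%:R (nnrate R m M (arm_size v w)) eM) <=
  (p w ^+ 2)^-1 * (30 * root_dim m (M%:R / (n%:R * p w)) + 12 / M%:R) +
  (n%:R / M%:R) ^+ 2 * eM.
Proof.
move=> n0 M0 p01 pw eM0; set q := p w in p01 pw *.
have q0 : 0 < q by case/andP: p01.
have p0 b : 0 <= p b.
  have [->|/negPf bw] := eqVneq b w; first exact: ltW.
  have -> : b = ~~ w by case: b w bw {pw p01 q q0} => -[].
  by rewrite pw subr_ge0; case/andP: p01.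
pose y k : R := n%:R * q / k%:R.
pose ro := root_dim m (M%:R / (n%:R * q)).
pose f k : R := (q ^+ 2)^-1 * (ro * ((0 < k)%N%:R * y k ^+ 2) + ro * ((0 < k)%N%:R * y k ^+ 3) +
  2 / M%:R * ((0 < k)%N%:R * y k ^+ 2)) + (n%:R / M%:R) ^+ 2 * eM * 1.
apply: (@le_trans _ _ (\sum_(v : {ffun 'I_n -> bool}) (\prod_l p (v l)) * f (arm_size v w))).
  apply: ler_sum => v _; apply: ler_wpM2l; first by apply: prodr_ge0.
  have last0 : 0 <= (n%:R / M%:R) ^+ 2 * eM by rewrite mulr_ge0// sqr_ge0.
  have [N0|N0] := posnP (arm_size v w).
    by rewrite mul0r /f N0 ltnn !mul0r !mulr0 !addr0 mulr0 add0r mulr1.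
  rewrite mul1r; apply: (le_trans (arm_rate_le q0 eM0 N0 M0 (arm_size_le _ _) (arm_size_le _ _) erefl)).
  by rewrite /f N0; apply: eq_ler; rewrite -/ro -/(y _) !mul1r; ring.
rewrite (@bin_mean_assignments _ q n w p f)//.
have MR : 0 < M%:R :> R by rewrite ltr0n.
have ro0 : 0 <= ro by exact: root_dim_ge0.
have m2 := @bin_mean_pos_inv2 _ q p01 n n0.
have m3 := @bin_mean_pos_inv3 _ q p01 n n0.
rewrite /f bin_meanD !bin_meanZ !bin_meanD !bin_meanZ bin_mean1 mulr1 lerD2r.
rewrite ler_wpM2l ?invr_ge0 ?sqr_ge0//.
have h2 := ler_wpM2l ro0 m2; have h3 := ler_wpM2l ro0 m3.
have M2 : 0 <= 2 / M%:R :> R by rewrite divr_ge0.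
have h4 := ler_wpM2l M2 m2.
apply: le_trans (lerD (lerD h2 h3) h4) _.
rewrite -/ro; apply: eq_ler; ring.
Qed.

(** The terms containing [q] decrease in it, so [q] may be replaced by [eta]; the far tail is
    absorbed by [delta_H3] because [eta <= 1]. *)
Lemma mean_rate_matching_bound (n M : nat) (q eta r0 : R) :
  (0 < n)%N -> (0 < M)%N -> 0 < eta <= 1 -> eta <= q ->
  (q ^+ 2)^-1 * (30 * root_dim m (M%:R / (n%:R * q)) + 12 / M%:R) +
  (n%:R / M%:R) ^+ 2 * far_tail R M <= 30 * matching_bound m r0 n%:R M%:R eta.
Proof.
rewrite -!(ltr_nat R) => n0 M0 /andP[eta0 eta1] etaq.
have q0 : 0 < q by exact: lt_le_trans etaq.
have sq : (q ^+ 2)^-1 <= (eta ^+ 2)^-1.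
  by rewrite lef_pV2 ?posrE ?exprn_gt0// lerXn2r ?nnegrE ?(ltW eta0) ?(ltW q0).
have e20 : 0 <= (eta ^+ 2)^-1 by rewrite invr_ge0 sqr_ge0.
have q20 : 0 <= (q ^+ 2)^-1 by rewrite invr_ge0 sqr_ge0.
have ro : root_dim m (M%:R / (n%:R * q)) <= root_dim m (M%:R / (n%:R * eta)).
  apply: ler_root_dim; first by rewrite divr_ge0 ?mulr_ge0// ltW.
  by rewrite ler_pM2l// lef_pV2 ?posrE ?mulr_gt0// ler_pM2l.
have ro0 : 0 <= root_dim m (M%:R / (n%:R * q)) by exact: root_dim_ge0.
have ro1 : 0 <= root_dim m (M%:R / (n%:R * eta)) by exact: root_dim_ge0.
have Mi0 : 0 <= M%:R^-1 :> R by rewrite invr_ge0 ltW.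
have et0 : 0 <= far_tail R M by exact: expR_ge0.
have H1 := delta_H1_ge0 n%:R M%:R r0 (ltW eta0).
have H2 := delta_H2_ge0 m r0 (ltW n0) (ltW M0) (ltW eta0).
have H3 : (n%:R / M%:R) ^+ 2 * far_tail R M <= delta_H3 n%:R M%:R eta.
  rewrite /delta_H3 ler_wpM2r// lerXn2r ?nnegrE ?divr_ge0 ?mulr_ge0 ?(ltW eta0) ?(ltW M0)//.
  rewrite ler_pM2l// lef_pV2 ?posrE ?mulr_gt0// ler_piMr// ltW.
rewrite /matching_bound -/(root_dim m _) mulrDl mul1r.
set T1 := root_dim m (M%:R / (n%:R * eta)) in ro ro1 *.
have -> : (eta ^+ 2 * M%:R)^-1 = (eta ^+ 2)^-1 * M%:R^-1 by rewrite invfM.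
have h1 : (q ^+ 2)^-1 * (30 * root_dim m (M%:R / (n%:R * q)) + 12 / M%:R) <=
   30 * ((eta ^+ 2)^-1 * T1) + 12 * ((eta ^+ 2)^-1 * M%:R^-1).
  apply: (@le_trans _ _ ((eta ^+ 2)^-1 * (30 * T1 + 12 / M%:R))).
    apply: ler_pM => //; first by rewrite addr_ge0// mulr_ge0.
    by rewrite lerD2r ler_pM2l.
  by apply: eq_ler; ring.
have h2 : 0 <= (eta ^+ 2)^-1 * T1 by rewrite mulr_ge0.
have h3 : 0 <= (eta ^+ 2)^-1 * M%:R^-1 by rewrite mulr_ge0.
have h4 : 0 <= delta_H2 m r0 n%:R M%:R eta * ((eta ^+ 2)^-1 * M%:R^-1) by rewrite mulr_ge0.
have h5 : 0 <= (n%:R / M%:R) ^+ 2 * far_tail R M by rewrite mulr_ge0// sqr_ge0.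
lra.
Qed.

End mean_rate.

(** * The laws of the two arms *)

(** The law is the normalised image under [f] of the restriction of [P] to [E]. It provides the laws
    of the two arms and the law of all covariates given the treatments. *)
Lemma conditional_law d (T : measurableType d) (R : realType) (P : probability T R)
    d' (U : measurableType d') (f : T -> U) (E : set T) :
  measurable E -> measurable_fun setT f -> (0 < P E)%E ->
  exists Q : probability U R,
    (forall A, measurable A -> P (E `&` f @^-1` A) = (P E * Q A)%E) /\
    forall F : U -> \bar R, measurable_fun setT F -> (forall u, 0 <= F u)%E ->
      (\int[P]_(t in E) F (f t) <= P E * \int[Q]_u F u)%E.
Proof.
move=> mE mf PE0.
have PEfin : P E \is a fin_num by exact: fin_num_measure.
have [t0 _] : E !=set0.
  by apply/set0P/negP => /eqP E0; move: PE0; rewrite E0 measure0 ltxx.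
pose PEr : {measure set T -> \bar R} := mrestr P mE.
pose nu : {measure set U -> \bar R} :=
  measure_function_pushforward__canonical__measure_function_Measure PEr mf.
(* The Dirac mass is the default value of the normalisation for mass zero or infinity, both excluded
   here. *)
pose Q : probability U R := mnormalize nu \d_(f t0).
have nuE A : nu A = P (E `&` f @^-1` A) by rewrite /nu /= /pushforward /PEr /= /mrestr setIC.
have nuT : nu setT = P E by rewrite nuE preimage_setT setIT.
have nuQ A : measurable A -> nu A = (P E * Q A)%E.
  move=> mA; rewrite /Q /= /mnormalize nuT gt_eqF// (_ : P E == +oo%E = false)/=; last first.
    by apply/negbTE; move: PEfin; rewrite fin_numE => /andP[].
  rewrite muleC -muleA -[X in (_ * (_ * X))%E](fineK PEfin) -EFinM mulVf ?mule1//.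
  by rewrite lt0r_neq0// fine_gt0// PE0 ltey_eq PEfin.
exists Q; split=> [A mA|F mF F0]; first by rewrite -nuE nuQ.
have mFf : measurable_fun setT (F \o f) by exact: measurableT_comp.
have -> : (\int[P]_(t in E) F (f t) = \int[PEr]_(t in E) F (f t))%E.
  by apply: eq_measure_integral => A mA AE; rewrite /PEr/= /mrestr setIidl.
apply: (@le_trans _ _ (\int[PEr]_t F (f t))%E).
  exact: ge0_subset_integral.
have -> : (\int[PEr]_t F (f t) = \int[nu]_u F u)%E.
  by rewrite (ge0_integral_pushforward mf PEr measurableT mF).
pose k : {nonneg R} := NngNum (fine_ge0 (measure_ge0 P E)).
have kE : k%:num%:E = P E by rewrite /k /= fineK.
have -> : (\int[nu]_u F u = \int[mscale k Q]_u F u)%E.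
  apply: eq_measure_integral => A mA _.
  by rewrite (nuQ _ mA) -kE.
by rewrite ge0_integral_mscale// kE.
Qed.

(** Two distinct nonnegative values are separated by one of countably many brackets with positive
    gap, so that an almost sure equality can be tested bracket by bracket. *)
Lemma natural_bracket (R : realType) (x y : R) : 0 <= x -> x < y ->
  exists i k : nat, x <= i%:R / k.+1%:R /\ i.+1%:R / k.+1%:R <= y.
Proof.
move=> x0 xy; have yx : 0 < y - x by rewrite subr_gt0.
pose k := Num.trunc (2 / (y - x)).
have kP : 2 < k.+1%:R * (y - x) by rewrite -ltr_pdivrMr//; exact: truncnS_gt.
have k0 : 0 < k.+1%:R :> R by rewrite ltr0n.
pose i := (Num.trunc (x * k.+1%:R)).+1.
have xk0 : 0 <= x * k.+1%:R by rewrite mulr_ge0// ltW.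
have /andP[i1 i2] := truncn_itv xk0.
exists i, k; rewrite ler_pdivlMr// ler_pdivrMr//; split; first exact: ltW.
rewrite -[i.+1%:R]natr1 -[i%:R]natr1; move: i1 kP; rewrite mulrBr; lra.
Qed.

(** In the form f (f^2)^(-1) the real power is applied to nonnegative numbers only, and the value 0
    at the zeros of [f] agrees with the convention for the inverse. *)
Lemma measurable_fun_inv d (T : measurableType d) (R : realType) (f : T -> R) :
  measurable_fun setT f -> measurable_fun setT (fun x => (f x)^-1).
Proof.
move=> mf; have -> : (fun x => (f x)^-1) = (fun x => f x * ((f x ^+ 2) `^ (-1))).
  apply/funext => x; rewrite powR_inv1 ?sqr_ge0//.
  have [->|f0] := eqVneq (f x) 0; first by rewrite invr0 mul0r.
  by rewrite expr2 invfM mulrA mulfV// mul1r.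
apply: measurable_funM => //.
exact: measurableT_comp (measurable_powR _) (measurable_funX _ mf).
Qed.

Lemma adde_fin_cancel (R : realType) (x y z : \bar R) :
  x \is a fin_num -> (x + y = x + z -> y = z)%E.
Proof.
by case: x => // x _; case: y => [y||]; case: z => [z||] //= -[/addrI ->].
Qed.

Section arms.
Variables (d : measure_display) (T : measurableType d) (R : realType) (m : nat).
Variables (P : probability T R) (X : T -> 'rV[R]_m) (D : T -> bool).
Hypothesis m_gt0 : (0 < m)%N.
Hypothesis mX : measurable_fun setT X.
Hypothesis mD : measurable_fun setT D.
Local Notation lam := (lebesgue_rV R m).

Lemma measurable_arm b : measurable (arm D b).
Proof.
have -> : arm D b = D @^-1` [set b] by [].
by rewrite -[X in measurable X]setTI; apply: mD.
Qed.

Let mXA A : measurable A -> measurable (X @^-1` A).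
Proof. by move=> mA; rewrite -[X in measurable X]setTI; apply: mX. Qed.

Lemma cprob_law (E : set T) (G : probability 'rV[R]_m R) A :
  measurable E -> (0 < P E)%E ->
  (forall B, measurable B -> P (E `&` X @^-1` B) = (P E * G B)%E) ->
  measurable A -> (cprob P (X @^-1` A) E)%:E = G A.
Proof.
move=> mE PE0 GE mA; rewrite /cprob setIC GE//.
have PEfin : P E \is a fin_num by exact: fin_num_measure.
rewrite fineM ?fin_num_measure// mulrAC mulfV ?mul1r ?fineK ?fin_num_measure//.
by rewrite lt0r_neq0// fine_gt0// PE0 ltey_eq PEfin.
Qed.

Lemma csupport_law (E : set T) (G : probability 'rV[R]_m R) :
  measurable E -> (0 < P E)%E ->
  (forall B, measurable B -> P (E `&` X @^-1` B) = (P E * G B)%E) ->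
  csupport P X E = msupport G.
Proof.
move=> mE PE0 GE; apply/seteqP; split => x Ex r r0.
  by rewrite -(cprob_law mE PE0 GE) ?lte_fin; [exact: Ex|exact: measurable_eball].
by rewrite -lte_fin (cprob_law mE PE0 GE); [exact: Ex|exact: measurable_eball].
Qed.

Variables (XX : set 'rV[R]_m) (e g : 'rV[R]_m -> R) (eta : R).
Hypothesis eP : is_cprob P X (arm D true) e.
Hypothesis XXE : csupport P X setT = XX.
Hypothesis gP : is_density P X setT g.
Hypothesis eta_gt0 : 0 < eta.
Hypothesis ov : overlap XX e eta.

Let marm := measurable_arm.

Lemma support_law : exists2 G : probability 'rV[R]_m R, msupport G = XX &
  forall B, measurable B -> P (X @^-1` B) = G B.
Proof.
have P1 : (0 < P setT)%E by rewrite probability_setT.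
have [G [GE _]] := conditional_law measurableT mX P1.
exists G; first by rewrite -XXE (csupport_law measurableT P1 GE).
by move=> B mB; have := GE B mB; rewrite probability_setT mul1e setTI.
Qed.

Lemma measurable_XX : measurable XX.
Proof. by have [G <- _] := support_law; exact: measurable_msupport. Qed.

(** Overlap holds only almost everywhere. Since the law of [X] has a density this set has full mass,
    and on it the propensities can be bounded pointwise. *)
Definition overlap_set : set 'rV[R]_m := XX `&` [set x | eta <= e x <= 1 - eta].

Lemma measurable_overlap_set : measurable overlap_set.
Proof.
apply: measurableI; first exact: measurable_XX.
have [me _] := eP.
have -> : [set x | eta <= e x <= 1 - eta] = e @^-1` `[eta, 1 - eta]%classic.
  by apply/seteqP; split => x; rewrite /= in_itv.
by rewrite -[X in measurable X]setTI; apply: me.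
Qed.

Lemma overlap_set_full : P (X @^-1` (~` overlap_set)) = 0%E.
Proof.
have [G GX GE] := support_law.
have mXX := measurable_XX; have mov := measurable_overlap_set.
have -> : ~` overlap_set = ~` XX `|` (XX `\` overlap_set).
  apply/seteqP; split => x /=.
    by move=> ox; have [Xx|] := pselect (XX x); [right|left].
  by case=> [nX [/nX]|[_]].
have lam0 : lam (XX `\` overlap_set) = 0%E.
  apply/negligibleP; first exact: measurableD.
  by case: ov => B [mB B0 sB]; exists B; split => // x [Xx nox]; apply: sB => /= h; apply: nox; split => //; exact: h.
have P2 : P (X @^-1` (XX `\` overlap_set)) = 0%E.
  have [mg g0 gE] := gP.
  have mXo : measurable (XX `\` overlap_set) by exact: measurableD.
  have P1 : (0 < P setT)%E by rewrite probability_setT.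
  have h B : measurable B -> P (setT `&` X @^-1` B) = (P setT * G B)%E.
    by move=> mB; rewrite setTI probability_setT mul1e GE.
  rewrite GE// -(cprob_law measurableT P1 h mXo) gE//.
  by apply: null_set_integral => //; apply/measurable_EFinP; exact: measurable_funTS.
apply/eqP; rewrite eq_le measure_ge0 andbT preimage_setU.
apply: le_trans (measureU_null_le _ _ P2) _; [exact/mXA/measurableC|exact/mXA/measurableD|].
apply: eq_ler; transitivity (G (~` XX)).
  by apply: GE; exact: measurableC.
by rewrite -GX msupport_full.
Qed.

Lemma preimage_overlap A : measurable A ->
  P (X @^-1` A) = P (X @^-1` (A `&` overlap_set)).
Proof.
move=> mA; have mov := measurable_overlap_set; apply/eqP; rewrite eq_le; apply/andP; split.
  have -> : X @^-1` A = X @^-1` (A `&` overlap_set) `|` X @^-1` (A `&` ~` overlap_set).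
    by rewrite -preimage_setU -setIUr setUCr setIT.
  apply: measureU_null_le; [exact/mXA/measurableI|exact/mXA/measurableI/measurableC|].
  apply: (subset_measure0 _ _ _ overlap_set_full); [exact/mXA/measurableI/measurableC|exact/mXA/measurableC|].
  by move=> t [].
by apply: le_measure; rewrite ?inE; [exact/mXA/measurableI|exact: mXA|move=> t []].
Qed.

Lemma propensity_itv b x : overlap_set x -> eta <= propensity e b x <= 1 - eta.
Proof. by case=> _ /=; rewrite /propensity; case: b => // /andP[h1 h2]; apply/andP; split; lra. Qed.

Lemma measurable_propensity b : measurable_fun setT (propensity e b).
Proof.
have [me _] := eP; case: b; rewrite /propensity //.
exact: measurable_funB.
Qed.

Let mprop b : measurable_fun setT (fun t => (propensity e b (X t))%:E).
Proof. by apply/measurable_EFinP; exact: measurableT_comp (measurable_propensity b) mX. Qed.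

(** For the arm [true] this is the definition of [e]. The other arm follows by complement,
    cancelling a finite common term. *)
Lemma propensity_integral b A : measurable A -> A `<=` overlap_set ->
  P (X @^-1` A `&` arm D b) = (\int[P]_(t in X @^-1` A) (propensity e b (X t))%:E)%E.
Proof.
move=> mA sA; have [me eE] := eP.
case: b; first exact: eE.
have mAX := mXA mA.
have p0 b t : (X @^-1` A) t -> (0 <= (propensity e b (X t))%:E)%E.
  by move=> At; rewrite lee_fin; have /andP[h _] := propensity_itv b (sA _ At); apply: le_trans h; exact: ltW.
have tot : P (X @^-1` A) = (P (X @^-1` A `&` arm D true) + P (X @^-1` A `&` arm D false))%E.
  rewrite -measureU; [|exact: measurableI|exact: measurableI|].
    congr (P _); rewrite -setIUr (_ : arm D true `|` arm D false = setT) ?setIT//.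
    by apply/seteqP; split => // t _; rewrite /arm /=; case: (D t); [left|right].
  by apply/seteqP; split => // t [[_ h1] [_ h2]]; move: h1 h2; rewrite /arm /= => ->.
have intot : P (X @^-1` A) = (\int[P]_(t in X @^-1` A) (propensity e true (X t))%:E +
    \int[P]_(t in X @^-1` A) (propensity e false (X t))%:E)%E.
  rewrite -ge0_integralD//; [|exact: p0|exact: measurable_funTS|exact: p0|exact: measurable_funTS].
  rewrite -[LHS]mul1e -integral_cst//; apply: eq_integral => t _.
  by rewrite /propensity -EFinD subrKC.
move: intot; rewrite tot -(eE _ mA).
have fin : P (X @^-1` A `&` arm D true) \is a fin_num by rewrite fin_num_measure//; exact: measurableI.
exact: adde_fin_cancel fin.
Qed.

(** With the whole space for [A] this bounds the arm probabilities below; with small balls it shows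
    that each arm has the support of [X]. *)
Lemma arm_lower b A : measurable A -> (eta%:E * P (X @^-1` A) <= P (X @^-1` A `&` arm D b))%E.
Proof.
move=> mA; rewrite preimage_overlap//; have mov := measurable_overlap_set.
have mAo : measurable (A `&` overlap_set) by exact: measurableI.
apply: (@le_trans _ _ (P (X @^-1` (A `&` overlap_set) `&` arm D b))); last first.
  apply: le_measure; rewrite ?inE; [apply: measurableI => //; exact: mXA|apply: measurableI => //; exact: mXA|].
  by move=> t [[]].
rewrite propensity_integral//.
rewrite -integral_cst//; last exact: mXA.
apply: ge0_le_integral => //; [exact: mXA|by move=> t _; rewrite lee_fin ltW|exact: measurable_funTS|].
by move=> t [_ ot]; rewrite lee_fin; have /andP[] := propensity_itv b ot.
Qed.

Lemma arm_prob_ge b : (eta%:E <= P (arm D b))%E.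
Proof.
have := arm_lower b measurableT; rewrite preimage_setT probability_setT mule1 setTI.
exact.
Qed.

Lemma arm_prob_gt0 b : (0 < P (arm D b))%E.
Proof. by apply: lt_le_trans (arm_prob_ge b); rewrite lte_fin. Qed.

Lemma arm_prob_sum b : fine (P (arm D (~~ b))) = 1 - fine (P (arm D b)).
Proof.
have -> : arm D (~~ b) = ~` arm D b.
  by apply/seteqP; split => t; rewrite /arm /=; case: (D t) b => -[].
rewrite probability_setC// fineB ?fin_num_measure//.
Qed.

Lemma csupport_arm b : csupport P X (arm D b) = XX.
Proof.
rewrite -XXE; have T1 : (0 < P setT)%E by rewrite probability_setT.
have Ppos : 0 < fine (P (arm D b)).
  by rewrite fine_gt0// arm_prob_gt0 ltey_eq fin_num_measure.
have mB x r : measurable (X @^-1` eball x r) by apply: mXA; exact: measurable_eball.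
have fin x r : P (X @^-1` eball x r) \is a fin_num by exact: fin_num_measure.
have finI x r : P (X @^-1` eball x r `&` arm D b) \is a fin_num.
  by rewrite fin_num_measure//; exact: measurableI.
have pT : fine (P [set: T]) = 1 by rewrite probability_setT.
apply/seteqP; split => x Ex r r0; have := Ex r r0; rewrite /cprob setIT pT divr1.
  rewrite pmulr_lgt0 ?invr_gt0// => h; apply: lt_le_trans h _.
  rewrite fine_le//; apply: le_measure; rewrite ?inE//; exact: measurableI.
move=> h; rewrite pmulr_lgt0 ?invr_gt0//.
have := arm_lower b (measurable_eball x r).
rewrite -(fineK (fin x r)) -(fineK (finI x r)) -EFinM lee_fin; apply: lt_le_trans.
exact: mulr_gt0.
Qed.

Variable gD : bool -> 'rV[R]_m -> R.
Hypothesis gDP : forall b, is_density P X (arm D b) (gD b).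
Variables (gm gM L : R).
Hypothesis gm_gt0 : 0 < gm.
Hypothesis gD_itv : forall b x, XX x -> gm <= gD b x <= gM.
Hypothesis gD_lip : forall b x z, XX x -> XX z -> `|gD b z - gD b x| <= L * edist x z.

Variable G : bool -> probability 'rV[R]_m R.
Hypothesis GE : forall b A, measurable A ->
  P (arm D b `&` X @^-1` A) = (P (arm D b) * G b A)%E.

Lemma arm_density b A : measurable A -> G b A = (\int[lam]_(x in A) (gD b x)%:E)%E.
Proof.
move=> mA; have [_ _ <-//] := gDP b.
by rewrite (cprob_law (marm b) (arm_prob_gt0 b) (GE b) mA).
Qed.

Lemma arm_overlap b : G b (~` overlap_set) = 0%E.
Proof.
have mo := measurableC measurable_overlap_set.
have : P (arm D b `&` X @^-1` (~` overlap_set)) = 0%E.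
  apply: (subset_measure0 _ _ _ overlap_set_full); [apply: measurableI => //|exact: mXA|].
    exact: mXA.
  by move=> t [].
rewrite GE// => /eqP; rewrite mule_eq0 => /orP[/eqP h|/eqP//].
by have := arm_prob_gt0 b; rewrite h ltxx.
Qed.

Lemma arm_regular b : regular_density XX gm gM L (G b) (gD b).
Proof.
have [mg g0 _] := gDP b; split => //; [split => // A mA; exact: arm_density| |exact: gD_itv|exact: gD_lip].
apply: (subset_measure0 _ _ _ (arm_overlap b)); [apply: measurableC; exact: measurable_XX|
  apply: measurableC; exact: measurable_overlap_set|].
by move=> x nX [].
Qed.

Variable w : bool.

Definition density_odds (x : 'rV[R]_m) : R :=
  fine (P (arm D w)) / fine (P (arm D (~~ w))) * (propensity e (~~ w) x / propensity e w x).

Lemma measurable_density_odds : measurable_fun setT density_odds.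
Proof.
apply: measurable_funM => //; apply: measurable_funM; first exact: measurable_propensity.
apply: measurable_fun_inv; exact: measurable_propensity.
Qed.

Let pw b := fine (P (arm D b)).
Let pw_gt0 b : 0 < pw b.
Proof. by rewrite fine_gt0// arm_prob_gt0 ltey_eq fin_num_measure. Qed.
Let pwE b : P (arm D b) = (pw b)%:E. Proof. by rewrite fineK// fin_num_measure. Qed.

Let prop_gt0 b x : overlap_set x -> 0 < propensity e b x.
Proof. by move/(propensity_itv b) => /andP[h _]; exact: lt_le_trans h. Qed.

Let odds_scale x s : overlap_set x ->
  (density_odds x <= s) = (pw w * propensity e (~~ w) x <= pw (~~ w) * s * propensity e w x) /\
  (s <= density_odds x) = (pw (~~ w) * s * propensity e w x <= pw w * propensity e (~~ w) x).
Proof.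
move=> ox; have h := prop_gt0 w ox; rewrite /density_odds -!/(pw _).
have -> : pw w / pw (~~ w) * (propensity e (~~ w) x / propensity e w x) =
  pw w * propensity e (~~ w) x / (pw (~~ w) * propensity e w x).
  by field; rewrite !lt0r_neq0.
by rewrite ler_pdivrMr ?ler_pdivlMr ?mulr_gt0// mulrCA mulrA.
Qed.

Let mean_prop b c A : measurable A -> A `<=` overlap_set -> 0 <= c ->
  (\int[P]_(t in X @^-1` A) (c * propensity e b (X t))%:E = (c * pw b)%:E * G b A)%E.
Proof.
move=> mA sA c0; under eq_integral do rewrite EFinM.
rewrite ge0_integralZl//; first last.
- by move=> t At; rewrite lee_fin ltW// prop_gt0//; exact: sA.
- exact: measurable_funTS.
- exact: mXA.
by rewrite -propensity_integral// setIC GE// pwE EFinM muleA.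
Qed.

(** Cross-multiplied, a bound on the odds is a pointwise comparison of two propensities, and
    integration turns it into one of the two arm laws. [density_law] reaches the same comparison
    from the ratio of the densities, which makes the two ratios comparable. *)
Let odds_law A s : measurable A -> A `<=` overlap_set -> 0 <= s ->
  ((forall x, A x -> (density_odds x <= s)%R) -> G (~~ w) A <= s%:E * G w A)%E /\
  ((forall x, A x -> (s <= density_odds x)%R) -> s%:E * G w A <= G (~~ w) A)%E.
Proof.
move=> mA sA s0; have ps0 : 0 <= pw (~~ w) * s by rewrite mulr_ge0// ltW.
pose f1 t := pw w * propensity e (~~ w) (X t).
pose f2 t := pw (~~ w) * s * propensity e w (X t).
have f0 t : (X @^-1` A) t -> 0 <= f1 t /\ 0 <= f2 t.
  by move=> At; split; rewrite mulr_ge0// ltW// prop_gt0//; exact: sA.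
have m1 : measurable_fun (X @^-1` A) (fun t => (f1 t)%:E).
  by under eq_fun do rewrite EFinM; apply/measurable_funTS/measurable_funeM.
have m2 : measurable_fun (X @^-1` A) (fun t => (f2 t)%:E).
  by under eq_fun do rewrite EFinM; apply/measurable_funTS/measurable_funeM.
have i1 : (\int[P]_(t in X @^-1` A) (f1 t)%:E = (pw w * pw (~~ w))%:E * G (~~ w) A)%E.
  by rewrite mean_prop// ltW.
have i2 : (\int[P]_(t in X @^-1` A) (f2 t)%:E = (pw w * pw (~~ w))%:E * (s%:E * G w A))%E.
  by rewrite mean_prop// muleA -EFinM; congr (_%:E * _)%E; ring.
have pp : (0 < (pw w * pw (~~ w))%:E)%E by rewrite lte_fin mulr_gt0.
split=> As; rewrite -(@lee_pmul2l _ _ _ pp)// -?i1 -?i2; apply: ge0_le_integral => //;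
  try exact: mXA; try by move=> t /f0[]; rewrite lee_fin.
  by move=> t At; rewrite lee_fin -(odds_scale s (sA _ At)).1; exact: As.
by move=> t At; rewrite lee_fin -(odds_scale s (sA _ At)).2; exact: As.
Qed.

Let gD_gt0 b x : overlap_set x -> 0 < gD b x.
Proof. by case=> Xx _; have /andP[h _] := gD_itv b Xx; exact: lt_le_trans h. Qed.
Let mgD b : measurable_fun setT (fun x => (gD b x)%:E).
Proof. by have [mg _ _] := gDP b; exact/measurable_EFinP. Qed.

Let density_law A s : measurable A -> A `<=` overlap_set -> 0 <= s ->
  ((forall x, A x -> (gD (~~ w) x / gD w x <= s)%R) -> G (~~ w) A <= s%:E * G w A)%E /\
  ((forall x, A x -> (s <= gD (~~ w) x / gD w x)%R) -> s%:E * G w A <= G (~~ w) A)%E.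
Proof.
move=> mA sA s0; rewrite !arm_density//.
have g0 b x : A x -> (0 <= (gD b x)%:E)%E by move=> /sA /(gD_gt0 b) h; rewrite lee_fin ltW.
rewrite -ge0_integralZl//; [|exact: measurable_funTS|exact: g0].
have ms : measurable_fun A (fun x => s%:E * (gD w x)%:E)%E.
  exact/measurable_funTS/measurable_funeM.
split=> As.
  apply: ge0_le_integral => //; [exact: g0|exact: measurable_funTS|].
  by move=> x Ax; rewrite -EFinM lee_fin -ler_pdivrMr; [exact: As|exact/gD_gt0/sA].
apply: ge0_le_integral => //; [by move=> x /g0 h; rewrite mule_ge0|exact: measurable_funTS|].
by move=> x Ax; rewrite -EFinM lee_fin -ler_pdivlMr; [exact: As|exact/gD_gt0/sA].
Qed.

Let null_between A s t : measurable A -> s < t ->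
  (G (~~ w) A <= s%:E * G w A)%E -> (t%:E * G w A <= G (~~ w) A)%E -> G w A = 0%E.
Proof.
move=> mA st h1 h2; have := le_trans h2 h1.
have fin : G w A \is a fin_num by exact: fin_num_measure.
have : 0 <= fine (G w A) by rewrite fine_ge0.
rewrite -(fineK fin) -!EFinM lee_fin => a0 ta; congr EFin; apply/eqP; rewrite eq_le a0 andbT.
have : (t - s) * fine (G w A) <= 0 by rewrite mulrBl; lra.
by rewrite pmulr_rle0// subr_gt0.
Qed.

(* If the two functions differed, a rational bracket [s < t] would separate them; on
   the set where one is at most [s] and the other at least [t], the law [G (~~ w)] is
   at most [s] times and at least [t] times [G w], so that this set is null. *)
Let ratios (b : bool) x : R := if b then density_odds x else gD (~~ w) x / gD w x.

Let measurable_ratios b : measurable_fun setT (ratios b).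
Proof.
case: b; first exact: measurable_density_odds.
apply: measurable_funM; last apply: measurable_fun_inv.
  by have [] := gDP (~~ w).
by have [] := gDP w.
Qed.

Let ratios_ge0 b x : overlap_set x -> 0 <= ratios b x.
Proof.
move=> ox; case: b; rewrite /ratios; last by rewrite divr_ge0// ltW// gD_gt0.
by apply: mulr_ge0; apply: divr_ge0; apply: ltW; rewrite ?prop_gt0//; exact: pw_gt0.
Qed.

Let bracket b i k : set 'rV[R]_m := overlap_set `&`
  ([set x | ratios b x <= i%:R / k.+1%:R] `&` [set x | i.+1%:R / k.+1%:R <= ratios (~~ b) x]).

Let bracket_null b i k : G w (bracket b i k) = 0%E.
Proof.
have mB : measurable (bracket b i k).
  apply: measurableI; first exact: measurable_overlap_set.
  by apply: measurableI; apply: measurable_set_le => //; exact: measurable_ratios.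
have sB : bracket b i k `<=` overlap_set by move=> x [].
have k0 : 0 < k.+1%:R :> R by rewrite ltr0n.
have st : i%:R / k.+1%:R < i.+1%:R / k.+1%:R :> R by rewrite ltr_pM2r ?invr_gt0// ltr_nat.
have s0 : 0 <= i%:R / k.+1%:R :> R by rewrite divr_ge0.
have t0 : 0 <= i.+1%:R / k.+1%:R :> R by rewrite divr_ge0.
apply: (null_between mB st).
  case: b mB sB => mB sB; [apply: (odds_law mB sB s0).1 => x []|apply: (density_law mB sB s0).1 => x []].
    by move=> _ [].
  by move=> _ [].
case: b mB sB => mB sB; [apply: (density_law mB sB t0).2 => x []|apply: (odds_law mB sB t0).2 => x []].
  by move=> _ [].
by move=> _ [].
Qed.

Lemma density_oddsE : {ae G w, forall x, density_odds x = gD (~~ w) x / gD w x}.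
Proof.
have mo := measurable_overlap_set.
have aeo : {ae G w, forall x, overlap_set x}.
  by exists (~` overlap_set); split => //; [exact: measurableC|exact: arm_overlap].
have aeb b i k : {ae G w, forall x, ~ bracket b i k x}.
  exists (bracket b i k); split; last by move=> x /= /contrapT.
    apply: measurableI => //.
    by apply: measurableI; apply: measurable_set_le => //; exact: measurable_ratios.
  exact: bracket_null.
have aet := ae_foralln (fun i => ae_foralln (fun k => aeb true i k)).
have aef := ae_foralln (fun i => ae_foralln (fun k => aeb false i k)).
apply: filterS3 aeo aet aef => x ox ht hf.
apply/eqP; rewrite eq_le !leNgt; apply/andP; split; apply/negP => lt.
  have [i [k [h1 h2]]] := natural_bracket (ratios_ge0 false ox) lt.
  by apply: (hf i k); split.
have [i [k [h1 h2]]] := natural_bracket (ratios_ge0 true ox) lt.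
by apply: (ht i k); split.
Qed.

End arms.

Lemma integral_finite_valued d (T : measurableType d) (R : realType)
    (P : probability T R) (F : finType) (V : T -> F) (h : F -> \bar R) :
  (forall v, measurable [set t | V t = v]) -> (forall v, (0 <= h v)%E) ->
  (\int[P]_t h (V t) = \sum_v h v * P [set t | V t = v])%E.
Proof.
move=> mV h0.
have -> : (fun t => h (V t)) = (fun t => \sum_v h v * (\1_[set t | V t = v] t)%:E)%E.
  apply/funext => t; rewrite (bigD1 (V t))//= indicE mem_set// mule1 big1 ?adde0// => v vt.
  by rewrite indicE memNset ?mule0// => /= e; move: vt; rewrite -e eqxx.
have mi v : measurable_fun setT (fun t => (\1_[set t | V t = v] t)%:E : \bar R).
  by apply/measurable_EFinP; exact: measurable_indic.
rewrite ge0_integral_sum//; first last.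
- by move=> v t _; rewrite mule_ge0// lee_fin indicE.
- by move=> v; exact: measurable_funeM.
by apply: eq_bigr => v _; rewrite ge0_integralZl// integral_indic// setIT.
Qed.

Lemma first_unit_treated n (v : 'I_n -> bool) w : (0 < arm_size v w)%N ->
  exists2 i, first_unit v w = Some i & v i = w.
Proof.
move=> v0; case E : (first_unit v w) => [i|]; last first.
  move: v0; rewrite /arm_size big1// => i _; apply/eqP; rewrite eqb0; apply/negP => vi.
  have : i \in [seq i <- enum 'I_n | v i == w] by rewrite mem_filter vi mem_enum.
  by move: E; rewrite /first_unit; case: [seq _ <- _ | _].
exists i => //; have : i \in [seq i <- enum 'I_n | v i == w].
  move: E; rewrite /first_unit; case: [seq _ <- _ | _] => //= a s [->]; exact: mem_head.
by rewrite mem_filter => /andP[/eqP].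
Qed.

(** * Disintegration of the error along the treatments *)

Section sample_error.
Variables (d : measure_display) (T : measurableType d) (R : realType) (m n M : nat).
Variables (P : probability T R) (X : T -> 'rV[R]_m) (Y : bool -> T -> R) (D : T -> bool).
Variable Z : 'I_n -> T -> 'rV[R]_m * R * bool.
Hypothesis mD : measurable_fun setT D.
Hypothesis iid : iid_copies P Z (fun t => (X t, Yobs Y D t, D t)).

Definition treated (v : 'I_n -> bool) : set T := [set t | forall i, (Z i t).2 = v i].
Definition covariates (t : T) : n.-tuple 'rV[R]_m := [tuple (Z i t).1.1 | i < n].

Let mZ i : measurable_fun setT (Z i). Proof. by case: iid. Qed.

Lemma measurable_covariates : measurable_fun setT covariates.
Proof.
apply/measurable_fun_tnthP => l.
rewrite (_ : _ \o _ = fun t => (Z l t).1.1); last by apply/funext => t /=; rewrite tnth_mktuple.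
apply: (measurableT_comp measurable_fst).
exact: (measurableT_comp measurable_fst (mZ l)).
Qed.

Lemma measurable_treated v : measurable (treated v).
Proof.
have -> : treated v = \bigcap_(i in [set: 'I_n]) (fun t => (Z i t).2) @^-1` [set v i].
  by apply/seteqP; split => t /= h i; [move=> _; exact: h|exact: h].
apply: fin_bigcap_measurable => // i _.
rewrite -[X in measurable X]setTI.
exact: (measurableT_comp measurable_snd (mZ i)).
Qed.

Let cell b (A : set 'rV[R]_m) : set ('rV[R]_m * R * bool) := [set z | A z.1.1 /\ z.2 = b].

Let measurable_cell b A : measurable A -> measurable (cell b A).
Proof.
move=> mA; have -> : cell b A = (A `*` setT) `*` [set b].
  by apply/seteqP; split => -[[x y] c] /=; [case=> ? ?; split|case=> -[? _] ?; split].
by apply: measurableX => //; exact: measurableX.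
Qed.

Lemma joint_law v (A : 'I_n -> set 'rV[R]_m) : (forall i, measurable (A i)) ->
  P (treated v `&` covariates @^-1` [set W | forall i, A i (tnth W i)]) =
  (\prod_i P (X @^-1` A i `&` arm D (v i)))%E.
Proof.
move=> mA; case: iid => _ _ same indep.
have -> : treated v `&` covariates @^-1` [set W | forall i, A i (tnth W i)] =
    \bigcap_(i in [set: 'I_n]) Z i @^-1` cell (v i) (A i).
  apply/seteqP; split => t /=.
    by move=> [h1 h2] i _; split; [have := h2 i; rewrite tnth_mktuple|exact: h1].
  by move=> h; split => i; [have [] := h i I|rewrite tnth_mktuple; have [] := h i I].
rewrite indep; last by move=> i; exact: measurable_cell.
apply: eq_bigr => i _; rewrite same; last exact: measurable_cell.
by [].
Qed.

Lemma treated_prob v : P (treated v) = (\prod_i P (arm D (v i)))%E.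
Proof.
rewrite -[treated v]setIT -(preimage_setT covariates).
have -> : setT = [set W : n.-tuple 'rV[R]_m | forall i, [set: 'rV[R]_m] (tnth W i)].
  by apply/seteqP; split.
by rewrite (joint_law v (A := fun=> setT))//; apply: eq_bigr => i _; rewrite preimage_setT setTI.
Qed.

Variable G : bool -> probability 'rV[R]_m R.
Hypothesis GE : forall b A, measurable A ->
  P (arm D b `&` X @^-1` A) = (P (arm D b) * G b A)%E.
Hypothesis arm_gt0 : forall b, (0 < P (arm D b))%E.

Let pw b := fine (P (arm D b)).
Let pw_gt0 b : 0 < pw b.
Proof. by rewrite fine_gt0// arm_gt0 ltey_eq fin_num_measure//; exact: measurable_arm. Qed.
Let pwE b : P (arm D b) = (pw b)%:E.
Proof. by rewrite fineK// fin_num_measure//; exact: measurable_arm. Qed.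

Let treated_probE v : P (treated v) = (\prod_i pw (v i))%:E.
Proof. by rewrite treated_prob -prodEFin; apply: eq_bigr => i _; rewrite pwE. Qed.

(** Given the treatments the covariates stay independent, because the joint probability and the
    probability of the treatments both factor over the units. *)
Lemma treated_law v : exists2 Q : probability (n.-tuple 'rV[R]_m) R,
  forall A : 'I_n -> set 'rV[R]_m, (forall i, measurable (A i)) ->
    Q [set W | forall i, A i (tnth W i)] = (\prod_i G (v i) (A i))%E &
  forall F : n.-tuple 'rV[R]_m -> \bar R, measurable_fun setT F -> (forall W, 0 <= F W)%E ->
    (\int[P]_(t in treated v) F (covariates t) <= P (treated v) * \int[Q]_W F W)%E.
Proof.
have p0 : 0 < \prod_i pw (v i) by apply: prodr_gt0 => i _; exact: pw_gt0.
have Pv0 : (0 < P (treated v))%E by rewrite treated_probE lte_fin.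
have [Q [QE QF]] := conditional_law (measurable_treated v) measurable_covariates Pv0.
exists Q => // A mA.
have := QE _ (measurable_rect mA); rewrite joint_law// treated_probE.
have -> : (\prod_i P (X @^-1` A i `&` arm D (v i)) =
    (\prod_i pw (v i))%:E * \prod_i G (v i) (A i))%E.
  rewrite -prodEFin -big_split/=; apply: eq_bigr => i _.
  by rewrite setIC GE// pwE.
move/(congr1 (fun z => ((\prod_i pw (v i))^-1)%:E * z)%E).
by rewrite !muleA -!EFinM mulVf ?lt0r_neq0// !mul1e => ->.
Qed.

Variables (e : 'rV[R]_m -> R) (w : bool) (Kc eM : R).
Hypothesis m_odds : measurable_fun setT (density_odds P D e w).
Hypothesis Kc0 : 0 <= Kc.
Hypothesis eM0 : 0 <= eM.
Let rate (v : 'I_n -> bool) := arm_rate (arm_size v (~~ w))%:R (arm_size v w)%:R M%:R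
  (nnrate R m M (arm_size v w)) eM.
Hypothesis arm_bnd : forall (v : 'I_n -> bool) i, v i = w ->
  forall Q : probability (n.-tuple 'rV[R]_m) R,
  (forall A : 'I_n -> set 'rV[R]_m, (forall i, measurable (A i)) ->
    Q [set W | forall i, A i (tnth W i)] = (\prod_i G (v i) (A i))%E) ->
  (\int[Q]_W (((match_count (tnth W) v w M i)%:R / M%:R -
      (arm_size v (~~ w))%:R / (arm_size v w)%:R * density_odds P D e w (tnth W i)) ^+ 2)%:E
   <= (Kc * rate v)%:E)%E.

Let err t : \bar R := (oapp (fun i => weight_error P D Z e w M i t ^+ 2) 0
  (first_unit (fun i => (Z i t).2) w))%:E.

Let err_ge0 t : (0 <= err t)%E.
Proof. by rewrite lee_fin; case: first_unit => //= i; exact: sqr_ge0. Qed.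

(** The outer factor, the square of n_{~w}/n_w, cancels the factor n_w/n_{~w} in front of K/M and
    leaves the error that [arm_bnd] estimates. *)
Lemma treated_error v : (0 < arm_size v w)%N ->
  ((((arm_size v (~~ w))%:R / (arm_size v w)%:R) ^+ 2)%:E *
    \int[P]_(t in treated v) err t <= P (treated v) * (Kc * rate v)%:E)%E.
Proof.
move=> N0; have [i fi vi] := first_unit_treated N0.
have mtr := measurable_treated v.
have rate0 : 0 <= rate v.
  have h := root_dim_ge0 m (M%:R / (arm_size v w)%:R : R).
  rewrite /rate /arm_rate; apply: addr_ge0; last by rewrite mulr_ge0// sqr_ge0.
  apply: addr_ge0; last by rewrite !divr_ge0.
  by rewrite mulr_ge0 ?sqr_ge0// addr_ge0// invr_ge0.
(* If the other arm is empty the outer factor vanishes, and nothing has to be cancelled. *)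
set q := _ / _; have [q0|q0] := eqVneq q 0.
  by rewrite q0 expr0n/= mul0e mule_ge0// lee_fin mulr_ge0.
have NR : (arm_size v w)%:R != 0 :> R by rewrite pnatr_eq0 -lt0n.
have NR' : (arm_size v (~~ w))%:R != 0 :> R.
  by apply: contraNN q0 => /eqP h; rewrite /q h mul0r.
pose F (W : n.-tuple 'rV[R]_m) : \bar R := (((match_count (tnth W) v w M i)%:R / M%:R -
   q * density_odds P D e w (tnth W i)) ^+ 2)%:E.
have mF : measurable_fun setT F.
  apply/measurable_EFinP/measurable_funX/measurable_funB.
    by apply: measurable_funM => //; exact: measurable_match_count.
  apply: measurable_funM => //; apply: measurableT_comp => //; exact: measurable_tnth.
have F0 W : (0 <= F W)%E by rewrite lee_fin sqr_ge0.
have errF t : treated v t -> ((q ^+ 2)%:E * err t = F (covariates t))%E.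
  move=> tv; have E : (fun i => (Z i t).2) = v by apply/funext.
  rewrite /err E fi /= /weight_error E -/(density_odds P D e w _) -EFinM -exprMn.
  congr ((_ ^+ 2)%:E); rewrite mulrBr !tnth_mktuple.
  have -> : match_count (tnth (covariates t)) v w M i =
      match_count (fun i => (Z i t).1.1) v w M i.
    by congr (match_count _ _ _ _ _); apply/funext => j; rewrite tnth_mktuple.
  by congr (_ - _); rewrite /q mulrA [_ / _ * (_ / _)]mulrA mulfVK// mulfV// mul1r.
have [Q QA QF] := treated_law v.
have -> : ((q ^+ 2)%:E * \int[P]_(t in treated v) err t =
    \int[P]_(t in treated v) F (covariates t))%E.
  transitivity (\int[P]_(t in treated v) ((q ^+ 2)%:E * err t))%E; last first.
    by apply: eq_integral => t; rewrite inE => tv; exact: errF.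
  rewrite ge0_integralZl//.
    (* Measurability of the error is obtained on this cell alone, where it is a multiple of a
       measurable function of the covariates. *)
    have mFc : measurable_fun setT (fun t => (q ^+ 2)^-1%:E * F (covariates t))%E.
      by apply: measurable_funeM; exact: measurableT_comp measurable_covariates.
    apply: eq_measurable_fun (measurable_funTS mFc) => t; rewrite inE => tv.
    have q2 : q ^+ 2 != 0 by exact: expf_neq0.
    have qq : ((q ^+ 2)^-1%:E * (q ^+ 2)%:E = 1 :> \bar R)%E by rewrite -EFinM mulVf.
    by rewrite -(errF t tv) muleA qq mul1e.
  by rewrite lee_fin sqr_ge0.
apply: le_trans (QF F mF F0) _; rewrite lee_wpmul2l//; exact: arm_bnd.
Qed.

(** The conditional expectation takes one value for each treatment vector; summed over these, its
    normalisation cancels the probability of the vector. *)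
Lemma expected_weight_error_le :
  (expected_weight_error P D Z e w M <=
   (Kc * \sum_(v : {ffun 'I_n -> bool}) (\prod_l pw (v l)) *
     ((0 < arm_size v w)%N%:R * rate v))%:E)%E.
Proof.
pose V t : {ffun 'I_n -> bool} := [ffun i => (Z i t).2].
have VE v : [set t | V t = v] = treated v.
  apply/seteqP; split => t /=; first by move=> <- i; rewrite ffunE.
  by move=> h; apply/ffunP => i; rewrite ffunE.
pose h (v : {ffun 'I_n -> bool}) : \bar R :=
  ((((arm_size v (~~ w))%:R / (arm_size v w)%:R) ^+ 2)%:E *
    ((fine (P (treated v)))^-1%:E * \int[P]_(t in treated v) err t) *
   ((0 < ((arm_size v w)%:R : R))%R%:R)%:E)%E.
have h0 v : (0 <= h v)%E.
  rewrite /h; apply: mule_ge0; last by rewrite lee_fin.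
  apply: mule_ge0; first by rewrite lee_fin sqr_ge0.
  apply: mule_ge0; first by rewrite lee_fin invr_ge0 fine_ge0.
  by apply: integral_ge0 => t _; exact: err_ge0.
have -> : expected_weight_error P D Z e w M = (\int[P]_t h (V t))%E.
  rewrite /expected_weight_error; apply: eq_integral => t _.
  have E : (V t : 'I_n -> bool) = (fun i => (Z i t).2) by apply/funext => i; rewrite ffunE.
  by rewrite /h /cond_exp E -/(V t) VE E.
rewrite integral_finite_valued//; last by move=> v; rewrite VE; exact: measurable_treated.
rewrite mulr_sumr -sumEFin; apply: lee_sum => v _; rewrite VE /h ltr0n.
have p0 : 0 < \prod_i pw (v i) by apply: prodr_gt0 => i _; exact: pw_gt0.
have [N0|N0] := posnP (arm_size v w).
  by rewrite !(mule0, mul0e, mul0r, mulr0).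
have := treated_error N0; rewrite treated_probE -EFinM => le.
rewrite mule1 mul1r /= mulrCA; apply: le_trans le.
rewrite -muleA [X in (_ * X)%E]muleC [X in (_ * X)%E]muleA -EFinM mulfV ?mul1e//.
exact: lt0r_neq0.
Qed.

End sample_error.

Lemma convex_setP (R : realType) m (XX : set 'rV[R]_m) :
  convex_set (XX : set (convex_lmodType 'rV[R]_m)) ->
  forall x y t, XX x -> XX y -> 0 <= t <= 1 -> XX (t *: x + (1 - t) *: y).
Proof.
move=> cX x y t Xx Xy /andP[t0 t1].
have := cX x y (Itv01 t0 t1); rewrite !inE => /(_ Xx Xy).
by rewrite /conv /=.
Qed.

Lemma compact_coordinate_bound (R : realType) m (XX : set 'rV[R]_m) : compact XX ->
  exists K : R, forall x j, XX x -> `|x ord0 j| <= K.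
Proof.
move=> /compact_bounded [K [Kr KX]]; exists (K + 1) => x j Xx.
have h : K < K + 1 by rewrite ltrDl.
apply: le_trans (KX _ h _ Xx).
have /mapP[k _ ->] : `|x ord0 j| \in [seq `|x u.1 u.2| | u : 'I_1 * 'I_m].
  by apply/mapP; exists (ord0, j) => //=; rewrite mem_enum.
by rewrite [leRHS]/Num.norm /= mx_normrE; apply/bigmax_geP; right => /=; exists k.
Qed.

(** * The bound under the assumptions on the law of the sample *)

Section first_part.
Variables (d : measure_display) (T : measurableType d) (R : realType) (m n M : nat).
Variables (P : probability T R) (X : T -> 'rV[R]_m) (Y : bool -> T -> R) (D : T -> bool).
Variable Z : 'I_n -> T -> 'rV[R]_m * R * bool.
Variables (XX : set 'rV[R]_m) (e g : 'rV[R]_m -> R) (gD : bool -> 'rV[R]_m -> R).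
Variables (eta a gm gM L : R).
Hypothesis m_gt0 : (0 < m)%N.
Hypothesis n_gt0 : (0 < n)%N.
Hypothesis M_gt0 : (0 < M)%N.
Hypothesis cptX : compact XX.
Hypothesis cvxX : convex_set (XX : set (convex_lmodType 'rV[R]_m)).
Hypothesis mX : measurable_fun setT X.
Hypothesis mD : measurable_fun setT D.
Hypothesis iid : iid_copies P Z (fun t => (X t, Yobs Y D t, D t)).
Hypothesis eP : is_cprob P X (arm D true) e.
Hypothesis XXE : csupport P X setT = XX.
Hypothesis gP : is_density P X setT g.
Hypothesis eta_gt0 : 0 < eta.
Hypothesis eta_le1 : eta <= 1.
Hypothesis ov : overlap XX e eta.
Hypothesis gDP : forall b, is_density P X (arm D b) (gD b).
Hypothesis gm_gt0 : 0 < gm.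
Hypothesis L_gt0 : 0 < L.
Hypothesis a01 : 0 < a <= 1.
Hypothesis gD_itv : forall b x, csupport P X (arm D b) x -> gm <= gD b x <= gM.
Hypothesis gD_lip : lipschitz_densities P X D gD L.
Hypothesis regular : arm_regularity P X D a.

Let supp b : csupport P X (arm D b) = XX.
Proof. exact: (csupport_arm m_gt0 mX mD eP XXE gP eta_gt0 ov). Qed.

Let arm_laws : exists G : bool -> probability 'rV[R]_m R,
  forall b A, measurable A -> P (arm D b `&` X @^-1` A) = (P (arm D b) * G b A)%E.
Proof.
have law b := conditional_law (measurable_arm mD b) mX
  (arm_prob_gt0 m_gt0 mX mD eP XXE gP eta_gt0 ov b).
have [G0 [h0 _]] := law false; have [G1 [h1 _]] := law true.
by exists (fun b => if b then G1 else G0) => -[].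
Qed.

Let gD_itvX b x : XX x -> gm <= gD b x <= gM.
Proof. by move=> Xx; apply: gD_itv; rewrite supp. Qed.

Let gD_lipX b x z : XX x -> XX z -> `|gD b z - gD b x| <= L * edist x z.
Proof.
move=> Xx Xz; have := @gD_lip true x z; rewrite !supp ge_max => /(_ Xx Xz) /andP[].
by case: b.
Qed.

(** An arm law has a density and gives [XX] mass 1, so [XX] cannot be a null set. With convexity
    this yields the inscribed ball. *)
Let lam_gt0 : (0 < lebesgue_rV R m XX)%E.
Proof.
have [G GE] := arm_laws.
have [[_ _ dens] GX _ _] := arm_regular m_gt0 mX mD eP XXE gP eta_gt0 ov gDP gD_itvX gD_lipX GE true.
have mXX := measurable_XX m_gt0 mX XXE.
rewrite lt0e measure_ge0 andbT; apply/eqP => l0.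
have : G true XX = 0%E.
  rewrite dens//.
  by apply: null_set_integral => //; apply/measurable_EFinP; apply: measurable_funTS; have [] := gDP true.
have := probability_setC (G true) mXX; rewrite GX => /esym h h'.
by move: h; rewrite h' sube0 => /eqP; rewrite onee_eq0.
Qed.

Lemma support_inner_ball : exists c : 'rV[R]_m, exists2 rho, 0 < rho & eball c rho `<=` XX.
Proof.
have [K hK] := compact_coordinate_bound cptX.
exact: (convex_interior_ball m_gt0 (convex_setP cvxX) (measurable_XX m_gt0 mX XXE) hK lam_gt0).
Qed.

Lemma expected_weight_error_bound (c : 'rV[R]_m) (rho r0 : R) (w : bool) :
  0 < rho -> eball c rho `<=` XX ->
  (expected_weight_error P D Z e w M <=
   (carm m gm gM L a rho * (30 * matching_bound m r0 n%:R M%:R eta))%:E)%E.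
Proof.
move=> rho0 ball; have [G GE] := arm_laws.
have rg := arm_regular m_gt0 mX mD eP XXE gP eta_gt0 ov gDP gD_itvX gD_lipX GE.
have mXX := measurable_XX m_gt0 mX XXE.
have Xc : XX c by apply: ball; rewrite /eball /= edistxx ltW.
have gmM : gm <= gM by have /andP[] := gD_itvX true Xc; exact: le_trans.
have p0 := arm_prob_gt0 m_gt0 mX mD eP XXE gP eta_gt0 ov.
have p_ge b : eta <= fine (P (arm D b)).
  rewrite -lee_fin fineK; first exact: (arm_prob_ge m_gt0 mX mD eP XXE gP eta_gt0 ov).
  by rewrite fin_num_measure//; exact: measurable_arm.
have p_sum b := arm_prob_sum P mD b.
have fat z delta : XX z -> 0 < delta -> (delta%:E <= ediam XX)%E ->
  (a%:E * lebesgue_rV R m (eball z delta) <= lebesgue_rV R m (eball z delta `&` XX))%E.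
  by move=> Xz d0 dX; have := @regular true z delta; rewrite !supp; apply.
have odds := density_oddsE m_gt0 mX mD eP XXE gP eta_gt0 ov gDP gm_gt0 gD_itvX GE w.
have carm0 := carm_ge0 L m_gt0 gm_gt0 gmM a01 rho0.
have bnd (v : 'I_n -> bool) i (vi : v i = w) (Q : probability (n.-tuple 'rV[R]_m) R) QE :=
  @arm_bound R m XX gm gM L a m_gt0 mXX (convex_setP cvxX) gm_gt0 gmM L_gt0 a01 fat
   c rho rho0 ball n v w i M vi M_gt0 G gD rg Q QE (density_odds P D e w)
   (measurable_density_odds eP w) odds.
have m_odds := measurable_density_odds eP w.
apply: le_trans (expected_weight_error_le mD iid GE p0 m_odds carm0 (expR_ge0 _) bnd) _.
rewrite lee_fin ler_wpM2l//.
have p1 : 0 < fine (P (arm D w)) <= 1.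
  rewrite (lt_le_trans eta_gt0 (p_ge w))/=; have := p_sum w; have := p_ge (~~ w).
  by move: eta_gt0; lra.
apply: (le_trans (mean_arm_rate m_gt0 n_gt0 M_gt0 (p := fun b => fine (P (arm D b)))
  p1 (p_sum w) (expR_ge0 _))).
apply: mean_rate_matching_bound => //; first by rewrite eta_gt0.
Qed.

End first_part.

(** * The simplified rate *)

Section simple_rate.
Variables (R : realType) (m : nat).

Lemma ln2_lt1 : ln 2 < 1 :> R.
Proof.
rewrite -[ltRHS]expRK ltr_ln ?posrE ?expR_gt0//.
by have := @expR_gt1Dx R 1; rewrite oner_eq0; apply.
Qed.

Lemma expR1_le4 : expR 1 <= 4 :> R.
Proof.
have h : expR 2^-1 <= 2 :> R.
  rewrite -[leLHS]invrK -expRN -[leRHS]invrK lef_pV2 ?posrE ?expR_gt0//.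
  by have := @expR_ge1Dx R (- 2^-1); lra.
have -> : expR 1 = expR 2^-1 * expR 2^-1 :> R by rewrite -expRD; congr expR; lra.
rewrite (_ : 4 = 2 * 2); last by lra.
by apply: ler_pM => //; exact: expR_ge0.
Qed.

(** In the exponent plus 2 log n, each of the four terms M, M log u and twice log n is at most M log
    n, hence at most a quarter of c n, and -u compensates their sum. This uses log n >= 1; the
    factor 1/2 comes from 2n <= n^2. *)
Lemma tail_upper_vanish (n M : nat) (c u : R) :
  (9 <= n)%N -> (1 <= M)%N -> c * n%:R <= u <= n%:R -> 0 < c ->
  M%:R * ln n%:R / n%:R <= c / 4 ->
  n%:R * expR (M%:R - u - M%:R * ln M%:R + M%:R * ln u) <= 2^-1.
Proof.
move=> n9 M1 /andP[cu un] c0 small.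
have n0 : 0 < n%:R :> R by rewrite ltr0n; exact: leq_trans n9.
have M1R : 1 <= M%:R :> R by rewrite ler1n.
have u0 : 0 < u by apply: lt_le_trans cu; exact: mulr_gt0.
have ln1 : 1 <= ln n%:R :> R.
  rewrite -[leLHS]expRK ler_ln ?posrE ?expR_gt0//.
  apply: (@le_trans _ _ 4); first exact: expR1_le4.
  by rewrite ler_nat; exact: leq_trans n9.
have lnu : ln u <= ln n%:R by rewrite ler_ln// posrE.
have lnM : 0 <= ln M%:R :> R by exact: ln_ge0.
have h1 : M%:R * ln n%:R <= c / 4 * n%:R by rewrite -ler_pdivrMr.
have h2 : M%:R * ln u <= M%:R * ln n%:R by rewrite ler_pM2l// (lt_le_trans ltr01).
have h3 : ln n%:R <= M%:R * ln n%:R :> R by rewrite ler_peMl// (le_trans ler01).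
have h4 : M%:R <= M%:R * ln n%:R :> R by rewrite ler_peMr// (le_trans ler01).
have h5 : 0 <= M%:R * ln M%:R :> R by rewrite mulr_ge0// (le_trans ler01).
have two : 2 * n%:R <= n%:R ^+ 2 :> R.
  by rewrite expr2 ler_pM2r// ler_nat; exact: leq_trans n9.
set E := _ + _ * ln u.
have E0 : E + (ln n%:R + ln n%:R) <= 0 by rewrite /E; lra.
have : n%:R ^+ 2 * expR E <= 1.
  by rewrite -[n%:R in leLHS]lnK ?posrE// expr2 -!expRD -[leRHS]expR0 ler_expR addrC.
have := expR_gt0 E => e0 h.
have : 2 * n%:R * expR E <= 1 by apply: le_trans h; rewrite ler_pM2r.
by rewrite -mulrA; lra.
Qed.

Lemma tail_lower_vanish (n M : nat) (k : R) :
  (9 <= n)%N -> (1 <= M)%N -> ln n%:R / M%:R <= k / 2 ->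
  n%:R ^+ 2 * expR (- k * M%:R) <= 1.
Proof.
move=> n9 M1; have n0 : 0 < n%:R :> R by rewrite ltr0n; exact: leq_trans n9.
rewrite ler_pdivrMr ?ltr0n// => h.
rewrite -[n%:R in leLHS]lnK ?posrE// expr2 -!expRD -[leRHS]expR0 ler_expR; lra.
Qed.

Definition simple_const (l : R) : R :=
  (l ^+ 2)^-1 * root_dim m l^-1 + (l ^+ 4)^-1 +
  (l ^+ 2)^-1 * (4 + root_dim m l^-1 + l^-1).

Variables (n M : nat) (eta l r0 : R).
Hypothesis n_ge9 : (9 <= n)%N.
Hypothesis M_itv : (1 <= M <= n)%N.
Hypothesis l_gt0 : 0 < l.
Hypothesis eta_itv : l <= eta <= 2^-1.
Hypothesis r0_itv : 0 < r0 <= 1.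

Let n0 : 0 < n%:R :> R. Proof. by rewrite ltr0n; exact: leq_trans n_ge9. Qed.
Let M0 : 0 < M%:R :> R. Proof. by case/andP: M_itv; rewrite ltr0n. Qed.
Let M1 : 1 <= M%:R :> R. Proof. by case/andP: M_itv; rewrite ler1n. Qed.
Let Mn : M%:R <= n%:R :> R. Proof. by case/andP: M_itv => _; rewrite ler_nat. Qed.
Let eta0 : 0 < eta. Proof. by case/andP: eta_itv => h _; exact: lt_le_trans h. Qed.
Let eta1 : eta <= 1. Proof. by case/andP: eta_itv => _ h; lra. Qed.
Let le_eta : l <= eta. Proof. by case/andP: eta_itv. Qed.
Let ne0 : 0 < n%:R * eta. Proof. exact: mulr_gt0. Qed.
Let eta2_le : (eta ^+ 2)^-1 <= (l ^+ 2)^-1.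
Proof. by rewrite lef_pV2 ?posrE ?exprn_gt0// lerXn2r ?nnegrE ?(ltW l_gt0) ?(ltW eta0). Qed.
Let eta4_le : (eta ^+ 4)^-1 <= (l ^+ 4)^-1.
Proof. by rewrite lef_pV2 ?posrE ?exprn_gt0// lerXn2r ?nnegrE ?(ltW l_gt0) ?(ltW eta0). Qed.
Let eta2_ge1 : 1 <= (eta ^+ 2)^-1.
Proof. by rewrite invf_ge1 ?exprn_gt0// expr_le1// ltW. Qed.
Let tail_ge0 : 0 <= delta_tail r0 n%:R M%:R eta.
Proof. exact: delta_tail_ge0. Qed.

Lemma simple_rate_le_bound :
  simple_rate m n%:R M%:R <= matching_bound m r0 n%:R M%:R eta.
Proof.
have H1 := delta_H1_ge0 n%:R M%:R r0 (ltW eta0).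
have H2 := delta_H2_ge0 m r0 (ltW n0) (ltW M0) (ltW eta0).
have H3 := delta_H3_ge0 n%:R M%:R eta.
have h1 : root_dim m (M%:R / n%:R) <= (eta ^+ 2)^-1 * root_dim m (M%:R / (n%:R * eta)).
  apply: (@le_trans _ _ (root_dim m (M%:R / (n%:R * eta)))).
    apply: ler_root_dim; first by rewrite divr_ge0// ltW.
    by rewrite ler_pM2l// lef_pV2 ?posrE// ler_piMr// ltW.
  by rewrite ler_peMl// root_dim_ge0.
have h2 : M%:R^-1 <= (delta_H2 m r0 n%:R M%:R eta + 1) * (eta ^+ 2 * M%:R)^-1.
  rewrite invfM mulrA ler_peMl//; rewrite -[leLHS]mul1r; apply: ler_pM => //; by rewrite lerDr.
move: h1 h2; rewrite /matching_bound /simple_rate /root_dim; lra.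
Qed.

Hypothesis low_small : ln n%:R / M%:R <= (1 - ln 2) / 2 :> R.
Hypothesis high_small : M%:R * ln n%:R / n%:R <= r0 * l / 4.

Let low_tail : n%:R ^+ 2 * expR (- (1 - ln 2) * M%:R) <= 1 :> R.
Proof. by apply: tail_lower_vanish => //; case/andP: M_itv. Qed.

Let tail_le : n%:R * delta_tail r0 n%:R M%:R eta <= 1.
Proof.
have [r00 r01] := andP r0_itv.
have h1 : n%:R * expR (- (1 - ln 2) * M%:R) <= 2^-1 :> R.
  have two : 2 * n%:R <= n%:R ^+ 2 :> R.
    by rewrite expr2 ler_pM2r// ler_nat; exact: leq_trans n_ge9.
  have e0 : 0 < expR (- (1 - ln 2) * M%:R) :> R by exact: expR_gt0.
  have : 2 * n%:R * expR (- (1 - ln 2) * M%:R) <= 1 :> R.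
    by apply: le_trans low_tail; rewrite ler_pM2r.
  by rewrite -mulrA; lra.
have h2 := @tail_upper_vanish n M (r0 * l) (r0 * n%:R * eta) n_ge9 _ _ _ high_small.
rewrite /delta_tail mulrDr [leRHS](_ : 1 = 2^-1 + 2^-1); last by lra.
apply: lerD => //; apply: h2; [by case/andP: M_itv| |exact: mulr_gt0].
apply/andP; split.
  by rewrite mulrAC ler_pM2l// mulr_gt0.
by rewrite mulrAC ler_piMl ?(ltW n0)// mulr_ile1 ?(ltW r00) ?(ltW eta0).
Qed.

Lemma bound_le_simple_rate :
  matching_bound m r0 n%:R M%:R eta <= simple_const l * simple_rate m n%:R M%:R.
Proof.
have li0 : 0 <= l^-1 by rewrite invr_ge0 ltW.
have l20 : 0 <= (l ^+ 2)^-1 by rewrite invr_ge0 sqr_ge0.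
have l40 : 0 <= (l ^+ 4)^-1 by rewrite invr_ge0 exprn_ge0// ltW.
have rl0 : 0 <= root_dim m l^-1 by exact: root_dim_ge0.
have e20 : 0 <= (eta ^+ 2)^-1 by rewrite invr_ge0 sqr_ge0.
have Mn0 : 0 <= M%:R / n%:R :> R by rewrite divr_ge0// ltW.
have Mn1 : M%:R / n%:R <= 1 :> R by rewrite ler_pdivrMr// mul1r.
pose ro : R := root_dim m (M%:R / n%:R).
have ro0 : 0 <= ro by exact: root_dim_ge0.
have ro1 : ro <= 1.
  by have := ler_root_dim m Mn0 Mn1; rewrite {2}/root_dim powR1.
have roE : root_dim m (M%:R / (n%:R * eta)) <= root_dim m l^-1 * ro.
  rewrite /ro -root_dimM//; apply: ler_root_dim; first by rewrite divr_ge0// ltW.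
  by rewrite invfM mulrA mulrC ler_wpM2r// lef_pV2.
(* An error of order 1/n compensates the growth of n/(M eta), and what remains is of order 1/M. *)
have nM t : 0 <= t -> n%:R * t <= 1 -> n%:R / (M%:R * eta) * t <= l^-1 * M%:R^-1.
  move=> t0 nt.
  apply: (@le_trans _ _ ((M%:R * eta)^-1)).
    by rewrite mulrAC ler_piMl// invr_ge0 mulr_ge0// ltW.
  by rewrite invfM mulrC ler_wpM2r// lef_pV2.
have nMe : 0 <= n%:R / (M%:R * eta) by rewrite divr_ge0 ?mulr_ge0// ltW.
have liM : 0 <= l^-1 / M%:R by exact: mulr_ge0.
have iM1 : M%:R^-1 <= 1 :> R by rewrite invf_le1.
have sqM : (l^-1 * M%:R^-1) ^+ 2 <= (l ^+ 2)^-1 * M%:R^-1.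
  rewrite exprMn -exprVn ler_wpM2l ?sqr_ge0//.
  by rewrite expr2 ler_piMr.
have H1 : delta_H1 r0 n%:R M%:R eta <= (l ^+ 4)^-1 * M%:R^-1 + (l ^+ 2)^-1 * M%:R^-1.
  apply: lerD.
    rewrite invfM mulrC; apply: ler_pM => //; rewrite ?invr_ge0 ?sqr_ge0 ?exprn_ge0 ?(ltW eta0)//.
    rewrite lef_pV2 ?posrE ?exprn_gt0//; apply: le_trans Mn _.
    by rewrite expr2 ler_peMl ?(ltW n0)// (le_trans M1).
  rewrite -exprMn; apply: le_trans sqM.
  by rewrite lerXn2r ?nnegrE ?nM// mulr_ge0.
have H3 : delta_H3 n%:R M%:R eta <= (l ^+ 2)^-1 * M%:R^-1.
  apply: le_trans sqM; rewrite /delta_H3.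
  have lt := low_tail; set t := expR _ in lt *.
  have t0 : 0 <= t by exact: expR_ge0.
  (* The tail is only known to be at most 1/n^2; its square root is at most 1/n, as [nM] asks. *)
  have -> : (n%:R / (M%:R * eta)) ^+ 2 * t = (n%:R / (M%:R * eta) * Num.sqrt t) ^+ 2.
    by rewrite [RHS]exprMn sqr_sqrtr.
  rewrite lerXn2r ?nnegrE//; first by rewrite mulr_ge0 ?sqrtr_ge0.
  apply: nM; first exact: sqrtr_ge0.
  rewrite -(@ler_pXn2r _ 2) ?nnegrE ?mulr_ge0 ?sqrtr_ge0// expr1n exprMn sqr_sqrtr//.
have H2 : delta_H2 m r0 n%:R M%:R eta <= root_dim m l^-1 + l^-1 + 1.
  apply: lerD; first apply: lerD.
  - by apply: le_trans roE _; rewrite ler_piMr.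
  - rewrite lef_pV2 ?posrE//; apply: le_trans le_eta _.
    by rewrite ler_peMl ?(ltW eta0)// (le_trans M1).
  - apply: le_trans tail_le; rewrite mulrAC ler_piMr// mulr_ge0// ltW//.
have H2' : (delta_H2 m r0 n%:R M%:R eta + 1) * (eta ^+ 2 * M%:R)^-1 <=
    (root_dim m l^-1 + l^-1 + 2) * ((l ^+ 2)^-1 * M%:R^-1).
  have H20 := delta_H2_ge0 m r0 (ltW n0) (ltW M0) (ltW eta0).
  rewrite invfM; apply: ler_pM; [by rewrite addr_ge0|by rewrite mulr_ge0|lra|].
  by rewrite ler_wpM2r.
have T1 : (eta ^+ 2)^-1 * root_dim m (M%:R / (n%:R * eta)) <=
    (l ^+ 2)^-1 * (root_dim m l^-1 * ro).
  by apply: ler_pM => //; exact: root_dim_ge0.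
rewrite /matching_bound /simple_rate -/(root_dim m (M%:R / n%:R)) -/ro -/(root_dim m _).
have p1 : 0 <= (l ^+ 2)^-1 * root_dim m l^-1 by exact: mulr_ge0.
have p2 : 0 <= (l ^+ 2)^-1 * (4 + root_dim m l^-1 + l^-1).
  by rewrite mulr_ge0// !addr_ge0.
have p3 : 0 <= ((l ^+ 4)^-1 + (l ^+ 2)^-1 * (4 + root_dim m l^-1 + l^-1)) * ro.
  by rewrite mulr_ge0// addr_ge0.
have p4 : 0 <= (l ^+ 2)^-1 * root_dim m l^-1 * M%:R^-1 by rewrite mulr_ge0.
apply: (le_trans (lerD (lerD (lerD T1 H1) H2') H3)).
rewrite -subr_ge0 /simple_const.
set A := (l ^+ 2)^-1 in p1 p2 p3 p4 *; set B4 := (l ^+ 4)^-1 in p3 *.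
set rl := root_dim m l^-1 in p1 p2 p3 p4 *; set Mv := M%:R^-1 in p4 *; set il := l^-1 in p2 p3 *.
have -> : (A * rl + B4 + A * (4 + rl + il)) * (ro + Mv) -
  (A * (rl * ro) + (B4 * Mv + A * Mv) + (rl + il + 2) * (A * Mv) + A * Mv) =
  (B4 + A * (4 + rl + il)) * ro + A * rl * Mv by ring.
exact: addr_ge0.
Qed.

End simple_rate.

Lemma r_zero_itv (R : realType) m (c : constants R) : admissible m c -> 0 < r_zero c <= 1.
Proof.
move=> [[_ gDc] _ _ _ [gphic _ _ _]].
have r01 (a b : R) : 0 < a <= b -> 0 < a / b <= 1.
  by move=> /andP[a0 ab]; have b0 := lt_le_trans a0 ab; rewrite divr_gt0// ler_pdivrMr// mul1r.
have D b := r01 _ _ (gDc b); have F b i := r01 _ _ (gphic b i).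
have [D1 D2] := andP (D true); have [D3 D4] := andP (D false).
have [F1 F2] := andP (F true true); have [F3 F4] := andP (F true false).
have [F5 F6] := andP (F false true); have [F7 F8] := andP (F false false).
by rewrite /r_zero /r_ratio /r_ratio_phi !lt_max !ge_max D1 D2 D4 F2 F4 F6 F8 !orbT.
Qed.

(** * A constant uniform over all samples, and the equivalence of the two rates *)

Theorem lemmaA4 (R : realType) (m m' : nat) (XX : set 'rV[R]_m)
    (c : constants R) :
  (0 < m)%N ->
  compact XX -> convex_set (XX : set (convex_lmodType 'rV[R]_m)) ->
  admissible m c ->
  (exists C : R, exists N : nat, 0 < C /\
    forall (n M : nat) (eta : R),
    (9 <= n)%N -> (N <= n)%N -> (1 <= M <= n)%N -> 0 < eta <= 2^-1 ->
    M%:R <= C0 c * n%:R * eta -> C1 c <= n%:R * eta ^+ 2 ->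
    forall (d : measure_display) (T : measurableType d) (P : probability T R)
      (X : T -> 'rV[R]_m) (Y : bool -> T -> R) (D : T -> bool)
      (Z : 'I_n -> T -> 'rV[R]_m * R * bool)
      (e : 'rV[R]_m -> R) (g : 'rV[R]_m -> R) (gD : bool -> 'rV[R]_m -> R)
      (mu : bool -> 'rV[R]_m -> R)
      (est : bool -> ('I_n -> 'rV[R]_m * R * bool) -> 'rV[R]_m -> R)
      (phi : bool -> 'rV[R]_m -> 'rV[R]_m')
      (gphi : bool -> bool -> 'rV[R]_m' -> R) (Sphi : bool -> set 'rV[R]_m'),
    measurable_fun setT X -> (forall w, measurable_fun setT (Y w)) ->
    measurable_fun setT D ->
    iid_copies P Z (fun t => (X t, Yobs Y D t, D t)) ->
    is_cprob P X (arm D true) e ->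
    (forall w, is_cmean P X (arm D w) (Yobs Y D) (mu w)) ->
    csupport P X setT = XX ->
    is_density P X setT g ->
    (forall x, XX x -> g_min c <= g x <= g_max c) ->
    cond_indep_potential_outcomes P X Y D ->
    overlap XX e eta ->
    (forall i, is_density P X (arm D i) (gD i)) ->
    (forall i x, csupport P X (arm D i) x ->
       gD_min c i <= gD i x <= gD_max c i) ->
    lipschitz_densities P X D gD (lip c) ->
    arm_regularity P X D (ball_frac c) ->
    (forall i, (surface_area (csupport P X (arm D i)) <= (area c)%:E)%E) ->
    (forall w, (\int[P]_t (mu w (X t) ^+ 2)%:E <= (mu_sq c)%:E)%E) ->
    outcome_moments P X Y D XX mu (var_min c) (mom_exp c) (mom_max c) ->
    (forall w, Ck_on (m./2).+1 XX (mu w)) ->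
    (forall w, (max_mderiv (m./2).+1 XX (mu w) <= (mu_deriv c)%:E)%E) ->
    regression_estimators P Z XX mu est (est_bound c) (est_rate c) ->
    (forall w, measurable_fun setT (phi w)) ->
    (forall w i, is_density P (phi w \o X) (arm D i) (gphi w i)) ->
    (forall w i, csupport P (phi w \o X) (arm D i) = Sphi i) ->
    (forall w i x, Sphi i x ->
       gphi_min c w i <= gphi w i x <= gphi_max c w i) ->
    let B := (C * matching_bound m (r_zero c) n%:R M%:R eta)%:E in
    (expected_weight_error P D Z e false M <= B)%E /\
    (expected_weight_error P D Z e true M <= B)%E) /\
  (forall eta_low : R, 0 < eta_low ->
    exists2 C : R, 0 < C &
    forall (M : nat -> nat) (eta : nat -> R),
    (forall n, (9 <= n)%N -> (1 <= M n <= n)%N) ->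
    (forall n, eta_low <= eta n <= 2^-1) ->
    (fun n => ln (n%:R : R) / (M n)%:R) @ \oo --> (0 : R) ->
    (fun n => (M n)%:R * ln (n%:R : R) / n%:R) @ \oo --> (0 : R) ->
    \forall n \near \oo,
      let B := matching_bound m (r_zero c) n%:R (M n)%:R (eta n) in
      B <= C * simple_rate m n%:R (M n)%:R /\
      simple_rate m n%:R (M n)%:R <= C * B).
Proof.
move=> m0 cptX cvxX adm; split; last first.
  move=> l l0; have r01 := r_zero_itv adm; have [r00 r0le] := andP r01.
  have li0 : 0 < l^-1 by rewrite invr_gt0.
  have sc0 : 0 <= simple_const m l.
    have h2 : 0 <= (l ^+ 2)^-1 by rewrite invr_ge0 sqr_ge0.
    have h4 : 0 <= (l ^+ 4)^-1 by rewrite invr_ge0 exprn_ge0// ltW.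
    have hr := root_dim_ge0 m l^-1.
    rewrite /simple_const; apply: addr_ge0; first by apply: addr_ge0 => //; exact: mulr_ge0.
    by apply: mulr_ge0 => //; rewrite !addr_ge0// ltW.
  (* One constant for both directions: at least [simple_const] for the upper bound and at least 1
     for the lower one. *)
  exists (1 + simple_const m l); first by rewrite ltr_wpDr.
  move=> M eta MP etaP cvg1 cvg2.
  have k1 : 0 < (1 - ln 2) / 2 :> R by rewrite divr_gt0// subr_gt0 ln2_lt1.
  have k2 : 0 < r_zero c * l / 4 by rewrite divr_gt0// mulr_gt0.
  have near1 : \forall n \near \oo, ln n%:R / (M n)%:R <= (1 - ln 2) / 2 :> R.
    exact: (cvgr_le _ cvg1 _ k1).
  have near2 : \forall n \near \oo, (M n)%:R * ln n%:R / n%:R <= r_zero c * l / 4 :> R.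
    exact: (cvgr_le _ cvg2 _ k2).
  near=> n; have n9 : (9 <= n)%N by near: n; exact: nbhs_infty_ge.
  have h1 : ln n%:R / (M n)%:R <= (1 - ln 2) / 2 :> R by near: n.
  have h2 : (M n)%:R * ln n%:R / n%:R <= r_zero c * l / 4 by near: n.
  have lb := simple_rate_le_bound m (r_zero c) n9 (MP n n9) l0 (etaP n).
  have ub := bound_le_simple_rate m n9 (MP n n9) l0 (etaP n) r01 h1 h2.
  have s0 : 0 <= simple_rate m n%:R (M n)%:R :> R.
    by rewrite /simple_rate addr_ge0 ?powR_ge0// invr_ge0.
  have b0 := le_trans s0 lb.
  split; first by apply: le_trans ub _; rewrite ler_wpM2r// lerDr.
  by apply: le_trans lb _; rewrite ler_peMl// lerDl.
have [[[_ gDc] [lip0 a01 _] _ _ _]] := adm.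
pose gm := Num.min (gD_min c false) (gD_min c true).
pose gM := Num.max (gD_max c false) (gD_max c true).
have gm0 : 0 < gm.
  by rewrite lt_min; have /andP[-> _] := gDc false; have /andP[-> _] := gDc true.
have gD_itv i z : gD_min c i <= z <= gD_max c i -> gm <= z <= gM.
  by move=> /andP[h1 h2]; rewrite ge_min le_max; case: i h1 h2 => -> ->; rewrite ?orbT.
have a1 : 0 < ball_frac c <= 1 by case/andP: a01 => -> /ltW ->.
(* The constant has to be chosen before any sample is given, whereas an inscribed ball is obtained
   from the law of a sample. If there is no such ball, no sample satisfies the assumptions and any
   constant will do. *)
have [[ctr [rho rho0 ball]]|noball] :=
  pselect (exists x : 'rV[R]_m, exists2 rho, 0 < rho & eball x rho `<=` XX); last first.
  exists 1, 0%N; split => // n M eta n9 _ M1n eta01 _ _ d T P X Y D Z e g gD mu est phi gphi Sphi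
    mX _ mD iid eP _ XXE gP _ _ ov gDP gDb lipD regD _ _ _ _ _ _ _ _ _ _ B.
  exfalso; apply: noball; have [eta0 _] := andP eta01.
  exact: (support_inner_ball m0 cptX cvxX mX mD eP XXE gP eta0 ov gDP
    (fun b x h => gD_itv b _ (gDb b x h)) lipD).
(* The summand 1 makes the constant positive, since [carm] is only known to be nonnegative. *)
exists (carm m gm gM (lip c) (ball_frac c) rho * 30 + 1), 0%N.
have gmM : gm <= gM.
  have /andP[_ h] := gDc false; rewrite ge_min; apply/orP; left.
  by rewrite le_max h.
have K0 := carm_ge0 (lip c) m0 gm0 gmM a1 rho0.
split; first by rewrite ltr_wpDl// mulr_ge0.
move=> n M eta n9 _ M1n eta01 _ _ d T P X Y D Z e g gD mu est phi gphi Sphi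
  mX _ mD iid eP _ XXE gP _ _ ov gDP gDb lipD regD _ _ _ _ _ _ _ _ _ _ B.
have [eta0 eta2] := andP eta01.
have eta1 : eta <= 1 by lra.
have [M1 _] := andP M1n; have n1 : (0 < n)%N by exact: leq_trans n9.
have s0 : 0 <= simple_rate m n%:R M%:R :> R.
  by rewrite /simple_rate addr_ge0 ?powR_ge0// invr_ge0.
have b0 : 0 <= matching_bound m (r_zero c) n%:R M%:R eta.
  by apply: le_trans s0 _; apply: (simple_rate_le_bound m (r_zero c) n9 M1n eta0); rewrite lexx.
have bnd w : (expected_weight_error P D Z e w M <= B)%E.
  apply: le_trans (expected_weight_error_bound m0 n1 M1 cvxX mX mD iid eP XXE gP eta0 eta1 ov gDP
    gm0 lip0 a1 (fun b x h => gD_itv b _ (gDb b x h)) lipD regD (r_zero c) w rho0 ball) _.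
  by rewrite /B lee_fin mulrA ler_wpM2r// lerDl.
by split; exact: bnd.
Unshelve. all: by end_near.
Qed.
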